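(* Let $L>0$ and let $\alpha$ be a positive number with $\alpha<(\log3-\log2)/\log3$. Then there exist a constant $c>0$ and $d_0\in\mathbb N$ such that the following holds for all positive integers $n$, $d$, $d^*$ with $d_0\le d^*\le d$. Let $\boldsymbol X_1,\dots,\boldsymbol X_n\in[0,1]^d$ be a deterministic design satisfying $$\Big|\frac1n\sum_{i=1}^n\varphi_{\boldsymbol k}(\boldsymbol X_i)\varphi_{\boldsymbol k'}(\boldsymbol X_i)\Big|\le\frac{n}{N_1(d^*,L)^2}$$ for all distinct $\boldsymbol k,\boldsymbol k'\in S_{(d^*L)^{1/2},d^*}$. Let $\gamma^*$ be the largest (positive) real number such that $d^*\gamma^*$ is an integer and $L\ge\gamma^*\big(1+\frac1{2z_{\gamma^*}}\big)$. If $$\frac{\big(N_1(d^*,\gamma^* )-N_2(d^*,\gamma^* )\big)^2\log\binom{d}{d^*}}{n^2N_1(d^*,\gamma^* )}\ \ge\ \frac{5}{\alpha},$$ then $$\inf_{\widetilde J}\ \sup_{f\in\widetilde\Sigma_L}\mathbf P_f\big(\widetilde J\ne J_f\big)\ge c,$$ where the infimum is over all estimators $\widetilde J$ of the sparsity pattern $J_f$.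
   Context: Model: $Y_i=f(\boldsymbol X_i)+\varepsilon_i$, $i=1,\dots,n$, with $\varepsilon_i$ i.i.d. $\mathcal N(0,1)$ and fixed design points $\boldsymbol X_i\in[0,1]^d$; $\mathbf P_f$ is the law of $(Y_1,\dots,Y_n)$ when the regression function is $f$. An estimator $\widetilde J$ is any measurable map from the observations to subsets of $\{1,\dots,d\}$. Fourier basis: for $\boldsymbol k\in\mathbb Z^d$, $\varphi_{\boldsymbol k}(\boldsymbol x)=1$ if $\boldsymbol k=0$; $\sqrt2\cos(2\pi\boldsymbol k\cdot\boldsymbol x)$ if $\boldsymbol k\in(\mathbb Z^d)_+$; $\sqrt2\sin(2\pi\boldsymbol k\cdot\boldsymbol x)$ if $-\boldsymbol k\in(\mathbb Z^d)_+$, where $(\mathbb Z^d)_+$ is the set of $\boldsymbol k\in\mathbb Z^d\setminus\{0\}$ whose first nonzero coordinate is positive. Put $\theta_{\boldsymbol k}[f]=\int_{[0,1]^d}f\varphi_{\boldsymbol k}\,d\boldsymbol x$ and $Q_j[f]=\sum_{\boldsymbol k:\,k_j\ne0}\theta_{\boldsymbol k}[f]^2$. Functional class: $\widetilde\Sigma_L$ is the set of all functions $f$ such that (i) $\sum_{\boldsymbol k\in\mathbb Z^d}k_j^2\theta_{\boldsymbol k}[f]^2\le L$ for all $j\in\{1,\dots,d\}$; and (ii) there is $J\subset\{1,\dots,d\}$ of cardinality $\le d^*$ and a function $\bar f:\mathbb R^{|J|}\to\mathbb R$ with $f(\boldsymbol x)=\bar f(\boldsymbol x_J)$ for all $\boldsymbol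 x\in\mathbb R^d$ and $Q_j[f]\ge1$ for all $j\in J$. This set $J=:J_f$ is the sparsity pattern of $f$ (it equals $\{j:Q_j[f]\ne0\}$). Index set: $S_{m,\ell}=\{\boldsymbol k\in\mathbb Z^d:\|\boldsymbol k\|_2\le m,\ \|\boldsymbol k\|_0\le\ell\}$, with $\|\boldsymbol k\|_0$ the number of nonzero coordinates. Lattice-point counts: $N_1(d^*,\gamma)=\mathrm{Card}\{\boldsymbol k\in\mathbb Z^{d^*}:k_1^2+\dots+k_{d^*}^2\le\gamma d^*\}$ and $N_2(d^*,\gamma)=\mathrm{Card}\{\boldsymbol k\in\mathbb Z^{d^*}:k_2^2+\dots+k_{d^*}^2\le\gamma d^*,\ k_1=0\}$. Saddle point: with $h(z)=\sum_{r\in\mathbb Z}z^{r^2}$ for $|z|<1$ and $l_\gamma(z)=\log h(z)-\gamma\log z$, for $\gamma>0$ the number $z_\gamma$ is the unique solution in $(0,1)$ of $l_\gamma'(z)=0$. *)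

(* Defs.v *)
From HB Require Import structures.
From mathcomp Require Import all_boot all_order all_algebra finmap.
From mathcomp Require Import all_classical all_reals all_analysis.

Set Implicit Arguments.
Unset Strict Implicit.
Unset Printing Implicit Defensive.
Import Order.TTheory GRing.Theory Num.Theory.
Import numFieldNormedType.Exports.

Local Open Scope classical_set_scope.
Local Open Scope ring_scope.

Section PowerMeasure.
Local Open Scope ereal_scope.
Context d (T : measurableType d) (R : realType).
Variable m : {sigma_finite_measure set T -> \bar R}.

Definition tcons n (x : T * n.-tuple T) : n.+1.-tuple T := [tuple of x.1 :: x.2].

Lemma measurable_tcons n : measurable_fun [set: T * n.-tuple T] (@tcons n).
Proof. exact: measurable_cons. Qed.

HB.instance Definition _ n :=
  isMeasurableFun.Build _ _ _ _ (@tcons n) (@measurable_tcons n).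

Section Cons.
Variables (n : nat) (p : {sigma_finite_measure set (n.-tuple T) -> \bar R}).

Definition cons_measure : set (n.+1.-tuple T) -> \bar R :=
  pushforward (m \x p) (@tcons n).

Let cons_measure0 : cons_measure set0 = 0.
Proof. by rewrite /cons_measure /pushforward preimage_set0 measure0. Qed.

Let cons_measure_ge0 A : 0 <= cons_measure A.
Proof. exact: measure_ge0. Qed.

Let cons_measure_sigma_additive : semi_sigma_additive cons_measure.
Proof. exact: measure_semi_sigma_additive. Qed.

HB.instance Definition _ := isMeasure.Build _ _ _ cons_measure
  cons_measure0 cons_measure_ge0 cons_measure_sigma_additive.

Lemma cons_measure_sigma_finite : sigma_finite setT cons_measure.
Proof.
have /sigma_finiteP[F [FT ndF Foo]] := sigma_finiteT m.
have /sigma_finiteP[G [GT ndG Goo]] := sigma_finiteT p.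
exists (fun k => (@thead n T) @^-1` F k `&`
  (fun t : n.+1.-tuple T => [tuple of behead t]) @^-1` G k).
  apply/seteqP; split => // t _.
  have : [set: T] (thead t) by [].
  have : [set: n.-tuple T] [tuple of behead t] by [].
  rewrite FT GT => -[j _ Gj] [i _ Fi]; exists (maxn i j) => //; split => /=.
    by move: Fi; exact/subsetPset/ndF/leq_maxl.
  by move: Gj; exact/subsetPset/ndG/leq_maxr.
move=> k; have [mF Fk] := Foo k; have [mG Gk] := Goo k; split.
  apply: measurableI; rewrite -[_ @^-1` _]setTI; first exact: measurable_tnth.
  exact: measurable_behead.
rewrite /cons_measure /pushforward.
rewrite (_ : _ @^-1` _ = F k `*` G k).
  by rewrite product_measure1E// lte_mul_pinfty// ge0_fin_numE.
by apply/seteqP; split=> -[x t] /= []; rewrite theadE (_ : [tuple of behead [tuple of x :: t]] = t)//; apply: val_inj.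
Qed.

HB.instance Definition _ := Measure_isSigmaFinite.Build _ _ _
  cons_measure cons_measure_sigma_finite.

End Cons.

(* The n-fold product measure m \x ... \x m on n.-tuple T. *)
Fixpoint power_measure n : {sigma_finite_measure set (n.-tuple T) -> \bar R} :=
  match n with
  | 0 => dirac [tuple]
  | k.+1 => cons_measure (power_measure k)
  end.

Lemma power_measure_box n (A : 'I_n -> set T) :
  (forall i, measurable (A i)) ->
  power_measure n [set t | forall i, A i (tnth t i)] = \prod_(i < n) m (A i).
Proof.
elim: n A => [|n IH] A mA.
  rewrite big_ord0 /= diracE mem_set//.
  by case.
rewrite big_ord_recl -IH//= /cons_measure /pushforward -product_measure1E//.
  congr ((m \x power_measure n) _); apply/seteqP; split=> -[x t] /=.
    move=> At; split; first exact: (At ord0).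
    by move=> i; have := At (lift ord0 i); rewrite tnthS.
  move=> [Ax At] i; case: (unliftP ord0 i) => [j|] ->//.
  by rewrite tnthS; exact: At.
rewrite (_ : mkset _ =
    \bigcap_(i in [set: 'I_n]) ((@tnth n T ^~ i) @^-1` A (lift ord0 i))).
  apply: fin_bigcap_measurable => // i _.
  by rewrite -[_ @^-1` _]setTI; exact: measurable_tnth.
by apply/seteqP; split => t /= At i; [move=> _|]; exact: At.
Qed.

End PowerMeasure.

Section Model.
Context {R : realType}.

Definition vec d := d.-tuple (measurableTypeR R).
Definition freq d := {ffun 'I_d -> int}.

Definition lebesgue_vec d := power_measure (@lebesgue_measure R) d.

Definition cube d : set (vec d) :=
  [set x | forall j, 0 <= tnth x j <= 1].

Definition dot d (k : freq d) (x : vec d) : R :=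
  \sum_j (k j)%:~R * tnth x j.

(* The first nonzero coordinate of k is positive. *)
Definition pos_freq d (k : freq d) : bool :=
  [exists j : 'I_d,
     (0 < k j) && [forall i : 'I_d, (i < j)%N ==> (k i == 0)]].

Definition fourier d (k : freq d) (x : vec d) : R :=
  if k == 0 then 1
  else if pos_freq k then Num.sqrt 2 * cos (2 * pi * dot k x)
  else Num.sqrt 2 * sin (2 * pi * dot k x).

Definition theta d (f : vec d -> R) (k : freq d) : R :=
  \int[lebesgue_vec d]_(x in @cube d) (f x * fourier k x).

Definition Q d (f : vec d -> R) (j : 'I_d) : \bar R :=
  \esum_(k in [set k : freq d | k j != 0]) (theta f k ^+ 2)%:E.

Definition subvec d (J : {set 'I_d}) (x : vec d) : vec #|J| :=
  [tuple tnth x (enum_val i) | i < #|J|].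

Definition is_pattern d (dstar : nat) (f : vec d -> R) (J : {set 'I_d}) :=
  [/\ (#|J| <= dstar)%N,
      exists fbar : vec #|J| -> R, forall x, f x = fbar (subvec J x)
    & forall j, j \in J -> (1 <= Q f j)%E].

(* Integrability over the cube is what makes every theta f k meaningful;
   membership then forces f to be square integrable on the cube. *)
Definition Sigma d (L : R) (dstar : nat) : set (vec d -> R) :=
  [set f | [/\ (lebesgue_vec d).-integrable (@cube d) (EFin \o f),
      forall j : 'I_d,
        (\esum_(k in [set: freq d]) ((k j)%:~R ^+ 2 * theta f k ^+ 2)%R%:E
           <= L%:E)%E
    & exists J, is_pattern dstar f J]].

(* The default value set0 is irrelevant for f in the class Sigma. *)
Definition pattern d (dstar : nat) (f : vec d -> R) : {set 'I_d} :=
  xget (finset.set0) [set J | is_pattern dstar f J].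

Definition observe n d (f : vec d -> R) (X : 'I_n -> vec d)
    (eps : vec n) : vec n :=
  [tuple f (X i) + tnth eps i | i < n].

(* The law P_f of (Y_1, ..., Y_n), Y_i = f (X_i) + eps_i, eps_i i.i.d. N(0,1). *)
Definition law n d (X : 'I_n -> vec d) (f : vec d -> R) :
    set (vec n) -> \bar R :=
  pushforward (power_measure (normal_prob (0 : R) 1) n) (observe f X).

(* Measurability for the discrete sigma-algebra on subsets of {1, ..., d}. *)
Definition estimator n d : set (vec n -> {set 'I_d}) :=
  [set Jt | forall A : set {set 'I_d}, measurable (Jt @^-1` A)].

Definition minimax_error n d (L : R) (dstar : nat) (X : 'I_n -> vec d) :
    \bar R :=
  ereal_inf [set ereal_sup
      [set law X f [set y | Jt y != pattern dstar f] | f in Sigma L dstar]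
    | Jt in @estimator n d].

Definition norm2 d (k : freq d) : R := Num.sqrt (\sum_j (k j)%:~R ^+ 2).
Definition norm0 d (k : freq d) : nat := #|[set j | k j != 0]%SET|.

Definition S_freq d (m : R) (l : nat) : set (freq d) :=
  [set k | norm2 k <= m /\ (norm0 k <= l)%N].

Definition ball1 (dstar : nat) (g : R) : set (freq dstar) :=
  [set k | \sum_j (k j)%:~R ^+ 2 <= g * dstar%:R].

Definition ball2 (dstar : nat) (g : R) : set (freq dstar) :=
  [set k | \sum_(j < dstar | (0 < j)%N) (k j)%:~R ^+ 2 <= g * dstar%:R
    /\ forall j : 'I_dstar, j = 0%N :> nat -> k j = 0].

Definition N1 (dstar : nat) (g : R) : nat := #|` fset_set (@ball1 dstar g)|%N.
Definition N2 (dstar : nat) (g : R) : nat := #|` fset_set (@ball2 dstar g)|%N.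

(* The sum of z ^ (r ^ 2) over all integers r, as the limit of the sums over
   -M <= r <= M (r = i - M below); it converges absolutely for `|z| < 1. *)
Definition h_fun (z : R) : R :=
  limn (fun M : nat =>
    \sum_(i < M.*2.+1) z ^+ (`|(i%:Z - M%:Z)%R|%N ^ 2)).

Definition l_fun (g z : R) : R := ln (h_fun z) - g * ln z.

(* For g > 0 the equation has exactly one solution in (0, 1). *)
Definition saddle (g : R) : R :=
  xget 0 [set z | 0 < z < 1 /\ derive1 (l_fun g) z = 0].

Definition admissible (L : R) (dstar : nat) (g : R) :=
  [/\ 0 < g, dstar%:R * g \is a Num.int
    & L >= g * (1 + 1 / (2 * saddle g))].

Definition is_gamma_star (L : R) (dstar : nat) (g : R) :=
  admissible L dstar g /\ forall g', admissible L dstar g' -> g' <= g.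

End Model.

Arguments vec : clear implicits.

(* Main.v *)
(* For each set J of dstar coordinates and each vector s of signs indexed by the
   lattice points of the ball of squared radius gamma dstar in Z^J, let f_{J,s}
   be A times the signed sum of the corresponding basis functions, normalised so
   that Q_j = 1 for j in J. Averaging over s, the likelihood ratio of the law
   of the observations with respect to pure noise has second moment
   E_{s,s'} exp(sum_i f_{J,s}(X_i) f_{J,s'}(X_i)); the diagonal Gram terms give
   a product of hyperbolic cosines, the others are controlled by the
   assumption on the design, and the total is at most M^alpha with
   M = C(d, dstar). A guess of J is then correct with average probability at
   most M^((alpha - 1) / 2) <= 2^((alpha - 1) / 2) < 1.

   That f_{J,s} belongs to the class amounts to gamma N1 <= L (N1 - N2), which
   follows from N2 / N1 <= 1 / (1 + 2 z). For large dstar the coordinates of a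
   uniform point of the ball behave like independent ones with weights
   z^(r^2) / h(z), z the saddle point, so that N2 / N1 is close to 1 / h(z),
   and h(z) >= 1 + 2 z + 2 z^4. To make this quantitative, the generating
   function of the number of zero coordinates is bounded above by Chernoff's
   method, and N1 from below by tilting to a point slightly smaller than z. *)

From HB Require Import structures.
Require Import Defs.
From mathcomp Require Import all_boot all_order all_algebra finmap perm.
From mathcomp Require Import all_classical all_reals all_analysis
  measurable_realfun.
From mathcomp Require Import lra zify.
Set Implicit Arguments.
Unset Strict Implicit.
Unset Printing Implicit Defensive.
Import Order.TTheory GRing.Theory Num.Theory.
Import numFieldNormedType.Exports.
Local Open Scope classical_set_scope.
Local Open Scope ring_scope.

(** * Gaussian shifts and the testing bound *)

Section Gaussian.
Context {R : realType}.
Local Open Scope ereal_scope.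
Notation mu := (@lebesgue_measure R).

(** The shape of the lattice part is dictated by uniformity: [d0] may depend on [L] only, while
    [gamma] moves with [dstar]. The saddle point must therefore stay in a fixed compact part of (0,
    1). The upper bound comes from [gamma <= L]. The lower one comes from the maximality of [gamma],
    because for [L > 1] a fixed small radius, rounded to a multiple of 1 / dstar, is admissible. At
    the saddle point itself the mean squared norm equals the squared radius, so Chebyshev's
    inequality could not put half of the mass inside the ball. The tilt by [eta] buys a margin
    linear in dstar and costs an error of order [eta] in the exponential rate. The term 2 z^4 of h,
    which 1 + 2 z leaves out, is bounded below uniformly and pays for every error: tilt, truncation
    and 1 / dstar. In the testing part each J is compared with pure noise separately, so only second
    moments with a common J occur and the correlation between different sets never has to be
    estimated. *)

Lemma ge0_integral_normal_prob (m s : R) (f : measurableTypeR R -> \bar R) :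
  measurable_fun setT f -> (forall x, 0 <= f x) ->
  \int[normal_prob m s]_x f x = \int[mu]_x (f x * (normal_pdf m s x)%:E).
Proof.
move=> mf f0.
have dom := normal_prob_dominates m s.
(* This change of variables is about the Radon-Nikodym derivative, which equals the density almost
   everywhere because both have the same integral over every measurable set. *)
rewrite -(Radon_Nikodym_SigmaFinite.change_of_variables dom)//.
have fi := Radon_Nikodym_SigmaFinite.f_integrable dom.
apply: ae_eq_integral => //.
- apply: emeasurable_funM => //; exact: measurable_int fi.
- apply: emeasurable_funM => //; apply/measurable_EFinP.
  exact: measurable_normal_pdf.
- apply: ae_eqe_mul2l; apply: integral_ae_eq => //.
  + by apply/measurable_EFinP; exact: measurable_normal_pdf.
  + by move=> E _ mE; rewrite -(Radon_Nikodym_SigmaFinite.f_integral dom).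
Qed.

(** Lebesgue measure is determined by its values on half-open intervals, and the image measure under
    the shift has the same values there. *)
Lemma ge0_integral_lebesgue_shift (a : R) (f : measurableTypeR R -> \bar R) :
  measurable_fun setT f -> (forall x, 0 <= f x) ->
  \int[mu]_x f (x + a)%R = \int[mu]_x f x.
Proof.
move=> mf f0.
pose sh := (fun x => (x + a)%R) : measurableTypeR R -> measurableTypeR R.
have msh : measurable_fun [set: measurableTypeR R] sh.
  by apply: measurable_funD.
transitivity (\int[pushforward mu sh]_x f x).
  by rewrite ge0_integral_pushforward.
apply: eq_measure_integral => //= A mA _; apply/esym.
pose sh' : {mfun measurableTypeR R >-> measurableTypeR R} :=
  HB.pack sh (isMeasurableFun.Build _ _ _ _ sh msh).
apply: (@lebesgue_measure_unique R (pushforward mu sh')) => // _ [[u v]] _ <-.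
transitivity (mu `](u - a)%R, (v - a)%R]%classic).
  rewrite !lebesgue_measure_itv/= !lte_fin ltrD2r; case: ifPn => // _.
  by rewrite -!EFinB; congr (_%:E); lra.
by congr (mu _); apply/seteqP; split => x /=;
  rewrite !in_itv/= /sh ltrBlDr lerBrDr.
Qed.

(** The density of N(m, 1) with respect to N(0, 1). *)
Definition shift_ratio (m x : R) : R := expR (x * m - m ^+ 2 / 2).

Lemma measurable_shift_ratio m : measurable_fun [set: R] (shift_ratio m).
Proof.
apply: measurableT_comp => //; apply: measurable_funB => //.
exact: measurable_funM.
Qed.

Lemma normal_pdf_shift (m x : R) :
  (normal_pdf 0 1 (x - m) = shift_ratio m x * normal_pdf 0 1 x)%R.
Proof.
rewrite !normal_pdfE ?oner_eq0// mulrCA /normal_fun /shift_ratio -expRD;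
  congr (_ * expR _)%R.
by rewrite !subr0 expr1n; lra.
Qed.

Lemma normal_shift (m : R) (g : measurableTypeR R -> \bar R) :
  measurable_fun setT g -> (forall x, 0 <= g x) ->
  \int[normal_prob 0%R 1%R]_x g (x + m)%R
  = \int[normal_prob 0%R 1%R]_x (g x * (shift_ratio m x)%:E).
Proof.
move=> mg g0.
have mlr := @measurable_shift_ratio m.
have mpdf := @measurable_normal_pdf R 0 1.
rewrite !ge0_integral_normal_prob//; first last.
- apply: measurableT_comp => //; exact: measurable_funD.
- by move=> x; rewrite mule_ge0// lee_fin expR_ge0.
- by apply: emeasurable_funM => //; exact/measurable_EFinP.
under eq_integral do rewrite -[X in normal_pdf _ _ X](addrK m).
rewrite (@ge0_integral_lebesgue_shift m (fun y =>
  g y * (normal_pdf 0 1 (y - m))%:E)).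
- by apply: eq_integral => x _; rewrite normal_pdf_shift EFinM muleA.
- apply: emeasurable_funM => //; apply/measurable_EFinP.
  apply: measurableT_comp => //; exact: measurable_funB.
- by move=> x; rewrite mule_ge0// lee_fin normal_pdf_ge0.
Qed.

End Gaussian.

Lemma ge0_integral_power_measure d (T : measurableType d) (R : realType)
    (m : {sigma_finite_measure set T -> \bar R}) n
    (g : n.+1.-tuple T -> \bar R) :
  measurable_fun setT g -> (forall t, 0 <= g t)%E ->
  (\int[power_measure m n.+1]_t g t =
   \int[m]_x \int[power_measure m n]_t g (tcons (x, t)))%E.
Proof.
move=> mg g0; have mt := @measurable_tcons d T n.
transitivity (\int[pushforward (m \x power_measure m n) (@tcons d T n)]_t g
  t)%E.
  by [].
rewrite ge0_integral_pushforward//.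
by rewrite fubini_tonelli1//=; apply: measurableT_comp.
Qed.

Section GaussianVector.
Context {R : realType}.
Notation gauss n := (power_measure (@normal_prob R 0 1) n).

Definition shift_vec n (a : 'I_n -> R) (t : vec R n) : vec R n :=
  [tuple a i + tnth t i | i < n].

Definition shift_ratio_vec n (a : 'I_n -> R) (t : vec R n) : R :=
  \prod_(i < n) shift_ratio (a i) (tnth t i).

Lemma measurable_shift_vec n (a : 'I_n -> R) :
  measurable_fun setT (shift_vec a).
Proof.
apply/measurable_fun_tnthP => i.
rewrite (_ : _ \o _ = fun t => a i + tnth t i); last first.
  by apply/funext => t /=; rewrite tnth_mktuple.
by apply: measurable_funD => //; exact: measurable_tnth.
Qed.

Lemma measurable_shift_ratio_vec n (a : 'I_n -> R) : measurable_fun setT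
  (shift_ratio_vec a).
Proof.
apply: measurable_prod => i _; apply: measurableT_comp;
  last exact: measurable_tnth.
exact: measurable_shift_ratio.
Qed.

Lemma shift_ratio_vec_ge0 n (a : 'I_n -> R) t : 0 <= shift_ratio_vec a t.
Proof. by apply: prodr_ge0 => i _; exact: expR_ge0. Qed.

Lemma shift_vec_tcons n (a : 'I_n.+1 -> R) x t :
  shift_vec a (tcons (x, t)) =
  tcons (a ord0 + x, shift_vec (fun i => a (lift ord0 i)) t).
Proof.
apply: eq_from_tnth => i; rewrite tnth_mktuple.
case: (unliftP ord0 i) => [j|] -> //.
by rewrite !tnthS tnth_mktuple.
Qed.

Lemma shift_ratio_vec_tcons n (a : 'I_n.+1 -> R) x t :
  shift_ratio_vec a (tcons (x, t)) =
  shift_ratio (a ord0) x * shift_ratio_vec (fun i => a (lift ord0 i)) t.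
Proof.
rewrite /shift_ratio_vec big_ord_recl; congr (_ * _).
by apply: eq_bigr => i _; rewrite tnthS.
Qed.

(** The Cameron-Martin formula in finite dimension. Tonelli splits off one coordinate at a time, and
    the ratio is multiplicative in the coordinates. *)
Lemma gauss_shift n (a : 'I_n -> R) (g : vec R n -> \bar R) :
  measurable_fun setT g -> (forall t, 0 <= g t)%E ->
  (\int[gauss n]_t g (shift_vec a t) =
   \int[gauss n]_t (g t * (shift_ratio_vec a t)%:E))%E.
Proof.
elim: n a g => [|n IH] a g mg g0.
  apply: eq_integral => t _; rewrite /shift_ratio_vec big_ord0 mule1.
  by congr g; apply: eq_from_tnth => -[].
rewrite !ge0_integral_power_measure//; first last.
- by apply: measurableT_comp => //; exact: measurable_shift_vec.
- by move=> t; rewrite mule_ge0// lee_fin shift_ratio_vec_ge0.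
- apply: emeasurable_funM => //; apply/measurable_EFinP.
  exact: measurable_shift_ratio_vec.
have mc (x : R) : measurable_fun setT (fun t =>
  @tcons _ (measurableTypeR R) n (x, t)).
  by apply: measurableT_comp; [exact: measurable_tcons|exact: measurable_pair1].
pose b (i : 'I_n) := a (lift ord0 i).
pose G (y : R) :=
  (\int[gauss n]_t (g (tcons (y, t)) * (shift_ratio_vec b t)%:E))%E.
transitivity (\int[normal_prob 0 1]_x G (x + a ord0)%R)%E.
  apply: eq_integral => x _.
  under eq_integral do rewrite shift_vec_tcons [a ord0 + x]addrC.
  by rewrite (IH b (fun s => g (tcons (x + a ord0, s))))//;
    exact: (measurableT_comp mg (mc _)).
have mp : measurable_fun setT (fun z : measurableTypeR R * vec R n =>
    (g (tcons z) * (shift_ratio_vec b z.2)%:E)%E).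
  apply: emeasurable_funM.
    by apply: measurableT_comp => //; exact: measurable_tcons.
  apply/measurable_EFinP; apply: measurableT_comp; last exact: measurable_snd.
  exact: measurable_shift_ratio_vec.
rewrite (normal_shift _ (g := G)).
- apply: eq_integral => x _; rewrite /G muleC -ge0_integralZl//.
  + by apply: eq_integral => t _; rewrite shift_ratio_vec_tcons EFinM muleCA.
  + apply: emeasurable_funM; first exact: (measurableT_comp mg (mc _)).
    by apply/measurable_EFinP; exact: measurable_shift_ratio_vec.
  + by move=> t _; rewrite mule_ge0// lee_fin shift_ratio_vec_ge0.
  + by rewrite lee_fin expR_ge0.
- apply: (@measurable_fun_fubini_tonelli_F _ _ _ _ _ (gauss n) _ mp) => z.
  by rewrite mule_ge0// lee_fin shift_ratio_vec_ge0.
- by move=> x; apply: integral_ge0 => t _;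
    rewrite mule_ge0// lee_fin shift_ratio_vec_ge0.
Qed.

Lemma gauss_setT n : gauss n setT = 1%E.
Proof.
have := @power_measure_box _ _ _ (@normal_prob R 0 1) n (fun=> setT)
  (fun=> measurableT).
rewrite big1 => [<-|i _];
  last exact: (@probability_setT _ _ _ (@normal_prob R 0 1)).
congr (gauss n _).
by apply/seteqP; split.
Qed.

Lemma integral_shift_ratio_vec n (a : 'I_n -> R) :
  (\int[gauss n]_t (shift_ratio_vec a t)%:E = 1)%E.
Proof.
have := @gauss_shift n a (cst 1%E) (@measurable_cst _ _ _ _ _ _) (fun=> lee01).
rewrite integral_cst// mul1e => E; rewrite -[RHS](gauss_setT n).
by apply/esym; apply: etrans E _; apply: eq_integral => t _; rewrite mul1e.
Qed.

(** Completing the square: the product of the two ratios is the exponential of the inner product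
    times the ratio for the shift [a + b], whose integral is 1. *)
Lemma integral_shift_ratio_vecM n (a b : 'I_n -> R) :
  (\int[gauss n]_t (shift_ratio_vec a t * shift_ratio_vec b t)%:E =
   (expR (\sum_i a i * b i))%:E)%E.
Proof.
have E t : shift_ratio_vec a t * shift_ratio_vec b t =
    expR (\sum_i a i * b i) * shift_ratio_vec (fun i => a i + b i) t.
  rewrite /shift_ratio_vec -big_split/= expR_sum -big_split/=;
    apply: eq_bigr => i _.
  by rewrite /shift_ratio -!expRD; congr expR; lra.
under eq_integral do rewrite E EFinM.
rewrite ge0_integralZl//.
- by rewrite integral_shift_ratio_vec mule1.
- by apply/measurable_EFinP; exact: measurable_shift_ratio_vec.
- by move=> t _; rewrite lee_fin shift_ratio_vec_ge0.
Qed.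

End GaussianVector.

(** * Testing many mixtures against pure noise *)

Section Testing.
Context {R : realType} (n : nat) (T W : finType) (D : {set T}).
Notation gauss n := (power_measure (@normal_prob R 0 1) n).
Variables (a : T -> W -> 'I_n -> R) (Jt : vec R n -> T) (B s : R).
Hypothesis mJ : forall j, measurable [set y | Jt y = j].
Hypothesis hB : forall j w', j \in D ->
  \sum_w expR (\sum_i a j w i * a j w' i) <= #|W|%:R * B.
Hypothesis s0 : 0 < s.
Hypothesis W0 : (0 < #|W|)%N.

Let correct j w := gauss n (shift_vec (a j w) @^-1` [set y | Jt y = j]).

Let correctE j w :
  (correct j w = \int[gauss n]_t (\1_[set y | Jt y = j] t * shift_ratio_vec
    (a j w) t)%:E)%E.
Proof.
have mI := @measurable_indic _ _ R setT _ (mJ j).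
under eq_integral do rewrite EFinM.
rewrite -(gauss_shift (a j w) (g := fun t => (\1_[set y | Jt y = j] t)%:E))//.
- rewrite (_ : correct j w = \int[gauss n]_t
      (\1_(shift_vec (a j w) @^-1` [set y | Jt y = j]) t)%:E)%E //.
  rewrite integral_indic ?setIT//.
  rewrite -[_ @^-1` _]setTI; exact: measurable_shift_vec.
- exact/measurable_EFinP.
Qed.

Let measurable_shift_ratio_vecM j w w' :
  measurable_fun setT (fun t : vec R n =>
    (shift_ratio_vec (a j w) t * shift_ratio_vec (a j w') t)%:E).
Proof.
by apply/measurable_EFinP; apply: measurable_funM;
  exact: measurable_shift_ratio_vec.
Qed.

(** Summing over [w] before integrating turns each guess into an indicator times a mixture
    likelihood ratio. Its square is controlled by [hB] for each j. The events [Jt y = j] are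
    disjoint, so the part of the bound made of indicators is paid once and not once per j: this is
    why the last term carries no factor [#|D|]. The parameter [s] balances the two parts. *)
Lemma sum_correct_le :
  (\sum_(j in D) \sum_w correct j w <=
   ((#|W| * #|D|)%:R * (s * B / 2) + #|W|%:R / (2 * s))%:E)%E.
Proof.
pose c1 := s / (2 * #|W|%:R); pose c2 := #|W|%:R / (2 * s).
have Wr : 0 < #|W|%:R :> R by rewrite ltr0n.
have c1_ge0 : 0 <= c1 by rewrite divr_ge0 ?mulr_ge0// ltW.
have c2_ge0 : 0 <= c2 by rewrite divr_ge0 ?mulr_ge0// ltW.
have mcorr j w : measurable_fun setT
    (fun t : vec R n =>
      (\1_[set y | Jt y = j] t * shift_ratio_vec (a j w) t)%:E).
  apply/measurable_EFinP; apply: measurable_funM;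
    last exact: measurable_shift_ratio_vec.
  exact: measurable_indic.
have corr0 j w t : (0 <=
  (\1_[set y | Jt y = j] t * shift_ratio_vec (a j w) t)%:E)%E.
  by rewrite lee_fin mulr_ge0// shift_ratio_vec_ge0.
rewrite (eq_bigr (fun j => \int[gauss n]_t
    \sum_w (\1_[set y | Jt y = j] t * shift_ratio_vec (a j w) t)%:E)%E);
      last first.
  by move=> j _; rewrite ge0_integral_sum//; apply: eq_bigr => w _;
    rewrite correctE.
rewrite -big_enum/= -ge0_integral_sum//; first last.
- by move=> j t _; exact: sume_ge0.
- by move=> j; exact: emeasurable_sum.
pose g (t : vec R n) : \bar R :=
  ((\sum_(j <- enum D) \sum_w \sum_w'
    (c1%:E * (shift_ratio_vec (a j w) t * shift_ratio_vec (a j w') t)%:E)) +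
      c2%:E)%E.
have lr2_ge0 j w w' t :
    (0 <= c1%:E * (shift_ratio_vec (a j w) t * shift_ratio_vec (a j w')
      t)%:E)%E.
  rewrite -EFinM lee_fin; apply: mulr_ge0 => //.
  by apply: mulr_ge0; exact: shift_ratio_vec_ge0.
have lr2_ge0' j w t : (0 <=
  \sum_w' c1%:E * (shift_ratio_vec (a j w) t * shift_ratio_vec (a j w')
  t)%:E)%E.
  by apply: sume_ge0.
have lr2_ge0'' j t :
    (0 <= \sum_w \sum_w' c1%:E * (shift_ratio_vec (a j w) t * shift_ratio_vec
      (a j w') t)%:E)%E.
  by apply: sume_ge0.
have msum : measurable_fun setT (fun t : vec R n =>
  (\sum_(j <- enum D) \sum_w \sum_w'
    (c1%:E * (shift_ratio_vec (a j w) t * shift_ratio_vec (a j w') t)%:E))%E).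
  do 3!(apply: emeasurable_sum => ?).
  by apply: emeasurable_funM.
apply: (@le_trans _ _ (\int[gauss n]_t g t)%E).
  apply: ge0_le_integral => //.
  - by move=> t _; apply: sume_ge0 => j _; exact: sume_ge0.
  - by apply: emeasurable_sum => j; exact: emeasurable_sum.
  - exact: emeasurable_funD.
  move=> t _; rewrite /g !big_enum/=.
  under eq_bigr do rewrite sumEFin.
  under [in leRHS]eq_bigr => j _.
    under eq_bigr => w _.
      under eq_bigr do rewrite -EFinM.
      rewrite sumEFin; over.
    rewrite sumEFin; over.
  rewrite !sumEFin -EFinD lee_fin.
  (* AM-GM: with c1 * c2 = 1 / 4, S * I <= c1 * S ^ 2 + c2 * I ^ 2. *)
  have key j : \sum_w \1_[set y | Jt y = j] t * shift_ratio_vec (a j w) t <=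
      \sum_w \sum_w' c1 * (shift_ratio_vec (a j w) t * shift_ratio_vec
        (a j w') t) +
      c2 * \1_[set y | Jt y = j] t.
    rewrite -mulr_sumr.
    under [in leRHS]eq_bigr do rewrite -mulr_sumr -mulr_sumr.
    rewrite -mulr_sumr -mulr_suml -expr2.
    set S := \sum_w _; set I := \1_ _ t.
    rewrite [X in _ + _ * X](_ : I = I ^+ 2); last first.
      by rewrite /I indicE; case: (_ \in _); rewrite ?expr1n// expr0n.
    have c12 : 4 * (c1 * c2) = 1.
      rewrite /c1 /c2 mulf_div (_ : 2 * _ * _ = 4 * (s * #|W|%:R)); last by lra.
      have y0 : 4 * (s * #|W|%:R) != 0 by rewrite gt_eqF// !mulr_gt0.
      by rewrite -[RHS](divff y0); exact: mulrA.
    have c1_gt0 : 0 < c1 by rewrite divr_gt0// mulr_gt0.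
    have c12I : c1 * (c2 * I ^+ 2) = I ^+ 2 / 4.
      by rewrite mulrA (_ : c1 * c2 = 4^-1) 1?mulrC//; lra.
    rewrite -(ler_pM2l c1_gt0) mulrDr c12I; have := sqr_ge0 (2 * c1 * S - I);
      lra.
  apply: le_trans (ler_sum _ (fun j _ => key j)) _.
  (* It remains that the indicators over j sum to at most 1: only j = [Jt t] can contribute. *)
  rewrite big_split/= lerD2l -mulr_sumr ler_piMr//.
  rewrite (bigID (fun j => j == Jt t))/= [X in _ + X]big1 ?addr0; last first.
    by move=> j /andP[_ /eqP jt]; rewrite indicE memNset//= => /esym.
  apply: (@le_trans _ _ (\sum_(j | j == Jt t) \1_[set y | Jt y = j] t)).
    by rewrite [leRHS](bigID (mem D))/=; under eq_bigl do rewrite andbC;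
      rewrite lerDl sumr_ge0.
  by rewrite big_pred1_eq indicE; case: (_ \in _).
rewrite ge0_integralD//; first last.
- by move=> t _; exact: sume_ge0.
rewrite integral_cst// [X in (_ * X)%E](gauss_setT n) mule1 EFinD leeD2r//.
rewrite ge0_integral_sum//; first last.
- by move=> j; do 2!(apply: emeasurable_sum => ?); exact: emeasurable_funM.
rewrite big_enum/=.
apply: (@le_trans _ _ (\sum_(j in D) (#|W|%:R * (s * B / 2))%:E)%E); last first.
  by rewrite sumEFin lee_fin sumr_const -mulr_natr natrM; lra.
apply: lee_sum => j jD.
rewrite ge0_integral_sum//; first last.
- by move=> w; apply: emeasurable_sum => ?; exact: emeasurable_funM.
rewrite (eq_bigr (fun w =>
    (\sum_w' c1 * expR (\sum_i a j w i * a j w' i))%:E)%E); last first.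
  move=> w _; rewrite ge0_integral_sum//; last first.
    by move=> w'; exact: emeasurable_funM.
  rewrite -sumEFin; apply: eq_bigr => w' _; rewrite ge0_integralZl//.
    by rewrite integral_shift_ratio_vecM EFinM.
  by move=> t _; rewrite lee_fin; apply: mulr_ge0; exact: shift_ratio_vec_ge0.
rewrite sumEFin lee_fin exchange_big/=.
apply: (@le_trans _ _ (\sum_(w' : W) c1 * (#|W|%:R * B))).
  by apply: ler_sum => w' _; rewrite -mulr_sumr ler_wpM2l// hB.
rewrite sumr_const -[leLHS]mulr_natl ler_wpM2l// ?ler0n//.
rewrite mulrA (_ : c1 * _ = s / 2); first by rewrite mulrAC.
by rewrite /c1 invfM mulrA mulrVK// unitfE gt_eqF.
Qed.

(** The left side of the first hypothesis is the previous bound divided by the number of pairs, so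
    it bounds the average success probability. Not every pair can then succeed with probability
    [r]. *)
Lemma exists_error_ge (r : R) :
  s * B / 2 + (2 * s * #|D|%:R)^-1 < r -> (0 < #|D|)%N ->
  exists j w, j \in D /\
    ((1 - r)%:E <= gauss n (shift_vec (a j w) @^-1` [set y | Jt y != j]))%E.
Proof.
move=> hr D0.
have ms j w : measurable (shift_vec (a j w) @^-1` [set y | Jt y = j]).
  rewrite -[_ @^-1` _]setTI; exact: measurable_shift_vec.
apply: contrapT => /forallNP H.
have {}H j w : j \in D -> (r%:E <= correct j w)%E.
  move=> jD; rewrite leNgt; apply/negP => lt; apply: (H j); exists w;
    split => //.
  have E := gauss_setT n; pose A := shift_vec (a j w) @^-1` [set y | Jt y = j].
  have AC : shift_vec (a j w) @^-1` [set y | Jt y != j] = ~` A.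
    by apply/seteqP; split => y /=; [move/eqP|move=> ?; apply/eqP].
  rewrite AC EFinB -E -(setUv A) measureU//; [|exact: ms|apply: measurableC;
    exact: ms|exact: setICr].
  rewrite leeBlDr// addeC leeD2l//; exact: ltW.
have := sum_correct_le; apply/negP; rewrite -ltNge.
apply: (@lt_le_trans _ _ (\sum_(j in D) \sum_(w : W) r%:E)%E); last first.
  by apply: lee_sum => j jD; apply: lee_sum => w _; exact: H.
rewrite (eq_bigr (fun=> (r *+ #|W|)%:E)) => [|j _];
  last by rewrite sumEFin sumr_const.
rewrite sumEFin sumr_const -mulrnA lte_fin.
have N0 : 0 < (#|W| * #|D|)%:R :> R by rewrite ltr0n muln_gt0 W0.
have {}hr : (#|W| * #|D|)%:R * (s * B / 2 + (2 * s * #|D|%:R)^-1) <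
    (#|W| * #|D|)%:R * r by rewrite ltr_pM2l.
rewrite -[ltRHS]mulr_natl; apply: le_lt_trans hr.
rewrite mulrDr lerD2l natrM [(2 * s * _)^-1]invfM -mulrA ler_wpM2l// mulrCA
  mulfV ?mulr1//.
by rewrite pnatr_eq0 -lt0n.
Qed.

End Testing.

(** * Exponential moments of random signs *)

Section Signs.
Context {R : realType}.

(* The sharp constant 1 / 2 in the exponent is not needed. *)
Lemma expR_cosh_le (x : R) : expR x + expR (- x) <= 2 * expR (x ^+ 2).
Proof.
wlog x0 : x / 0 <= x => [H|].
  have [/H//|/ltW x0] := lerP 0 x.
  by have := H (- x); rewrite opprK sqrrN addrC; apply; rewrite oppr_ge0.
have [x1|x1] := lerP x 1; last first.
  have xx : x <= x ^+ 2 by rewrite expr2 ler_peMl// ltW.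
  have e1 : expR x <= expR (x ^+ 2) by rewrite ler_expR.
  have e2 : expR (- x) <= expR (x ^+ 2) by rewrite ler_expR; lra.
  lra.
(* With E = exp y and F = exp (- y), the left side is 2 + (E - F)^2. From E F = 1, E >= 1 + y and F
   >= 1 - y one gets (E - F)(1 - y) <= y (2 - y). For y <= 1/2 this gives (E - F)^2 <= 8 y^2 + 8
   y^4, while exp(x^2) = exp(2 y^2)^2 >= (1 + 2 y^2)^2, twice which is exactly 2 + 8 y^2 + 8 y^4. *)
pose y := x / 2; have xy : x = y + y by rewrite /y; lra.
have y0 : 0 <= y by rewrite /y; lra.
have y1 : y <= 1 / 2 by rewrite /y; lra.
have EF := expRxMexpNx_1 y; have := expR_ge1Dx y; have := expR_ge1Dx (- y).
have -> : expR x + expR (- x) = (expR y - expR (- y)) ^+ 2 + 2.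
  by rewrite xy opprD !expRD; lra.
set E := expR y in EF *; set F := expR (- y) in EF * => hF hE.
have E0 : 0 < E by exact: expR_gt0.
have D1 : (E - F) * (1 - y) <= y * (2 - y).
  have : E * (1 - y) <= E * F by rewrite ler_pM2l.
  have : (1 - y) * (1 - y) <= F * (1 - y) by rewrite ler_wpM2r//; lra.
  lra.
have D0 : 0 <= (E - F) * (1 - y).
  by rewrite mulr_ge0// ?subr_ge0//; [|lra]; rewrite /E /F ler_expR; lra.
have D2 : ((E - F) * (1 - y)) ^+ 2 <= (y * (2 - y)) ^+ 2 by rewrite lerXn2r//
  nnegrE// (le_trans D0).
have P : (2 - y) ^+ 2 <= (8 + 8 * y ^+ 2) * (1 - y) ^+ 2 by nra.
have D3 : (E - F) ^+ 2 <= 8 * y ^+ 2 + 8 * y ^+ 2 * y ^+ 2.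
  have q0 : 0 < (1 - y) ^+ 2 by rewrite exprn_gt0//; lra.
  rewrite -(ler_pM2r q0) -exprMn; apply: le_trans D2 _.
  rewrite exprMn; apply: le_trans (ler_wpM2l (sqr_ge0 y) P) _; lra.
have e2 : (1 + 2 * y ^+ 2) ^+ 2 <= expR (x ^+ 2).
  have -> : x ^+ 2 = 2%:R * (2 * y ^+ 2) by rewrite xy; lra.
  have y20 := sqr_ge0 y.
  rewrite expRM_natl lerXn2r// ?nnegrE ?expR_ge0 ?expR_ge1Dx//; lra.
lra.
Qed.

Definition bool_sign (b : bool) : R := if b then 1 else -1.

Lemma bool_sign_sqr b : bool_sign b * bool_sign b = 1.
Proof. by case: b; rewrite /bool_sign; lra. Qed.

Lemma bool_sign_norm b : `|bool_sign b| = 1.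
Proof. by case: b; rewrite /bool_sign ?normrN normr1. Qed.

(** The signs are independent: the sum over all sign vectors factors into one hyperbolic cosine per
    index. *)
Lemma sum_expR_signs_le (K : finType) (b : K -> R) :
  \sum_(w : {ffun K -> bool}) expR (\sum_k bool_sign (w k) * b k) <=
  2 ^+ #|K| * expR (\sum_k b k ^+ 2).
Proof.
under eq_bigr do rewrite expR_sum.
rewrite -(bigA_distr_bigA (fun k c => expR (bool_sign c * b k)))/=.
rewrite expR_sum -prodr_const -big_split/=; apply: ler_prod => k _.
rewrite big_bool/= /bool_sign mul1r mulN1r addr_ge0 ?expR_ge0//=.
exact: expR_cosh_le.
Qed.

(** Off-diagonal Gram terms are replaced by their absolute bound before averaging, at a cost of
    [A ^+ 2 * e] per pair. Diagonal terms keep their sign, so that averaging makes their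
    contribution quadratic. Fixing [w'] only flips signs of the coefficients [b], hence a bound
    uniform in [w']. *)
Lemma sum_expR_gram_le (K I : finType) (f : K -> I -> R) (A c e : R)
    (w' : {ffun K -> bool}) :
  (forall k, \sum_i f k i * f k i <= c) ->
  (forall k k', k != k' -> `|\sum_i f k i * f k' i| <= e) ->
  0 <= e ->
  \sum_(w : {ffun K -> bool}) expR (\sum_i
     (A * \sum_k bool_sign (w k) * f k i) * (A * \sum_k bool_sign (w' k) *
       f k i)) <=
  2 ^+ #|K| * expR (A ^+ 4 * c ^+ 2 * #|K|%:R + A ^+ 2 * e * #|K|%:R ^+ 2).
Proof.
move=> hc he e0.
pose g k k' := \sum_i f k i * f k' i.
have g0 k : 0 <= g k k by apply: sumr_ge0 => i _; rewrite -expr2 sqr_ge0.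
pose b k := A ^+ 2 * g k k * bool_sign (w' k).
have key w : \sum_i (A * \sum_k bool_sign (w k) * f k i) *
  (A * \sum_k bool_sign (w' k) * f k i)
    <= \sum_k bool_sign (w k) * b k + A ^+ 2 * e * #|K|%:R ^+ 2.
  have -> : \sum_i (A * \sum_k bool_sign (w k) * f k i) *
    (A * \sum_k bool_sign (w' k) * f k i)
      = \sum_k \sum_k' A ^+ 2 * (bool_sign (w k) * bool_sign (w' k') * g k k').
    transitivity (\sum_i \sum_k \sum_k' A ^+ 2 *
      (bool_sign (w k) * bool_sign (w' k') * (f k i * f k' i))).
      apply: eq_bigr => i _; rewrite mulrACA -expr2 mulr_suml mulr_sumr.
      apply: eq_bigr => k _; rewrite !mulr_sumr; apply: eq_bigr => k' _; lra.
    rewrite exchange_big/=; apply: eq_bigr => k _.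
    rewrite exchange_big/=; apply: eq_bigr => k' _.
    by rewrite -!mulr_sumr.
  have -> : A ^+ 2 * e * #|K|%:R ^+ 2 = \sum_(k : K) \sum_(k' : K) A ^+ 2 * e.
    by rewrite !sumr_const -mulrnA -[in RHS]mulr_natr natrM expr2.
  rewrite -big_split/=; apply: ler_sum => k _.
  rewrite (bigD1 k)//= [X in _ <= _ + X](bigD1 k)//= addrA; apply: lerD.
    have : 0 <= A ^+ 2 * e by rewrite mulr_ge0// sqr_ge0.
    rewrite /b; lra.
  apply: ler_sum => k' kk'; rewrite ler_wpM2l ?sqr_ge0//.
  by rewrite (le_trans (ler_norm _))// !normrM !bool_sign_norm !mul1r
    he// eq_sym.
apply: (@le_trans _ _ (\sum_(w : {ffun K -> bool})
    expR (\sum_k bool_sign (w k) * b k + A ^+ 2 * e * #|K|%:R ^+ 2))).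
  by apply: ler_sum => w _; rewrite ler_expR.
under eq_bigr do rewrite expRD.
rewrite -mulr_suml expRD mulrA ler_wpM2r ?expR_ge0//.
apply: le_trans (sum_expR_signs_le b) _.
rewrite ler_wpM2l ?exprn_ge0// ler_expR.
apply: (@le_trans _ _ (\sum_(k : K) A ^+ 4 * c ^+ 2)).
  apply: ler_sum => k _; rewrite /b.
  have -> : (A ^+ 2 * g k k * bool_sign (w' k)) ^+ 2 = A ^+ 4 * g k k ^+ 2.
    by have := bool_sign_sqr (w' k); rewrite expr2 => E; rewrite mulrACA E; lra.
  rewrite ler_wpM2l ?exprn_even_ge0// lerXn2r ?nnegrE//; last exact: hc.
  exact: le_trans (g0 k) (hc k).
by rewrite sumr_const mulr_natr.
Qed.

End Signs.

(** * Trigonometric polynomials on the cube *)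

Section Trig.
Context {R : realType}.
Notation mu := (@lebesgue_measure R).

Lemma cosD2pi_int (a : R) (m : int) : cos (a + 2 * pi * m%:~R) = cos a.
Proof.
have H (b : R) n : cos (b + 2 * pi * n%:R) = cos b.
  rewrite (_ : 2 * pi * n%:R = (pi *+ 2) *+ n); last first.
    by rewrite mulr_natr [2 * pi]mulr_natl.
  exact: (periodicn (@cosD2pi R)).
case: m => n; first by rewrite -pmulrn H.
by rewrite NegzE mulrNz -pmulrn mulrN -(H _ n.+1) addrNK.
Qed.

Lemma sinD2pi_int (a : R) (m : int) : sin (a + 2 * pi * m%:~R) = sin a.
Proof. by rewrite -!cosBpihalf addrAC cosD2pi_int. Qed.

Lemma is_derive_sin_affine (w c x : R) : w != 0 ->
  is_derive x (1 : R) (fun x : R => sin (w * x + c) / w) (cos (w * x + c)).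
Proof.
move=> w0.
have H : is_derive x (1 : R) (fun x : R => w * x + c) w.
  by apply: is_derive_eq; rewrite addr0 [_ *: _]mulr1.
have S := @is_derive1_comp _ _ _ x _ _ (is_derive_sin (w * x + c)) H.
have := @is_deriveZ _ _ _ _ w^-1 x 1 _ S.
rewrite (_ : _ \*: _ = fun x : R => sin (w * x + c) / w); last first.
  by apply/funext => y; rewrite mulrC.
by rewrite [_ *: _]mulrC mulfK.
Qed.

(** This is the outer integral in the induction on the dimension: [s] receives the indicator that
    the remaining frequencies vanish, left behind by the inner integral. *)
Lemma integral_cos01 (m : int) (s c : R) :
  (\int[mu]_(x in `[0%R, 1%R]) (1 + s * cos (2 * pi * (m%:~R * x) + c))%:E =
   (1 + s * ((m == 0)%:R * cos c))%:E)%E.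
Proof.
have [->|m0] := eqVneq m 0.
  under eq_integral do rewrite mul0r mulr0 add0r.
  by rewrite integral_cst//= lebesgue_measure_itv/= lte01 sube0 mule1 mul1r.
rewrite mul0r mulr0 addr0.
pose w : R := 2 * pi * m%:~R.
have pi0 : pi != 0 :> R by rewrite gt_eqF// pi_gt0.
have w0 : w != 0 by rewrite !mulf_eq0 !negb_or intr_eq0 m0 pi0 pnatr_eq0.
pose F (x : R) := x + s * (sin (w * x + c) / w).
have dF (x : R) : is_derive x (1 : R) F (1 + s * cos (w * x + c)).
  have := @is_deriveZ _ _ _ _ s x 1 _ (is_derive_sin_affine c x w0).
  by move=> /(is_deriveD (is_derive_id x 1)); apply.
have cF : continuous F.
  by move=> x; apply: differentiable_continuous; apply/derivable1_diffP;
    have [] := dF x.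
rewrite (@continuous_FTC2 _ _ F)//.
- by rewrite /F mulr1 mulr0 !add0r [w + c]addrC sinD2pi_int -EFinB addrK.
- apply: continuous_subspaceT => x; apply: cvgD; first exact: cvg_cst.
  apply: cvgM; first exact: cvg_cst.
  apply: (cvg_comp _ cos); last exact: continuous_cos.
  apply: cvgD; last exact: cvg_cst.
  apply: cvgM; first exact: cvg_cst.
  by apply: cvgM; first exact: cvg_cst.
- split.
  + by move=> x _; have [] := dF x.
  + by apply: cvg_at_right_filter; exact: cF.
  + by apply: cvg_at_left_filter; exact: cF.
- by move=> x _; rewrite derive1E; have [_ ->] := dF x; rewrite /w mulrA.
Qed.

Lemma measurable_cos_lin d (T : measurableType d) (f : T -> R) :
  measurable_fun setT f -> measurable_fun setT (fun x => cos (f x)).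
Proof.
apply: measurableT_comp; apply: continuous_measurable_fun;
  exact: continuous_cos.
Qed.

Lemma measurable_dot d (k : freq d) : measurable_fun setT (dot k : vec R d ->
  R).
Proof.
apply: measurable_sum => j; apply: measurable_funM => //;
  exact: measurable_tnth.
Qed.

Lemma measurable_cube d : measurable (@cube R d).
Proof.
rewrite (_ : @cube R d = \bigcap_(i in [set: 'I_d])
  ((@tnth d R ^~ i) @^-1` `[0, 1]%classic)).
  apply: fin_bigcap_measurable => // i _.
  by rewrite -[_ @^-1` _]setTI; exact: measurable_tnth.
by apply/seteqP; split => t /= At i => [_|]; have := At i;
  rewrite /= in_itv/=; apply.
Qed.

Definition freq_tail d (k : freq d.+1) : freq d := [ffun j => k (lift ord0 j)].

Lemma dot_tcons d (k : freq d.+1) (x : R) (t : vec R d) :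
  dot k (tcons (x, t)) = (k ord0)%:~R * x + dot (freq_tail k) t.
Proof.
rewrite /dot big_ord_recl; congr (_ + _).
by apply: eq_bigr => j _; rewrite tnthS ffunE.
Qed.

Lemma freq_eq0 d (k : freq d.+1) :
  (k == 0) = (k ord0 == 0) && (freq_tail k == 0).
Proof.
apply/eqP/andP => [->|[/eqP k0 /eqP k1]]; first by rewrite ffunE; split => //;
  apply/eqP/ffunP => j; rewrite !ffunE.
apply/ffunP => i; rewrite ffunE; case: (unliftP ord0 i) => [j|] -> //.
by move/ffunP/(_ j): k1; rewrite !ffunE.
Qed.

Lemma indic_cube_tcons d (x : R) (t : vec R d) :
  \1_(@cube R d.+1) (tcons (x, t)) =
    \1_`[0, 1]%classic x * \1_(@cube R d) t :> R.
Proof.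
rewrite !indicE -natrM mulnb; congr (nat_of_bool _)%:R.
apply/idP/andP; rewrite !inE /cube /= in_itv/=.
  by move=> H; split; [exact: (H ord0)|move=> j; have := H (lift ord0 j);
    rewrite tnthS].
move=> [x01 H] i; case: (unliftP ord0 i) => [j|] ->//.
by rewrite tnthS; exact: H.
Qed.

(* Adding 1 makes the integrand nonnegative, so that Tonelli applies. *)
Lemma integral_cube_1Dcos d (k : freq d) (c : R) :
  (\int[lebesgue_vec d]_x (\1_(@cube R d) x *
    (1 + cos (2 * pi * dot k x + c)))%:E =
   (1 + (k == 0)%:R * cos c)%:E)%E.
Proof.
have m1 e (k' : freq e) (c' : R) : measurable_fun setT
    (fun x : vec R e =>
      (\1_(@cube R e) x * (1 + cos (2 * pi * dot k' x + c')))%:E).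
  apply/measurable_EFinP; apply: measurable_funM.
    by apply: measurable_indic; exact: measurable_cube.
  apply: measurable_funD => //; apply: measurable_cos_lin.
  apply: measurable_funD => //; apply: measurable_funM => //;
    exact: measurable_dot.
elim: d k c => [|d IH] k c.
  rewrite integral_dirac//=; last exact: m1.
  rewrite diracE mem_set// mul1e /dot big_ord0 mulr0 add0r.
  rewrite indicE mem_set ?mul1r; last by case.
  by rewrite (_ : k == 0) ?mul1r//; apply/eqP/ffunP => -[].
have c0 e (x : R) (t : vec R e) : (0 <= (\1_(@cube R e) t * (1 + cos x))%:E)%E.
  by rewrite lee_fin mulr_ge0//; have := cos_geN1 x; lra.
rewrite ge0_integral_power_measure//.
transitivity (\int[mu]_(x in `[0%R, 1%R])
   (1 + (freq_tail k == 0)%:R * cos (2 * pi * ((k ord0)%:~R * x) + c))%:E)%E;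
     last first.
  rewrite integral_cos01 freq_eq0; case: eqP; case: eqP;
    rewrite ?mul0r ?mul1r//.
rewrite [RHS]integral_mkcond; apply: eq_integral => x _.
rewrite patchE/=.
transitivity (\int[lebesgue_vec d]_t ((\1_`[0, 1]%classic x)%:E *
   (\1_(@cube R d) t * (1 + cos (2 * pi * dot (freq_tail k) t +
      (2 * pi * ((k ord0)%:~R * x) + c))))%:E))%E.
  apply: eq_integral => t _; rewrite indic_cube_tcons dot_tcons -EFinM mulrA.
  by congr (_ * (1 + cos _))%:E; lra.
rewrite ge0_integralZl//; last exact: m1.
by rewrite IH indicE; case: ifP => [|] xI; rewrite ?mul1e// mul0e.
Qed.

End Trig.

(** * Orthogonality of the basis functions *)

Section Orthogonality.
Context {R : realType}.

Lemma lebesgue_cube d : lebesgue_vec d (@cube R d) = 1%E.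
Proof.
have m01 (i : 'I_d) : measurable (`[0, 1]%classic : set (measurableTypeR R)).
  exact: measurable_itv.
have := power_measure_box (@lebesgue_measure R) m01.
rewrite big1 => [<-|i _]; last by rewrite /= lebesgue_measure_itv/= lte01 sube0.
by congr (power_measure _ d _); apply/seteqP.
Qed.

Lemma lebesgue_cube_lty d : (lebesgue_vec d (@cube R d) < +oo)%E.
Proof. by rewrite lebesgue_cube ltry. Qed.

Definition wave d (k : freq d) (c : R) (x : vec R d) : R :=
  cos (2 * pi * dot k x + c).

Lemma measurable_wave d (k : freq d) c : measurable_fun setT (wave k c).
Proof.
apply: measurable_cos_lin; apply: measurable_funD => //.
apply: measurable_funM => //; exact: measurable_dot.
Qed.

Lemma integrable_wave d (k : freq d) c :
  (lebesgue_vec d).-integrable (@cube R d) (EFin \o wave k c).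
Proof.
apply: measurable_bounded_integrable.
- exact: measurable_cube.
- exact: lebesgue_cube_lty.
- apply: measurable_funTS; exact: measurable_wave.
- exists 1; split => // M M1 x _; exact: le_trans (cos_max _) (ltW M1).
Qed.

Lemma Rintegral_wave d (k : freq d) c :
  \int[lebesgue_vec d]_(x in @cube R d) wave k c x = (k == 0)%:R * cos c.
Proof.
have mc := @measurable_cube R d.
have i1 : (lebesgue_vec d).-integrable (@cube R d) (EFin \o cst (1 : R)).
  apply: measurable_bounded_integrable => //; first exact: lebesgue_cube_lty.
  exists 1; split => // M M1 x _; rewrite /= normr1; exact: ltW.
apply: (@addrI _ 1).
have -> : 1 + \int[lebesgue_vec d]_(x in @cube R d) wave k c x =
    \int[lebesgue_vec d]_(x in @cube R d) (1 + wave k c x).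
  rewrite (@RintegralD _ _ _ _ _ (cst 1))//; last exact: integrable_wave.
  by rewrite Rintegral_cst// [X in fine X]lebesgue_cube mulr1.
rewrite /Rintegral integral_mkcond.
transitivity (fine (1 + (k == 0)%:R * cos c)%:E) => //.
rewrite -integral_cube_1Dcos; congr fine; apply: eq_integral => x _.
by rewrite patchE/= indicE; case: ifP => _; rewrite ?mul1r// mul0r.
Qed.

Lemma dotD d (k k' : freq d) (x : vec R d) : dot (k + k') x =
  dot k x + dot k' x.
Proof. by rewrite /dot -big_split/=; apply: eq_bigr => j _;
  rewrite ffunE rmorphD mulrDl. Qed.

Lemma dotN d (k : freq d) (x : vec R d) : dot (- k) x = - dot k x.
Proof. by rewrite /dot -sumrN; apply: eq_bigr => j _;
  rewrite ffunE rmorphN mulNr. Qed.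

Lemma waveM d (k k' : freq d) c c' x :
  wave k c x * wave k' c' x =
  2^-1 * wave (k - k') (c - c') x + 2^-1 * wave (k + k') (c + c') x.
Proof.
rewrite /wave !dotD dotN.
set a := 2 * pi * dot k x + c; set b := 2 * pi * dot k' x + c'.
have -> : 2 * pi * (dot k x - dot k' x) + (c - c') = a - b by rewrite /a /b;
  lra.
have -> : 2 * pi * (dot k x + dot k' x) + (c + c') = a + b by rewrite /a /b;
  lra.
rewrite (cosB a b) (cosD a b); lra.
Qed.

Lemma integrable_waveM d (k k' : freq d) c c' :
  (lebesgue_vec d).-integrable (@cube R d) (fun x =>
    (wave k c x * wave k' c' x)%:E).
Proof.
have mc := @measurable_cube R d.
pose h (q : freq d) e x := (2^-1%:E * (EFin \o wave q e) x)%E.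
rewrite (_ : (fun _ => _) =
  (h (k - k')%R (c - c')%R \+ h (k + k')%R (c + c')%R)%E); last first.
  by apply/funext => x /=; rewrite waveM EFinD !EFinM.
by apply: integrableD => //; apply: integrableZl => //; exact: integrable_wave.
Qed.

(** Frequencies k and -k span the same waves, hence the second term; whether it survives is decided
    by the phases alone. *)
Lemma Rintegral_waveM d (k k' : freq d) c c' :
  \int[lebesgue_vec d]_(x in @cube R d) (wave k c x * wave k' c' x) =
  2^-1 * ((k == k')%:R * cos (c - c')) + 2^-1 * ((k == - k')%:R * cos (c + c')).
Proof.
have mc := @measurable_cube R d.
under eq_Rintegral do rewrite waveM.
have i1 (q : freq d) e : (lebesgue_vec d).-integrable (@cube R d)
    (EFin \o (fun x => 2^-1 * wave q e x)).
  rewrite (_ : _ \o _ = (fun x => (2^-1)%:E * (EFin \o wave q e) x)%E);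
    last first.
    by apply/funext => x /=; rewrite EFinM.
  by apply: integrableZl => //; exact: integrable_wave.
rewrite RintegralD// !RintegralZl//; try exact: integrable_wave.
by rewrite !Rintegral_wave subr_eq0 addr_eq0.
Qed.

Lemma sqrt2_cos_pi4 : Num.sqrt 2 * cos (pi / 4) = 1 :> R.
Proof.
have c0 : 0 < cos (pi / 4 : R) by apply: cos_gt0_pihalf; have := @pi_gt0 R; lra.
have : cos (pi / 4 *+ 2) = 0 :> R.
  by rewrite -(@cos_pihalf R); congr cos; lra.
rewrite cos_mulr2n => c2.
apply/eqP; rewrite -(@eqrXn2 _ 2)// ?mulr_ge0 ?sqrtr_ge0 ?ltW//.
by rewrite exprMn sqr_sqrtr// expr1n; apply/eqP; lra.
Qed.

(* With this phase every basis function, including the constant one, is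
   [sqrt 2 * cos (2 pi k.x + phase k)]. *)
Definition phase d (k : freq d) : R :=
  if k == 0 then pi / 4 else if pos_freq k then 0 else - (pi / 2).

Lemma fourierE d (k : freq d) x : fourier k x = Num.sqrt 2 * wave k (phase k) x.
Proof.
rewrite /fourier /wave /phase; case: eqP => [->|_].
  rewrite (_ : dot 0 x = 0) ?mulr0 ?add0r ?sqrt2_cos_pi4//.
  by rewrite /dot big1// => j _; rewrite ffunE mul0r.
by case: ifP => _; rewrite ?addr0// cosBpihalf.
Qed.

Lemma pos_freqN d (k : freq d) : k != 0 -> pos_freq (- k) = ~~ pos_freq k.
Proof.
move=> k0.
have [j kj jmin] : exists2 j : 'I_d, k j != 0 & forall i : 'I_d, (i < j)%N ->
  k i = 0.
  have [j0 kj0] : exists j : 'I_d, k j != 0.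
    apply/existsP; apply: contraNT k0; rewrite negb_exists => /forallP H.
    by apply/eqP/ffunP => j; rewrite ffunE; apply/eqP; have := H j;
      rewrite negbK.
  have [j kj jmin] := @arg_minnP _ j0 (fun j => k j != 0) (fun j =>
    j : nat) kj0.
  exists j => // i ij; apply/eqP; apply: contraTT ij => /jmin;
    by rewrite -leqNgt.
have pE (q : freq d) : q j != 0 -> (forall i : 'I_d, (i < j)%N -> q i = 0) ->
    pos_freq q = (0 < q j).
  move=> qj qmin; apply/existsP/idP => [[i /andP[qi /forallP H]]|qj0].
    have [ij|ji|/val_inj <-//] := ltngtP i j;
      first by rewrite qmin// ltxx in qi.
    by have := H j; rewrite ji (negbTE qj).
  by exists j; rewrite qj0; apply/forallP => i; apply/implyP => /qmin ->.
rewrite !pE ?ffunE ?oppr_eq0//; last by move=> i ij; rewrite ffunE jmin// oppr0.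
by rewrite oppr_gt0 -leNgt lt_neqAle kj.
Qed.

(** Of k and -k, one carries the cosine and the other the sine. The cosine of this sum is the cross
    term of [Rintegral_waveM], which therefore vanishes. *)
Lemma phaseN d (k : freq d) : k != 0 -> phase (- k) + phase k = - (pi / 2).
Proof.
move=> k0; rewrite /phase oppr_eq0 (negbTE k0) pos_freqN//.
by case: (pos_freq k); rewrite /= ?addr0 ?add0r.
Qed.

End Orthogonality.

Section TrigPoly.
Context {R : realType} (d : nat) (K : finType) (e : K -> freq d).
Hypothesis e_inj : injective e.

Lemma esum_finType (P : set K) (a : K -> \bar R) :
  (forall i, (0 <= a i)%E) ->
  (\esum_(i in P) a i = \sum_(i : K | i \in P) a i)%E.
Proof.
move=> a0; rewrite esum_mkcond esum_fset; [|exact: finite_finset|by move=> i _;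
  case: ifP].
rewrite [RHS]big_mkcond/= [RHS]fsbig_seq ?index_enum_uniq//.
apply: eq_fsbigl; by apply/seteqP; split => // i _ /=; exact: mem_index_enum.
Qed.

Lemma esum_range (P : set (freq d)) (a : freq d -> \bar R) (g : K -> \bar R) :
  (forall k, (0 <= a k)%E) -> (forall i, a (e i) = g i) ->
  (forall k, (forall i, e i <> k) -> a k = 0%E) ->
  (\esum_(k in P) a k = \sum_(i : K | e i \in P) g i)%E.
Proof.
move=> a0 ag az.
rewrite (_ : \esum_(k in P) a k = \esum_(k in P `&` range e) a k)%E; last first.
  rewrite esum_mkcondr; apply: eq_esum => k _; case: ifPn => // /negP H.
  by apply: az => i ik; apply: H; rewrite inE; exists i.
rewrite (_ : P `&` range e = e @` (e @^-1` P)); last first.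
  apply/seteqP; split => [k [Pk [i _ ik]]|k [i Pi <-]] /=.
    by exists i => //=; rewrite ik.
  by split => //; exists i.
rewrite esum_image; last by move=> i j _ _; exact: e_inj.
rewrite esum_finType => [|i]; last exact: a0.
by apply: eq_big => [i|i _]; [apply/idP/idP; rewrite !in_setE|rewrite ag].
Qed.

(** Arbitrary phases are allowed because a translation of the argument turns a Fourier polynomial
    into a sum of this kind. *)
Definition phased_poly (b c : K -> R) (x : vec R d) : R :=
  \sum_i b i * (Num.sqrt 2 * wave (e i) (c i) x).

Let mc := @measurable_cube R d.

Lemma integrable_phased_poly b c :
  (lebesgue_vec d).-integrable (@cube R d) (EFin \o phased_poly b c).
Proof.
rewrite (_ : _ \o _ = fun x =>
  \sum_i ((b i * Num.sqrt 2)%:E * (EFin \o wave (e i) (c i)) x)%E).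
  by apply: integrable_sum => // i _; apply: integrableZl => //;
    exact: integrable_wave.
apply/funext => x /=; rewrite /phased_poly -sumEFin; apply: eq_bigr => i _.
by rewrite mulrA EFinM.
Qed.

Lemma theta_phased_poly b c k : theta (phased_poly b c) k =
  \sum_i b i * ((e i == k)%:R * cos (c i - phase k) +
                (e i == - k)%:R * cos (c i + phase k)).
Proof.
rewrite /theta.
transitivity (fine (\int[lebesgue_vec d]_(x in @cube R d)
    \sum_i (b i * 2)%:E * (wave (e i) (c i) x * wave k (phase k) x)%:E)%E).
  congr fine; apply: eq_integral => x _;
    rewrite /phased_poly fourierE mulr_suml -sumEFin.
  apply: eq_bigr => i _; rewrite -EFinM; congr (_%:E).
  rewrite -[X in _ = b i * X * _](sqr_sqrtr (ler0n R 2)); lra.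
rewrite integral_sum//; last first.
  by move=> i; apply: integrableZl => //; exact: integrable_waveM.
transitivity (fine (\sum_i (b i * ((e i == k)%:R * cos (c i - phase k) +
                (e i == - k)%:R * cos (c i + phase k)))%:E)%E);
                  last by rewrite sumEFin.
congr fine; apply: eq_bigr => i _.
rewrite integralZl//; last exact: integrable_waveM.
have fin : (\int[lebesgue_vec d]_(x in @cube R d) (wave (e i) (c i) x *
  wave k (phase k) x)%:E)%E
    \is a fin_num.
  by apply: integrable_fin_num => //; exact: integrable_waveM.
rewrite -(fineK fin) -EFinM; congr (_%:E).
have := Rintegral_waveM (e i) k (c i) (phase k); rewrite /Rintegral => ->; lra.
Qed.

Definition fourier_poly (b : K -> R) (x : vec R d) : R :=
  \sum_i b i * fourier (e i) x.

Lemma fourier_polyE b : fourier_poly b = phased_poly b (fun i => phase (e i)).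
Proof. by apply/funext => x; apply: eq_bigr => i _; rewrite fourierE. Qed.

Lemma theta_fourier_poly b k : theta (fourier_poly b) k =
  \sum_i b i * (e i == k)%:R.
Proof.
rewrite fourier_polyE theta_phased_poly; apply: eq_bigr => i _; congr (_ * _).
have [k0|k0] := eqVneq k 0.
  rewrite k0 oppr0 -mulrDr; have [->|_] := eqVneq (e i) 0;
    last by rewrite mul0r.
  rewrite subrr cos0 mul1r /phase eqxx.
  by rewrite (_ : pi / 4 + pi / 4 = pi / 2) ?cos_pihalf ?addr0//; lra.
have cN : e i = - k -> cos (phase (e i) + phase k) = 0 :> R.
  by move=> ->; rewrite phaseN// cosN cos_pihalf.
have [->|_] := eqVneq (e i) k.
  have kk : (k == - k) = false.
    apply/eqP => /ffunP kk; move/eqP: k0; apply; apply/ffunP => j.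
    by have := kk j; rewrite !ffunE; lra.
  by rewrite kk subrr cos0 mulr1 mul0r addr0.
by rewrite mul0r add0r; have [/cN ->|_] := eqVneq (e i) (- k);
  rewrite ?mulr0 ?mul0r.
Qed.

Lemma theta_fourier_poly_inj b i : theta (fourier_poly b) (e i) = b i.
Proof.
rewrite theta_fourier_poly (bigD1 i)//= eqxx mulr1 big1 ?addr0// => j ji.
by rewrite (inj_eq e_inj) (negbTE ji) mulr0.
Qed.

Lemma theta_fourier_poly_out b k : (forall i, e i <> k) ->
  theta (fourier_poly b) k = 0.
Proof.
by move=> ek; rewrite theta_fourier_poly big1// => i _; case: eqP (ek i) => //;
  rewrite mulr0.
Qed.

Lemma esum_theta_fourier_poly b (P : set (freq d)) (w : freq d -> R) :
  (forall k, 0 <= w k) ->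
  (\esum_(k in P) (w k * theta (fourier_poly b) k ^+ 2)%:E =
   (\sum_(i | e i \in P) w (e i) * b i ^+ 2)%:E)%E.
Proof.
move=> w0; rewrite (@esum_range P _ (fun i => (w (e i) * b i ^+ 2)%:E))
  ?sumEFin//.
- by move=> k; rewrite lee_fin mulr_ge0// sqr_ge0.
- by move=> i; rewrite theta_fourier_poly_inj.
- by move=> k ek; rewrite theta_fourier_poly_out// expr0n mulr0.
Qed.

Definition translate (j : 'I_d) (t : R) (x : vec R d) : vec R d :=
  [tuple tnth x i + (i == j)%:R * t | i < d].

Lemma dot_translate (k : freq d) j t x :
  dot k (translate j t x) = dot k x + (k j)%:~R * t.
Proof.
rewrite /dot (eq_bigr (fun i => (k i)%:~R * tnth x i + (i == j)%:R *
  ((k i)%:~R * t))).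
  rewrite big_split/= (bigD1 j)//= [X in _ + X](bigD1 j)//= eqxx mul1r.
  by rewrite [X in _ + (_ + X)]big1 ?addr0// => i /negbTE ->; rewrite mul0r.
by move=> i _; rewrite tnth_mktuple; lra.
Qed.

(* Translating by half a period of the k-th wave in direction j changes the sign
   of its coefficient. *)
Lemma theta_translate_invariant b j :
  (forall t x, fourier_poly b (translate j t x) = fourier_poly b x) ->
  forall k : freq d, k j != 0 -> theta (fourier_poly b) k = 0.
Proof.
move=> inv k kj.
have kjR : (k j)%:~R != 0 :> R by rewrite intr_eq0.
pose t : R := (2 * (k j)%:~R)^-1.
have kt : (k j)%:~R * t = 1 / 2 :> R.
  by rewrite /t invfM mulrCA mulfV// mulr1 mul1r.
have k0 : k != 0 by apply: contraNneq kj => ->; rewrite ffunE.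
have E : fourier_poly b = phased_poly b (fun i =>
  phase (e i) + 2 * pi * ((e i j)%:~R * t)).
  apply/funext => x; rewrite -(inv t); apply: eq_bigr => i _; rewrite fourierE.
  by rewrite /wave dot_translate; congr (_ * (_ * cos _)); lra.
suff : theta (fourier_poly b) k = - theta (fourier_poly b) k by lra.
rewrite {1}E theta_phased_poly theta_fourier_poly -sumrN; apply: eq_bigr => i _.
rewrite -mulrN; congr (_ * _).
have [->|ik] := eqVneq (e i) k.
  have kk : (k == - k) = false.
    apply/eqP => /ffunP kk; move/eqP: k0; apply; apply/ffunP => i'.
    by have := kk i'; rewrite !ffunE; lra.
  rewrite kk kt mul0r addr0 mul1r (_ : _ + _ - _ = pi) ?cospi//; lra.
rewrite mul0r add0r oppr0; have [->|_] := eqVneq (e i) (- k);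
  last by rewrite mul0r.
have := @phaseN R _ _ k0; rewrite ffunE rmorphN mulNr kt => ph.
rewrite mul1r (_ : _ + _ + _ = - (pi / 2) - pi); last by move: ph; lra.
by rewrite -cosN opprB opprK cosDpihalf sinpi oppr0 mulr0.
Qed.

(** If j lies in J but not in J', factoring through J' makes the function invariant under
    translations along j. Then Q_j = 0, against Q_j >= 1. Used both ways, this makes the pattern
    unique. *)
Lemma fourier_poly_pattern_sub b dstar J J' :
  is_pattern dstar (fourier_poly b) J -> is_pattern dstar (fourier_poly b) J' ->
    J \subset J'.
Proof.
move=> [_ _ QJ] [_ [fbar fE] _]; apply/fintype.subsetP => j jJ;
  apply: contraT => jJ'.
have inv t x : fourier_poly b (translate j t x) = fourier_poly b x.
  rewrite !fE; congr fbar; apply: eq_from_tnth => i; rewrite !tnth_mktuple.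
  rewrite (_ : enum_val i == j = false) ?mul0r ?addr0//.
  by apply: contraNF jJ' => /eqP <-; exact: enum_valP.
have := QJ j jJ; rewrite /Q esum1 ?lee_fin ?ler10// => k kj.
by rewrite (theta_translate_invariant inv)// expr0n.
Qed.

Lemma fourier_poly_pattern b dstar J :
  is_pattern dstar (fourier_poly b) J -> pattern dstar (fourier_poly b) = J.
Proof.
move=> pJ; have pP : is_pattern dstar (fourier_poly b)
  (pattern dstar (fourier_poly b)).
  exact: (@xgetPex _ finset.set0 [set J | is_pattern dstar (fourier_poly b) J]
    (ex_intro _ J pJ)).
by apply/eqP; rewrite finset.eqEsubset !(fourier_poly_pattern_sub pP pJ,
  fourier_poly_pattern_sub pJ pP).
Qed.

End TrigPoly.

(** * The series h and its saddle point *)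

Section ThetaSeries.
Context {R : realType}.

(** Each of the first n terms of the geometric series is at least q^n. *)
Lemma natr_expr_le (q : R) (n : nat) : 0 <= q < 1 -> n%:R * q ^+ n <=
  (1 - q)^-1.
Proof.
move=> /andP[q0 q1]; have p0 : 0 < 1 - q by rewrite subr_gt0.
rewrite -[leRHS]mul1r ler_pdivlMr// mulrC.
have -> : 1 - q = - (q - 1) by rewrite opprB.
apply: (@le_trans _ _ (- (q - 1) * \sum_(i < n) q ^+ i)).
  rewrite opprB ler_pM2l// -[n in n%:R]card_ord -sum1_card natr_sum mulr_suml.
  apply: ler_sum => i _; rewrite mul1r; apply: ler_wiXn2l => //;
    first exact: ltW.
  exact: ltnW.
by rewrite mulNr -subrX1 opprB gerBl exprn_ge0.
Qed.

(** Abel's criterion: it gives convergence at every smaller positive radius and, again after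
    shrinking the radius, passes to the differentiated series. Termwise differentiation needs
    convergence of the first two derived series. *)
Definition pbounded (f : nat -> R) (x : R) := exists B, forall n,
  `|f n| * x ^+ n <= B.

Lemma pbounded_diffs f x y : 0 < y -> y < x -> pbounded f x ->
  pbounded (pseries_diffs f) y.
Proof.
move=> y0 yx [B HB]; have x0 : 0 < x := lt_trans y0 yx.
have q1 : 0 <= y / x < 1 by rewrite divr_ge0 ?(ltW y0) ?(ltW x0)//=
  ltr_pdivrMr// mul1r.
have B0 : 0 <= B := le_trans (mulr_ge0 (normr_ge0 _) (exprn_ge0 _ (ltW x0)))
  (HB 0%N).
exists (B * (1 - y / x)^-1 / y) => n; rewrite /pseries_diffs normrM ger0_norm//.
rewrite ler_pdivlMr// -mulrA -exprSr.
have -> : n.+1%:R * `|f n.+1| * y ^+ n.+1 =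
    (`|f n.+1| * x ^+ n.+1) * (n.+1%:R * (y / x) ^+ n.+1).
  have xn : x ^+ n.+1 != 0 by rewrite expf_neq0// gt_eqF.
  rewrite expr_div_n -{1}(divfK xn (y ^+ n.+1)); lra.
apply: ler_pM => //; last exact: natr_expr_le.
- by rewrite mulr_ge0// exprn_ge0// ltW.
- by rewrite mulr_ge0// exprn_ge0//; case/andP: q1.
Qed.

Lemma pbounded_cvg f x y : 0 < y -> y < x -> pbounded f x -> cvgn (pseries f y).
Proof.
move=> y0 yx [B HB]; have x0 : 0 < x := lt_trans y0 yx.
apply: normed_cvg.
apply: (@series_le_cvg _ _ (geometric B (y / x))) => [n|n|n|].
- exact: normr_ge0.
- have B0 : 0 <= B := le_trans (mulr_ge0 (normr_ge0 _) (exprn_ge0 _ (ltW x0)))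
    (HB 0%N).
  by rewrite mulr_ge0// exprn_ge0// divr_ge0// ltW.
- rewrite /geometric/= expr_div_n mulrA ler_pdivlMr ?exprn_gt0//.
  rewrite normrM (ger0_norm (exprn_ge0 _ (ltW y0))) mulrAC ler_wpM2r//.
  by rewrite exprn_ge0// ltW.
- apply: is_cvg_geometric_series;
    rewrite ger0_norm ?divr_ge0 ?(ltW y0) ?(ltW x0)//.
  by rewrite ltr_pdivrMr// mul1r.
Qed.

(* c n is the number of integers r with r ^ 2 = n. *)
Definition sqcoef (n : nat) : R :=
  (n == 0)%:R + 2 * \sum_(r < n) ((r.+1 ^ 2 == n)%N)%:R.

(** The cut at (M + 1)^2 stops just before the first square left out, so the partial sums indexed by
    r form a subsequence of those of the power series. *)
Lemma sum_sqcoef (F : nat -> R) M :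
  \sum_(0 <= n < M.+1 ^ 2) sqcoef n * F n =
    F 0%N + 2 * \sum_(r < M) F (r.+1 ^ 2)%N.
Proof.
rewrite big_mkord.
set N := (M.+1 ^ 2)%N.
have N0 : (0 < N)%N by rewrite expn_gt0.
transitivity (\sum_(n < N) ((n == 0 :> nat)%:R * F n) +
   2 * \sum_(n < N) \sum_(r < N) ((r.+1 ^ 2 == n)%N)%:R * F n).
  rewrite mulr_sumr -big_split/=; apply: eq_bigr => n _.
  rewrite /sqcoef mulrDl -mulrA mulr_suml; congr (_ + 2 * _).
  rewrite (big_ord_widen N (fun r => ((r.+1 ^ 2 == n)%N)%:R * F n)
    (ltnW (ltn_ord n))).
  rewrite big_mkcond/=; apply: eq_bigr => r _; case: ifPn => // rn.
  case: eqP => [E|]; last by rewrite mul0r.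
  by move: rn; rewrite -E -leqNgt leqNgt expnS expn1
    (leq_trans _ (leq_pmulr _ _)).
congr (_ + 2 * _).
  rewrite (bigD1 (Ordinal N0))//= mul1r big1 ?addr0// => i /negbTE i0.
  by rewrite -val_eqE/= in i0; rewrite i0 mul0r.
rewrite exchange_big/= -/N.
rewrite (eq_bigr (fun r : 'I_N => if (r < M)%N then F (r.+1 ^ 2)%N else 0));
  last first.
  move=> r _; case: ifPn => rM.
    have rN : (r.+1 ^ 2 < N)%N by rewrite ltn_exp2r.
    rewrite (bigD1 (Ordinal rN))//= eqxx mul1r big1 ?addr0// => i ir.
    by rewrite eq_sym -(inj_eq val_inj)/= in ir; rewrite (negbTE ir) mul0r.
  rewrite big1// => i _; case: eqP => [E|]; last by rewrite mul0r.
  by move: (ltn_ord i); rewrite -E ltnNge leq_exp2r// ltnS leqNgt rM.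
rewrite -big_mkcond/= -(big_ord_widen N (fun r => F (r.+1 ^ 2)%N))//.
by rewrite ltnW// (leq_trans _ (leq_pmulr _ _)).
Qed.

Lemma pbounded_sqcoef x : 0 < x < 1 -> pbounded sqcoef x.
Proof.
move=> /andP[x0 x1].
have [B HB] : pbounded (pseries_diffs (cst 1)) x.
  by apply: (@pbounded_diffs _ 1) => //; exists 1 => n;
    rewrite expr1n mulr1 normr1.
exists (2 * B) => n; apply: le_trans (ler_wpM2l (ler0n _ 2) (HB n)).
rewrite mulrA ler_wpM2r ?exprn_ge0 ?(ltW x0)//.
rewrite /pseries_diffs/= mulr1 !ger0_norm//; last first.
  by rewrite addr_ge0// mulr_ge0// sumr_ge0.
have : \sum_(r < n) ((r.+1 ^ 2 == n)%N)%:R <= n%:R :> R.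
  rewrite -[n in leRHS]card_ord -sum1_card natr_sum.
  by apply: ler_sum => r _; rewrite ler_nat leq_b1.
have : (n == 0)%:R <= 1 :> R by rewrite lern1 leq_b1.
rewrite /sqcoef -[n.+1%:R]natr1; lra.
Qed.

Lemma sym_sumE (F : nat -> R) M :
  \sum_(i < M.*2.+1) F (`|(i%:Z - M%:Z)%R|%N) = F 0%N + 2 * \sum_(r < M) F r.+1.
Proof.
rewrite -(big_mkord xpredT (fun i => F (`|(i%:Z - M%:Z)%R|%N))).
rewrite (@big_cat_nat _ _ _ M)//=; last by rewrite -addnn leqW// leq_addr.
rewrite -{3}[M]add0n big_addn -addnn subSn ?leq_addr// addnK big_nat_recl//.
rewrite add0n subrr absz0 big_mkord addrCA; congr (_ + _).
rewrite mulr_natl mulr2n; congr (_ + _).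
  rewrite (reindex_inj rev_ord_inj)/=; apply: eq_bigr => i _; congr F.
  by rewrite distnEr ?leq_subr// subKn.
rewrite big_mkord; apply: eq_bigr => i _; congr F.
by rewrite PoszD addrK.
Qed.

End ThetaSeries.

Section HFun.
Context {R : realType}.
Implicit Types z g : R.

Definition sqr_sum z (M : nat) := \sum_(r < M) z ^+ (r.+1 ^ 2).
Definition sqr_moment_sum z (M : nat) := \sum_(r < M) (r.+1 ^ 2)%:R *
  z ^+ (r.+1 ^ 2).

Lemma partial_hE z M :
  \sum_(i < M.*2.+1) z ^+ (`|(i%:Z - M%:Z)%R|%N ^ 2) = 1 + 2 * sqr_sum z M.
Proof. by rewrite (sym_sumE (fun r => z ^+ (r ^ 2)))/= expr0. Qed.

Lemma cvg_sqr_oo : (fun M => (M.+1 ^ 2)%N) @ \oo --> \oo.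
Proof.
apply/cvgnyPge => A; near=> n.
have An : (A <= n)%N by near: n; exact: nbhs_infty_ge.
by rewrite (leq_trans An)// (leq_trans (leqnSn n))// expnS expn1 leq_pmulr.
Unshelve. all: by end_near. Qed.

Lemma cvg_sqcoef (z : R) : 0 < z < 1 ->
  [/\ cvgn (pseries sqcoef z), cvgn (pseries (pseries_diffs sqcoef) z) &
      cvgn (pseries (pseries_diffs (pseries_diffs sqcoef)) z)].
Proof.
move=> /andP[z0 z1].
pose y1 := (z + 1) / 2; pose y2 := (y1 + 1) / 2; pose y3 := (y2 + 1) / 2.
have b0 : pbounded sqcoef y3 by apply: pbounded_sqcoef;
  rewrite /y3 /y2 /y1; lra.
have b1 : pbounded (pseries_diffs sqcoef) y2.
  by apply: (pbounded_diffs _ _ b0); rewrite /y3 /y2 /y1; lra.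
have b2 : pbounded (pseries_diffs (pseries_diffs sqcoef)) y1.
  by apply: (pbounded_diffs _ _ b1); rewrite /y3 /y2 /y1; lra.
split; [apply: (pbounded_cvg z0 _ b0)|apply: (pbounded_cvg z0 _ b1)|
  apply: (pbounded_cvg z0 _ b2)]; rewrite /y3 /y2 /y1; lra.
Qed.

Lemma cvg_sqr_sum_pseries z : 0 < z < 1 ->
  (fun M => 1 + 2 * sqr_sum z M) @ \oo --> limn (pseries sqcoef z).
Proof.
move=> /cvg_sqcoef[c0 _ _].
have := cvg_comp _ _ cvg_sqr_oo c0; apply: cvg_trans; apply: near_eq_cvg.
by apply: nearW => M /=;
  rewrite /pseries/series/= (sum_sqcoef (fun n => z ^+ n)).
Qed.

Lemma h_fun_pseries z : 0 < z < 1 -> h_fun z = limn (pseries sqcoef z).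
Proof.
move=> z01; rewrite /h_fun.
under eq_fun do rewrite partial_hE.
exact/cvg_lim/cvg_sqr_sum_pseries.
Qed.

Lemma cvg_h_fun z : 0 < z < 1 -> (fun M => 1 + 2 * sqr_sum z M) @ \oo -->
  h_fun z.
Proof. by move=> z01; rewrite h_fun_pseries//; exact: cvg_sqr_sum_pseries. Qed.

(** The derivative is recorded through the limit of moment sums because all later estimates compare
    partial sums and pass to the limit. *)
Lemma is_derive_h_fun z : 0 < z < 1 -> exists D : R,
  is_derive z (1 : R) h_fun D /\
    (fun M => 2 * sqr_moment_sum z M) @ \oo --> z * D.
Proof.
move=> z01; have /andP[z0 z1] := z01.
pose k := (z + 1) / 2.
have k01 : 0 < k < 1 by rewrite /k; lra.
have [k0 k1 k2] := cvg_sqcoef k01.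
have zk : `|z| < `|k| by rewrite !ger0_norm /k; lra.
have [_ c1 _] := cvg_sqcoef z01.
exists (limn (pseries (pseries_diffs sqcoef) z)); split.
  apply: near_eq_is_derive (pseries_snd_diffs k0 k1 k2 zk).
  near=> y; apply/esym/h_fun_pseries; apply/andP; split; near: y.
    exact: lt_nbhsr.
  exact: lt_nbhsl.
have := cvg_comp _ _ cvg_sqr_oo (pseries_diffs_equiv c1).
move=> c; apply: (cvg_trans _ (cvgM (cvg_cst z) c)); apply: near_eq_cvg.
apply: nearW => M /=; rewrite /series/= mulr_sumr.
have := sum_sqcoef (fun n => n%:R * z ^+ n) M; rewrite mul0r add0r => <-.
apply: eq_bigr => n _; case: n => [|n]; first by rewrite !mul0r mulr0 ?mulr0.
rewrite exprS /=; lra.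
Unshelve. all: by end_near. Qed.

Lemma ge1_partial z M : 0 < z -> 1 <= 1 + 2 * sqr_sum z M.
Proof.
move=> z0; rewrite lerDl mulr_ge0// sumr_ge0// => r _; exact/exprn_ge0/ltW.
Qed.

Lemma partial_le_h_fun z M : 0 < z < 1 -> 1 + 2 * sqr_sum z M <= h_fun z.
Proof.
move=> z01; have /andP[z0 z1] := z01.
have c := @cvg_h_fun _ z01; rewrite -(cvg_lim _ c)//.
apply: (nondecreasing_cvgn_le _ (cvgP _ c)).
move=> m n mn; rewrite lerD2l ler_wpM2l// /sqr_sum.
rewrite -(subnKC mn) big_split_ord/= lerDl sumr_ge0// => r _;
  exact/exprn_ge0/ltW.
Qed.

Lemma h_fun_ge1 z : 0 < z < 1 -> 1 <= h_fun z.
Proof.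
move=> z01; apply: le_trans (partial_le_h_fun 0 z01); apply: ge1_partial.
by case/andP: z01.
Qed.

Lemma is_derive_l_fun g z : 0 < z < 1 -> exists D : R,
  is_derive z (1 : R) (l_fun g) (D / h_fun z - g / z) /\
    (fun M => 2 * sqr_moment_sum z M) @ \oo --> z * D.
Proof.
move=> z01; have /andP[z0 z1] := z01.
have [D [dh cD]] := is_derive_h_fun z01; exists D; split => //.
have h0 : 0 < h_fun z := lt_le_trans ltr01 (h_fun_ge1 z01).
have d1 := @is_derive1_comp _ _ _ z _ _ (is_derive1_ln h0) dh.
have d2 := @is_deriveZ _ _ _ _ g z 1 _ (is_derive1_ln z0).
by have := is_deriveB d1 d2; rewrite [_^-1 * _]mulrC.
Qed.

(* Its convergence to g / 2 is the saddle point equation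
   sum_r r ^ 2 z ^ (r ^ 2) = g * h z. *)
Definition saddle_sum z g (M : nat) := \sum_(r < M) ((r.+1 ^ 2)%:R - g) *
  z ^+ (r.+1 ^ 2).

Lemma saddle_sumE z g M : saddle_sum z g M = sqr_moment_sum z M -
  g * sqr_sum z M.
Proof. by rewrite /sqr_moment_sum /sqr_sum mulr_sumr -sumrB;
  apply: eq_bigr => r _; lra. Qed.

(** A critical point of [l_fun g] satisfies z h'(z) = g h(z). Restricting the sum of (r^2 - g)
    z^(r^2) to r > 0 halves it and moves the term r = 0 to the other side, which leaves g / 2. *)
Lemma saddle_eq z g : 0 < z < 1 -> derive1 (l_fun g) z = 0 ->
  saddle_sum z g @ \oo --> g / 2 /\ (fun M => 2 * sqr_moment_sum z M) @ \oo -->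
    g * h_fun z.
Proof.
move=> z01; have /andP[z0 z1] := z01.
have [D [dl cD]] := is_derive_l_fun g z01.
rewrite derive1E; have [_ ->] := dl => E.
have h0 : 0 < h_fun z := lt_le_trans ltr01 (h_fun_ge1 z01).
have DE : z * D = g * h_fun z.
  have hn0 : h_fun z != 0 by rewrite gt_eqF.
  have zn0 : z != 0 by rewrite gt_eqF.
  rewrite -{1}(divfK hn0 D) -{1}(divfK zn0 g) (subr0_eq E); lra.
split; last by rewrite -DE.
have cS0 : (fun M => 1 + 2 * sqr_sum z M) @ \oo --> h_fun z := cvg_h_fun z01.
have -> : g / 2 = 2^-1 * (z * D) - g / 2 * (h_fun z - 1) by rewrite DE; lra.
apply: (cvg_trans _ (cvgB (cvgM (cvg_cst _) cD)
  (cvgM (cvg_cst _) (cvgB cS0 (cvg_cst (1 : R)))))).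
by apply: near_eq_cvg; apply: nearW => M /=; rewrite !fctE saddle_sumE /=; lra.
Qed.

End HFun.

Section Saddle.
Context {R : realType}.
Implicit Types z g L : R.

Lemma bernoulli_ge (x : R) n : 0 <= x <= 1 -> 1 - n%:R * x <= (1 - x) ^+ n.
Proof.
move=> /andP[x0 x1]; elim: n => [|n IH]; first by rewrite mul0r subr0 expr0.
rewrite exprS; apply: le_trans (ler_wpM2l _ IH); last by lra.
rewrite -natr1; have : 0 <= n%:R * x * x by rewrite !mulr_ge0.
lra.
Qed.

Lemma sqr_sum_ge z M : 0 < z < 1 -> M%:R * z ^+ (M ^ 2) <= sqr_sum z M.
Proof.
move=> /andP[z0 z1]; rewrite /sqr_sum -[M in M%:R]card_ord -sum1_card natr_sum
  mulr_suml.
apply: ler_sum => r _; rewrite mul1r; apply: ler_wiXn2l; rewrite ?ltW//.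
by rewrite leq_exp2r.
Qed.

(** Near both ends of (0, 1) the function exceeds its value at 1/2, so its minimum over a closed
    subinterval is attained inside, where the derivative vanishes. *)
Lemma saddle_exists g : 0 < g -> exists z, 0 < z < 1 /\ derive1 (l_fun g) z = 0.
Proof.
move=> g0; pose l := l_fun g.
have half01 : 0 < (1 / 2 : R) < 1 by apply/andP; split; lra.
have l0 : 0 <= l (1 / 2).
  rewrite /l /l_fun subr_ge0; apply: (@le_trans _ _ 0);
    last exact/ln_ge0/h_fun_ge1.
  by rewrite nmulr_lle0 ?ltW// ln_lt0.
(* Chosen so that - g ln a = l(1/2) + 1, while ln h(a) >= 0. *)
pose a := expR (- ((l (1 / 2) + 1) / g)).
have a0 : 0 < a by exact: expR_gt0.
have a01 : 0 < a < 1.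
  by rewrite a0 expR_lt1 oppr_lt0 divr_gt0//; lra.
have la : l (1 / 2) < l a.
  have : 0 <= ln (h_fun a) by exact/ln_ge0/h_fun_ge1.
  have -> : l a = ln (h_fun a) - g * ln a by [].
  rewrite [ln a]expRK mulrN opprK [g * _]mulrC divfK ?gt_eqF//; lra.
have [M M2 hM] : exists2 M, (1 < M)%N & expR (l (1 / 2)) < M%:R :> R.
  pose M := (Num.truncn (expR (l (1 / 2)))).+2; exists M => //.
  apply: lt_trans (truncnS_gt _) _; by rewrite ltr_nat.
have M2r : 2 <= M%:R :> R by rewrite ler_nat.
(* By Bernoulli's inequality b^(M^2) >= 1/2, so the first M squares already give h(b) >= 1 + M,
   which is more than exp (l(1/2)). *)
pose x : R := (2 * (M ^ 2)%:R)^-1; pose b := 1 - x.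
have Mp : 0 < (M ^ 2)%:R :> R by rewrite ltr0n expn_gt0 (ltn_trans _ M2).
have Mx : (M ^ 2)%:R * x = 1 / 2.
  by rewrite /x invfM mulrCA mulfV ?gt_eqF// mulr1 mul1r.
have x0 : 0 < x by rewrite invr_gt0 mulr_gt0.
have x1 : x <= 1 / 4.
  have : 2 * x <= (M ^ 2)%:R * x.
    rewrite ler_pM2r// ler_nat (leq_trans M2)// expnS expn1 leq_pmulr//.
    exact: ltn_trans M2.
  lra.
have b01 : 0 < b < 1 by rewrite /b; lra.
have lb : l (1 / 2) < l b.
  have hb : expR (l (1 / 2)) < h_fun b.
    apply: lt_le_trans (partial_le_h_fun M b01).
    have bM : 1 / 2 <= b ^+ (M ^ 2).
      have : 0 <= x <= 1 by lra.
      move=> /(@bernoulli_ge x (M ^ 2)); rewrite Mx /b; lra.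
    have := sqr_sum_ge M b01; have : M%:R * (1 / 2) <=
      M%:R * b ^+ (M ^ 2) by rewrite ler_wpM2l.
    lra.
  have -> : l b = ln (h_fun b) - g * ln b by [].
  rewrite ltrBrDr; apply: (@le_lt_trans _ _ (l (1 / 2))).
    by rewrite gerDl nmulr_lle0 ?ltW// ln_lt0.
  by rewrite -[ltLHS]expRK ltr_ln ?posrE ?expR_gt0// (lt_trans _ hb)// expR_gt0.
have ahalf : a < 1 / 2.
  rewrite ltNge; apply/negP => ha.
  have : - g * ln a <= - g * ln (1 / 2).
    by rewrite ler_wnM2l ?oppr_le0 ?(ltW g0)// ler_ln ?posrE//; lra.
  have : 0 <= ln (h_fun (1 / 2) : R) by exact/ln_ge0/h_fun_ge1.
  rewrite /a expRK mulrN mulNr opprK [g * (_ / _)]mulrC divfK ?gt_eqF//.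
  move=> h1 h2.
  have : l (1 / 2) = ln (h_fun (1 / 2)) - g * ln (1 / 2) by [].
  lra.
have bhalf : 1 / 2 < b by rewrite /b; lra.
have ab : a < b := lt_trans ahalf bhalf.
have in01 t : a <= t <= b -> 0 < t < 1.
  by move=> /andP[at_ tb]; rewrite (lt_le_trans a0 at_) (le_lt_trans tb);
    case/andP: b01.
have dl t : a <= t <= b -> derivable l t 1.
  by move=> /in01 /(is_derive_l_fun g)[D [[]]].
have cl : {within `[a, b], continuous l}.
  apply: derivable_within_continuous => t; rewrite in_itv/=; exact: dl.
have [c cab cmin] := EVT_min (ltW ab) cl.
have chalf : l c <= l (1 / 2) by apply: cmin; rewrite in_itv/= !ltW.
exists c; move: cab; rewrite in_itv/= => cab; split; first exact: in01.
have c_oo : c \in `]a, b[.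
  rewrite in_itv/= !lt_neqAle; case/andP: (cab) => -> ->; rewrite !andbT.
  by apply/andP; split; apply/eqP => E; move: chalf;
    [rewrite -E leNgt la|rewrite E leNgt lb].
rewrite derive1E; have [|t|_ ->//] := @derive1_at_min R l a b c (ltW ab) _ c_oo.
- by move=> t; rewrite in_itv/= => /andP[at_ tb]; apply: dl; rewrite !ltW.
- by rewrite in_itv/= => /andP[at_ tb]; apply: cmin; rewrite in_itv/= !ltW.
Qed.

Lemma saddleP g : 0 < g ->
  0 < saddle g < 1 /\ derive1 (l_fun g) (saddle g) = 0.
Proof.
move=> /saddle_exists[z hz].
exact: (@xgetPex _ 0 [set z | 0 < z < 1 /\ derive1 (l_fun g) z = 0]
  (ex_intro _ z hz)).
Qed.

End Saddle.

(** * Quantitative bounds on the saddle point *)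

Section RootBounds.
Context {R : realType}.
Implicit Types z g L q : R.

Lemma sum_geometric_le (q : R) M : 0 <= q < 1 -> \sum_(r < M) q ^+ r <=
  (1 - q)^-1.
Proof.
move=> /andP[q0 q1]; have p0 : 0 < 1 - q by rewrite subr_gt0.
rewrite -[leRHS]mul1r ler_pdivlMr// mulrC -opprB mulNr -subrX1 opprB gerBl.
exact: exprn_ge0.
Qed.

Section Root.
Variables (z g : R).
Hypotheses (z01 : 0 < z < 1) (g0 : 0 < g) (zg : derive1 (l_fun g) z = 0).

Let z0 : 0 < z. Proof. by case/andP: z01. Qed.
Let z1 : z < 1. Proof. by case/andP: z01. Qed.
Let cU : saddle_sum z g @ \oo --> g / 2. Proof. by have [] :=
  saddle_eq z01 zg. Qed.
Let cS2 : (fun M => 2 * sqr_moment_sum z M) @ \oo --> g * h_fun z.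
Proof. by have [] := saddle_eq z01 zg. Qed.
Let cS0 : (fun M => 1 + 2 * sqr_sum z M) @ \oo --> h_fun z.
Proof. exact: cvg_h_fun. Qed.
Let zn n : 0 < z ^+ n. Proof. exact: exprn_gt0. Qed.

Lemma h_fun_gt1D : 1 + 2 * z <= h_fun z.
Proof.
by have := partial_le_h_fun 1 z01; rewrite /sqr_sum big_ord1 exp1n expr1.
Qed.

(** Since r^2 >= 1 for r <> 0, the saddle equation gives h - 1 <= g h. For g < 1, inserting h >= 1 +
    2 z yields 2 z <= g (1 + 2 z). *)
Lemma root_le : 2 * z <= 3 * g.
Proof.
have H : h_fun z - 1 <= g * h_fun z.
  apply: ler_cvg_to (cvgB cS0 (cvg_cst (1 : R))) cS2 _; apply: nearW => M /=.
  rewrite !fctE /= addrC addKr ler_wpM2l// /sqr_sum /sqr_moment_sum;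
    apply: ler_sum => r _.
  rewrite ler_peMl ?ler1n ?expn_gt0//; exact: ltW.
have h1 := h_fun_gt1D; have [g1|g1] := lerP 1 g; first by have := z1; lra.
have : (1 - g) * (1 + 2 * z) <= (1 - g) * h_fun z by rewrite ler_pM2l//
  subr_gt0.
have : g * z <= g by rewrite ler_piMr// ltW.
lra.
Qed.

(** For small g the quantity g (1 + 1 / (2 z)) of the admissibility condition is close to 1, because
    g h = 2 z + O(z^2). This makes small radii admissible when L > 1. *)
Lemma root_half : z <= 1 / 2 -> g * (1 + 2 * z) <= 2 * z * (1 + 48 * z).
Proof.
move=> zh; apply: (@le_trans _ _ (g * h_fun z)).
  by rewrite ler_pM2l// h_fun_gt1D.
apply: ler_cvg_to cS2 (cvg_cst _) _; apply: nearW => M /=.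
have H : sqr_moment_sum z M <=
  \sum_(r < M) ((r == 0 :> nat)%:R * z + 12 * z ^+ 2 * (3 / 4) ^+ r).
  apply: ler_sum => -[[|r] rM] _ /=.
    by rewrite exp1n !expr1 expr0 !mul1r mulr1 lerDl mulr_ge0// exprn_ge0// ltW.
  rewrite mul0r add0r; set n := (r.+2 ^ 2)%N.
  have n2 : (2 <= n)%N by rewrite /n expnS expn1 (leq_trans _ (leq_pmulr _ _)).
  have nr : (r.+1 <= n)%N by rewrite /n expnS expn1 (leq_trans (leqnSn _))//
    leq_pmulr.
  (* After extracting z^2, the factor (1/2)^n is split as (2/3)^n (3/4)^n: the first absorbs n at
     the price 3, the second is summable. So 12 = 4 * 3, and the sum 4 of the powers of 3/4 gives 48
     = 12 * 4. *)
  have e1 : z ^+ n <= z ^+ 2 * (4 * (1 / 2) ^+ n).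
    rewrite -{1}(subnKC n2) exprD ler_pM2l//.
    have -> : 4 * (1 / 2) ^+ n = (1 / 2) ^+ (n - 2) :> R.
      by rewrite -{1}(subnKC n2) exprD; lra.
    by rewrite lerXn2r// nnegrE; [exact: ltW|lra].
  have e2 : n%:R * (2 / 3) ^+ n <= 3 :> R.
    by apply: le_trans (natr_expr_le _ _) _; [lra|];
      rewrite -[3]invrK lef_pV2 ?posrE; lra.
  have e3 : (3 / 4) ^+ n <= (3 / 4) ^+ r.+1 :> R by apply: ler_wiXn2l => //;
    lra.
  have e4 : (1 / 2) ^+ n = (2 / 3) ^+ n * (3 / 4) ^+ n :> R.
    by rewrite -exprMn; congr (_ ^+ _); lra.
  have p3 : 0 <= (3 / 4) ^+ n :> R by rewrite exprn_ge0//; lra.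
  have z2 : 0 <= z ^+ 2 by exact: ltW.
  apply: (@le_trans _ _ (n%:R * (z ^+ 2 * (4 * (1 / 2) ^+ n)))).
    by rewrite ler_wpM2l.
  have : n%:R * (2 / 3) ^+ n * (3 / 4) ^+ n <= 3 * (3 / 4) ^+ r.+1 :> R.
    by apply: ler_pM => //; rewrite mulr_ge0// exprn_ge0//; lra.
  move=> /(ler_wpM2l z2); rewrite e4; lra.
have G : \sum_(r < M) (3 / 4) ^+ r <= 4 :> R.
  by apply: le_trans (sum_geometric_le _ _) _; [lra|];
    rewrite -[4]invrK lef_pV2 ?posrE; lra.
have D : \sum_(r < M) (r == 0 :> nat)%:R * z <= z.
  case: M {H G} => [|M]; first by rewrite big_ord0 ltW.
  by rewrite big_ord_recl/= mul1r big1 ?addr0// => i _; rewrite mul0r.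
move: H; rewrite big_split/= -mulr_sumr => H.
have z2 : 0 <= 12 * z ^+ 2 by rewrite mulr_ge0// ltW.
have := ler_wpM2l z2 G; lra.
Qed.

(* Rules out the case L <= 1. *)
Lemma root_gt : 2 * z < g * (1 + 2 * z).
Proof.
(* After multiplication by h the contributions of r = 0 and r = 1, -1 cancel exactly; those of r =
   2, -2 leave at least 4 z^4 and the others are nonnegative. *)
have H : 4 * z ^+ 4 <= (1 + 2 * z) * (g * h_fun z) - 2 * z * h_fun z.
  apply: ler_cvg_to (cvg_cst (4 * z ^+ 4))
    (cvgB (cvgM (cvg_cst (1 + 2 * z)) cS2)
    (cvgM (cvg_cst (2 * z)) cS0)) _.
  exists 2%N => // M /= M2; rewrite !fctE /=.
  rewrite -(subnKC M2) /sqr_sum /sqr_moment_sum; set N := (M - 2)%N.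
  rewrite add2n !big_ord_recl/= exp1n !expr1 mul1r.
  set S := \sum_(r < N) z ^+ _; set P := \sum_(r < N) _%:R * _.
  have PS : 4 * S <= P.
    rewrite /P /S mulr_sumr; apply: ler_sum => r _; rewrite ler_pM2r// ler_nat.
    by rewrite /bump/= !add1n -[4%N]/(2 ^ 2)%N leq_exp2r.
  have S0' : 0 <= S by apply: sumr_ge0 => r _; exact: ltW.
  have z4 := zn 4; have zS : z * S <= S by rewrite ler_piMl// ltW.
  have zP : 0 <= z * P by rewrite mulr_ge0 ?(ltW z0)//; lra.
  have zz4 : z * z ^+ 4 <= z ^+ 4 by rewrite ler_piMl// ltW.
  have zz40 : 0 <= z * z ^+ 4 by rewrite mulr_ge0// ltW.
  rewrite /bump/= add1n -[(2 ^ 2)%N]/4%N; lra.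
have h0 : 0 < h_fun z := lt_le_trans ltr01 (h_fun_ge1 z01).
rewrite -(ltr_pM2r h0); have := zn 4; lra.
Qed.

(** Past K every term is nonnegative. The cube in [z <= q ^+ 3] provides three factors q^n: one
    absorbs n, one yields the decay 1 / (K + 1), and one makes the tail summable. *)
Lemma saddle_sum_tail q K : 0 < q < 1 -> z <= q ^+ 3 -> g <= (K.+1 ^ 2)%:R ->
  0 <= g / 2 - saddle_sum z g K <= (1 - q)^-1 ^+ 3 / K.+1%:R.
Proof.
move=> /andP[q0 q1] zq gK; set C := (1 - q)^-1.
have C0 : 0 <= C by rewrite invr_ge0 subr_ge0 ltW.
have q01 : 0 <= q < 1 by rewrite (ltW q0).
pose k : R := K.+1%:R^-1; rewrite -/k.
have k0 : 0 <= k by rewrite invr_ge0.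
have term M : (K <= M)%N -> 0 <= saddle_sum z g M - saddle_sum z g K <=
  C ^+ 3 * k.
  move=> KM; rewrite /saddle_sum -(subnKC KM) big_split_ord/= addrAC
    subrr add0r.
  have gr (r : 'I_(M - K)) : g <= ((K + r).+1 ^ 2)%:R.
    by apply: le_trans gK _; rewrite ler_nat leq_exp2r// ltnS leq_addr.
  apply/andP; split.
    by apply: sumr_ge0 => r _; rewrite mulr_ge0 ?subr_ge0 ?gr// ltW.
  apply: (@le_trans _ _ (\sum_(r < M - K) C * (C * k) * q ^+ r)); last first.
    rewrite -mulr_sumr; have := sum_geometric_le (M - K) q01; rewrite -/C => G.
    have : 0 <= C * (C * k) by rewrite !mulr_ge0.
    move=> /ler_wpM2l /(_ _ _ G); rewrite !exprS expr0; lra.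
  apply: ler_sum => r _; set n := ((K + r).+1 ^ 2)%N.
  have nKr : (K.+1 + r <= n)%N by rewrite addSn /n expnS expn1 leq_pmulr.
  apply: (@le_trans _ _ (n%:R * z ^+ n)).
    by rewrite ler_pM2r// gerBl ltW.
  apply: (@le_trans _ _ (n%:R * (q ^+ 3) ^+ n)).
    by rewrite ler_wpM2l// lerXn2r// nnegrE ?exprn_ge0// ltW.
  have e1 : n%:R * q ^+ n <= C by exact: natr_expr_le.
  have e2 : q ^+ n <= C * k.
    rewrite /k ler_pdivlMr// mulrC; apply: le_trans (natr_expr_le K.+1 q01).
    rewrite ler_wpM2l//; apply: ler_wiXn2l; rewrite ?ltW//.
    exact: leq_trans (leq_addr _ _) nKr.
  have e3 : q ^+ n <= q ^+ r.
    apply: ler_wiXn2l; rewrite ?ltW//; exact: leq_trans (leq_addl _ _) nKr.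
  have p0 : 0 <= q ^+ n by rewrite exprn_ge0// ltW.
  have e23 : q ^+ n * q ^+ n <= (C * k) * q ^+ r by apply: ler_pM.
  have -> : n%:R * (q ^+ 3) ^+ n = (n%:R * q ^+ n) * (q ^+ n * q ^+ n).
    by rewrite -exprM mulnC exprM; lra.
  rewrite -[C * (C * k) * _]mulrA; apply: ler_pM => //; exact: mulr_ge0.
apply/andP; split.
  apply: ler_cvg_to (cvg_cst (0 : R)) (cvgB cU (cvg_cst (saddle_sum z g K))) _.
  by exists K => // M /= /term /andP[].
apply: ler_cvg_to (cvgB cU (cvg_cst (saddle_sum z g K)))
  (cvg_cst (C ^+ 3 * k)) _.
by exists K => // M /= /term /andP[].
Qed.

(** Otherwise the N terms after the first n0 would each contribute at least 1/2, the first n0 at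
    least - L each and the others at least 0, so the sum would exceed its limit g / 2 <= L / 2. *)
Lemma root_expn_lt (L : R) n0 N : g <= L -> L + 1 <= n0.+1%:R ->
  (2 * n0%:R + 1) * L < N%:R -> z ^+ ((n0 + N) ^ 2) < 1 / 2.
Proof.
move=> gL Ln0 hN; rewrite ltNge; apply/negP => zR.
have H : - (n0%:R * L) + N%:R / 2 <= g / 2.
  apply: ler_cvg_to (cvg_cst _) cU _; exists (n0 + N)%N => // M /= NM.
  rewrite /saddle_sum -(subnKC NM) !big_split_ord/= -addrA; apply: lerD.
    rewrite mulr_natl -mulNrn -[n0 in _ *+ n0]card_ord -sumr_const.
    apply: ler_sum => r _.
    have : - L <= (r.+1 ^ 2)%:R - g by have := ler0n R (r.+1 ^ 2); lra.
    have zr := zn (r.+1 ^ 2); have zr1 : z ^+ (r.+1 ^ 2) <= 1.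
      by rewrite exprn_ile1// ltW.
    move=> /(ler_wpM2r (ltW zr)); apply: le_trans.
    have L0 : 0 < L := lt_le_trans g0 gL.
    by rewrite mulNr lerN2 ler_piMr// ltW.
  have big (i : nat) : (n0 <= i)%N -> 1 <= (i.+1 ^ 2)%:R - g.
    move=> ni; have : n0.+1%:R <= (i.+1 ^ 2)%:R :> R.
      by rewrite ler_nat expnS expn1 (leq_trans _ (leq_pmulr _ _)).
    lra.
  rewrite -[leLHS]addr0; apply: lerD; last first.
    apply: sumr_ge0 => r _; apply: mulr_ge0; last exact: ltW.
    by apply: le_trans ler01 (big _ _); rewrite -addnA leq_addr.
  rewrite -[N in leLHS]card_ord -sum1_card natr_sum mulr_suml.
  apply: ler_sum => r _; rewrite mul1r.
  have : 1 <= ((n0 + r).+1 ^ 2)%:R - g by apply: big; exact: leq_addr.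
  move=> /(ler_wpM2r (ltW (zn ((n0 + r).+1 ^ 2)))); rewrite mul1r;
    apply: le_trans.
  apply: le_trans (_ : z ^+ ((n0 + N) ^ 2) <= _); first lra.
  by apply: ler_wiXn2l; rewrite ?ltW// leq_exp2r// -addnS leq_add2l.
lra.
Qed.

End Root.

(** Saddle points stay away from 1 uniformly over g <= L: z^m < 1/2 for a fixed m, whereas (1 - x)^m
    >= 1/2 for x = 1 / (2 m). A third of [x] leaves room for the cube. *)
Lemma root_upper_bound (L : R) : 0 < L -> exists q, 0 < q < 1 /\
  forall z g, 0 < z < 1 -> 0 < g -> derive1 (l_fun g) z = 0 -> g <= L ->
    z <= q ^+ 3.
Proof.
move=> L0.
pose n0 := Num.truncn (L + 1).
have hn0 : L + 1 <= n0.+1%:R by exact/ltW/truncnS_gt.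
pose N := (Num.truncn ((2 * n0%:R + 1) * L)).+1.
have hN : (2 * n0%:R + 1) * L < N%:R by exact: truncnS_gt.
pose m := ((n0 + N) ^ 2)%N.
have m0 : 1 <= m%:R :> R by rewrite ler1n expn_gt0 addnS.
pose x : R := (2 * m%:R)^-1.
have mx : m%:R * x = 1 / 2.
  by rewrite /x invfM mulrCA mulfV ?gt_eqF ?(lt_le_trans ltr01)// mulr1 mul1r.
have x0 : 0 < x by rewrite invr_gt0; lra.
have x1 : x <= 1 / 2 by rewrite -mx ler_peMl// ltW.
exists (1 - x / 3); split; first by lra.
move=> z g z01 g0 zg gL; have /andP[z0 z1] := z01.
have zm := root_expn_lt z01 g0 zg gL hn0 hN.
have : 1 - 3%:R * (x / 3) <= (1 - x / 3) ^+ 3 by apply: bernoulli_ge; lra.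
suff : z < 1 - x by lra.
rewrite ltNge; apply/negP => zx.
have : (1 - x) ^+ m <= z ^+ m by rewrite lerXn2r// nnegrE; lra.
have : 1 - m%:R * x <= (1 - x) ^+ m by apply: bernoulli_ge; lra.
rewrite mx; move: zm; rewrite -/m; lra.
Qed.

End RootBounds.

(** * Lattice points in a ball *)

Section Box.
Context {R : realType}.

(** Additivity of the variance under a product law, without normalising the weights: the cross terms
    contain a factor of mean zero. *)
Lemma sum_prod_sqr (n : nat) (I : finType) (a g : I -> R) :
  \sum_i a i * g i = 0 ->
  \sum_(w : {ffun 'I_n -> I}) (\prod_j a (w j)) * (\sum_j g (w j)) ^+ 2 =
  n%:R * ((\sum_i a i) ^+ n.-1 * \sum_i a i * g i ^+ 2).
Proof.
move=> ag0.
pose F (j j' i : 'I_n) (r : I) :=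
  a r * ((if i == j then g r else 1) * (if i == j' then g r else 1)).
have FE j j' (w : {ffun 'I_n -> I}) :
    (\prod_i a (w i)) * (g (w j) * g (w j')) = \prod_i F j j' i (w i).
  rewrite /F !big_split/= -!big_mkcond/= !big_pred1_eq//.
transitivity (\sum_j \sum_j' \sum_(w : {ffun 'I_n -> I}) \prod_i F j j'
  i (w i)).
  transitivity (\sum_(w : {ffun 'I_n -> I}) \sum_j \sum_j' \prod_i F j j'
    i (w i)).
    apply: eq_bigr => w _; rewrite expr2 mulr_suml mulr_sumr.
    apply: eq_bigr => j _; rewrite !mulr_sumr; apply: eq_bigr => j' _.
    by rewrite -FE.
  rewrite exchange_big/=; apply: eq_bigr => j _; exact: exchange_big.
have SE j j' : \sum_(w : {ffun 'I_n -> I}) \prod_i F j j' i (w i) =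
    if j == j' then (\sum_i a i) ^+ n.-1 * \sum_i a i * g i ^+ 2 else 0.
  rewrite -bigA_distr_bigA/= (bigD1 j)//= /F eqxx; case: eqVneq => [<-|jj'].
    rewrite mulrC; congr (_ * _).
      rewrite (eq_bigr (fun=> \sum_i a i)); last first.
        by move=> i /negbTE ->; apply: eq_bigr => r _; rewrite !mulr1.
      by rewrite prodr_const cardC1 card_ord.
  by rewrite (eq_bigr (fun i => a i * g i)) ?ag0 ?mul0r// => r _; rewrite mulr1.
move: SE; set S := _ * _ => SE; rewrite (eq_bigr (fun=> S)).
  by rewrite sumr_const card_ord mulr_natl.
move=> j _; rewrite (eq_bigr (fun i => if j == i then S else 0)) => [|i _].
  by rewrite -big_mkcond/= (eq_bigl (pred1 j)) ?big_pred1_eq// => i;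
    rewrite eq_sym.
exact: SE.
Qed.

Variables (p K : nat).
Notation box := {ffun 'I_p -> 'I_K.*2.+1}.

(** The ordinal i stands for the integer i - K, so that the lattice points of [-K, K]^p form a
    finite type. The ball of squared radius D fits in the box with K = D. *)
Definition box_abs (i : 'I_K.*2.+1) : nat := `|(i%:Z - K%:Z)%R|%N.
Definition box_sqr_norm (w : box) : nat := \sum_j (box_abs (w j) ^ 2)%N.
Definition ballbox (D : nat) : {set box} :=
  [set w | (box_sqr_norm w <= D)%N]%SET.
Definition zeros (w : box) : nat := \sum_j (box_abs (w j) == 0)%N.

Lemma sum_ballbox_sym D (G : 'I_K.*2.+1 -> R) (j j' : 'I_p) :
  \sum_(w in ballbox D) G (w j) = \sum_(w in ballbox D) G (w j').
Proof.
pose sw (w : box) : box := [ffun i => w (tperm j j' i)].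
have swK : involutive sw by move=> w; apply/ffunP => i; rewrite !ffunE tpermK.
rewrite (reindex_inj (inv_inj swK))/=; apply: eq_big => [w|w _].
  rewrite !inE /box_sqr_norm (reindex_inj (@perm_inj _ (tperm j j')))/=.
  by under eq_bigr do rewrite ffunE tpermK.
by rewrite ffunE tpermL.
Qed.

Section Weights.
Variable (z : R).
Hypothesis z01 : 0 < z < 1.
Let z0 : 0 < z. Proof. by case/andP: z01. Qed.
Let z1 : z < 1. Proof. by case/andP: z01. Qed.
Let wt (i : 'I_K.*2.+1) := z ^+ (box_abs i ^ 2).
Let h := \sum_i wt i.
Let wt_gt0 i : 0 < wt i. Proof. exact: exprn_gt0. Qed.

Lemma prod_wt (w : box) : \prod_j wt (w j) = z ^+ box_sqr_norm w.
Proof. by rewrite /wt /box_sqr_norm expr_sum. Qed.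

Lemma weight_sumE : h = 1 + 2 * sqr_sum z K.
Proof. exact: partial_hE. Qed.

Lemma weight_sum_ge1 : 1 <= h.
Proof. by rewrite weight_sumE; exact: ge1_partial. Qed.
Let h_gt0 : 0 < h. Proof. exact: lt_le_trans weight_sum_ge1. Qed.

(* Under the product law with weights z ^ (r ^ 2) / h on each coordinate the
   squared norm has mean p m, just below D, so by Chebyshev it lies in
   [D - p (d1 + d2), D] with probability at least 1/2. *)
Lemma ballbox_ge (D : nat) (t d1 d2 m V : R) :
  (0 < p)%N -> 0 < d1 -> expR (- t) <= z -> 0 <= t ->
  \sum_i wt i * ((box_abs i ^ 2)%:R - m) = 0 ->
  \sum_i wt i * ((box_abs i ^ 2)%:R - m) ^+ 2 <= V ->
  p%:R * (m + d1) <= D%:R -> D%:R <= p%:R * (m + d2) ->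
  2 * V <= p%:R * d1 ^+ 2 ->
  h ^+ p <= 2 * (#|ballbox D|%:R * z ^+ D * expR (t * (p%:R * (d1 + d2)))).
Proof.
move=> p0 d10 tz t0 mean var Dlo Dhi pV.
have pr : 0 < p%:R :> R by rewrite ltr0n.
pose X (w : box) := \sum_j ((box_abs (w j) ^ 2)%:R - m).
have XE w : X w = (box_sqr_norm w)%:R - p%:R * m.
  by rewrite /X sumrB sumr_const card_ord [in RHS]mulr_natl /box_sqr_norm
    natr_sum.
have total : \sum_(w : box) z ^+ box_sqr_norm w = h ^+ p.
  under eq_bigr do rewrite -prod_wt.
  by rewrite -(bigA_distr_bigA (fun _ i => wt i))/= prodr_const card_ord.
pose bad w := (p%:R * d1 < `|X w|).
have badle : \sum_(w : box | bad w) z ^+ box_sqr_norm w <= h ^+ p / 2.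
  have q0 : 0 < (p%:R * d1) ^+ 2 by rewrite exprn_gt0// mulr_gt0.
  rewrite -(ler_pM2r q0) mulr_suml.
  apply: (@le_trans _ _ (\sum_(w : box) (\prod_j wt (w j)) * X w ^+ 2)).
    rewrite [leRHS](bigID bad)/= -[leLHS]addr0; apply: lerD; last first.
      by apply: sumr_ge0 => w _;
        rewrite mulr_ge0 ?sqr_ge0// prod_wt exprn_ge0// ltW.
    apply: ler_sum => w; rewrite /bad => bw;
      rewrite prod_wt ler_wpM2l ?exprn_ge0 ?(ltW z0)//.
    by rewrite -[leRHS]real_normK ?num_real// lerXn2r ?nnegrE ?mulr_ge0
      ?(ltW d10)// ltW.
  rewrite (sum_prod_sqr p mean) -/h exprMn.
  have hp : h ^+ p.-1 <= h ^+ p by rewrite ler_weXn2l ?weight_sum_ge1//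
    leq_pred.
  have hp0 : 0 <= h ^+ p by rewrite exprn_ge0// ltW.
  apply: (@le_trans _ _ (p%:R * (h ^+ p * V))).
    rewrite ler_wpM2l//; apply: ler_pM => //; first by rewrite exprn_ge0// ltW.
    by apply: sumr_ge0 => i _; rewrite mulr_ge0 ?sqr_ge0// ltW.
  have : p%:R * h ^+ p * (2 * V) <= p%:R * h ^+ p * (p%:R * d1 ^+ 2).
    by rewrite ler_wpM2l// mulr_ge0.
  lra.
(* On good points the exponent falls short of D by at most p (d1 + d2), and each missing power of z
   costs a factor at most exp t. *)
have good w : ~~ bad w -> (w \in ballbox D) /\
    z ^+ box_sqr_norm w <= z ^+ D * expR (t * (p%:R * (d1 + d2))).
  rewrite /bad -leNgt XE ler_norml => /andP[lo hi].
  have nD : (box_sqr_norm w <= D)%N by rewrite -(ler_nat R); lra.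
  split; first by rewrite inE.
  rewrite -(subnKC nD) exprD -mulrA ler_peMr ?exprn_ge0 ?(ltW z0)//.
  have Dn : (D - box_sqr_norm w)%:R <= p%:R * (d1 + d2) by rewrite natrB//; lra.
  apply: (@le_trans _ _ (expR (- t) ^+ (D - box_sqr_norm w) *
    expR (t * (p%:R * (d1 + d2))))).
    rewrite -expRM_natl -expRD -[leLHS]expR0 ler_expR.
    have := ler_wpM2l t0 Dn; lra.
  by rewrite ler_wpM2r ?expR_ge0// lerXn2r// nnegrE ?expR_ge0// ltW.
have goodle : \sum_(w : box | ~~ bad w) z ^+ box_sqr_norm w <=
    #|ballbox D|%:R * (z ^+ D * expR (t * (p%:R * (d1 + d2)))).
  set c := z ^+ D * _; have c0 : 0 <= c by rewrite mulr_ge0 ?expR_ge0 ?exprn_ge0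
    ?(ltW z0).
  rewrite mulr_natl -sumr_const [leRHS](bigID (fun w => ~~ bad w))/=.
  rewrite -[leLHS]addr0; apply: lerD; last by apply: sumr_ge0.
  rewrite [leRHS](eq_bigl (fun w => ~~ bad w)); last first.
    by move=> w /=; apply/andP/idP => [[]//|gw]; split => //;
      have [] := good w gw.
  by apply: ler_sum => w /good[].
have := total; rewrite (bigID bad)/=; lra.
Qed.

(* Chernoff's bound for the joint generating function of the squared norm and of
   the number of zero coordinates. *)
Lemma ballbox_le (D : nat) (lam : R) : 0 <= lam ->
  (\sum_(w in ballbox D) expR (lam * (zeros w)%:R)) * z ^+ D <=
  h ^+ p * expR (p%:R * ((expR lam - 1) / h)).
Proof.
move=> lam0; pose b (i : 'I_K.*2.+1) :=
  wt i * (if box_abs i == 0 then expR lam else 1).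
have bE (w : box) : \prod_j b (w j) =
  z ^+ box_sqr_norm w * expR (lam * (zeros w)%:R).
  rewrite /b big_split/= prod_wt; congr (_ * _).
  rewrite /zeros natr_sum mulr_sumr expR_sum; apply: eq_bigr => j _.
  by case: eqP => _; rewrite ?mulr1 ?mulr0 ?expR0.
have b0 i : 0 <= b i by rewrite mulr_ge0 ?(ltW (wt_gt0 _))//; case: ifP => // _;
  exact: expR_ge0.
apply: (@le_trans _ _ (\sum_(w : box) \prod_j b (w j))).
  rewrite mulr_suml [leRHS](bigID (mem (ballbox D)))/= -[leLHS]addr0;
    apply: lerD.
    apply: ler_sum => w; rewrite inE => wD;
      rewrite bE mulrC ler_wpM2r ?expR_ge0//.
    by apply: ler_wiXn2l; rewrite ?ltW.
  by apply: sumr_ge0 => w _; apply: prodr_ge0.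
rewrite -(bigA_distr_bigA (fun _ i => b i))/= prodr_const card_ord.
have -> : \sum_i b i = h + (expR lam - 1).
  have -> : \sum_i b i = \sum_i (wt i + (expR lam - 1) * (box_abs i == 0)%:R).
    apply: eq_bigr => i _; rewrite /b /wt; case: eqP => [->|_];
      last by rewrite mulr1 mulr0 addr0.
    by rewrite expr0 mul1r mulr1; lra.
  rewrite big_split/= -mulr_sumr; congr (_ + _).
  rewrite (sym_sumE (fun r => (r == 0)%:R)) eqxx big1// mulr0 addr0 mulr1//.
have e : 0 <= expR lam - 1 by rewrite subr_ge0 -[1]expR0 ler_expR.
rewrite expRM_natl -exprMn lerXn2r// ?nnegrE.
- by rewrite addr_ge0// ltW.
- by rewrite mulr_ge0 ?expR_ge0// ltW.
have -> : h + (expR lam - 1) = h * (1 + (expR lam - 1) / h).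
  by rewrite mulrDr mulr1 mulrCA mulfV ?gt_eqF// mulr1.
by rewrite ler_pM2l// expR_ge1Dx.
Qed.

End Weights.

(** Jensen's inequality for the exponential, by its tangent at the mean. Exchanging coordinates
    preserves the ball, so the mean number of zeros is p rho. *)
Lemma zeros_jensen (D : nat) (lam rho : R) (j0 : 'I_p) :
  \sum_(w in ballbox D) (box_abs (w j0) == 0)%:R = rho * #|ballbox D|%:R ->
  #|ballbox D|%:R * expR (lam * (p%:R * rho)) <=
  \sum_(w in ballbox D) expR (lam * (zeros w)%:R).
Proof.
move=> hrho.
have zs : \sum_(w in ballbox D) (zeros w)%:R =
  p%:R * rho * #|ballbox D|%:R :> R.
  under eq_bigr do rewrite /zeros natr_sum.
  rewrite exchange_big/= (eq_bigr (fun=> rho * #|ballbox D|%:R)).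
    by rewrite sumr_const card_ord -[LHS]mulr_natl mulrA.
  by move=> j _; rewrite (sum_ballbox_sym D (fun i =>
    (box_abs i == 0)%:R) j j0).
set c := lam * (p%:R * rho).
apply: (@le_trans _ _ (\sum_(w in ballbox D) expR c *
  (1 + (lam * (zeros w)%:R - c)))).
  rewrite -mulr_sumr big_split/= sumrB -mulr_sumr zs !sumr_const
    -[c *+ _]mulr_natl /c.
  rewrite -[1 *+ _]/(_%:R); lra.
apply: ler_sum => w _.
have -> : expR (lam * (zeros w)%:R) = expR c * expR (lam * (zeros w)%:R - c).
  by rewrite -expRD addrC subrK.
by rewrite ler_wpM2l ?expR_ge0// expR_ge1Dx.
Qed.

End Box.

(** * The proportion of points with a vanishing coordinate *)

Section ZerosFraction.
Context {R : realType}.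

Lemma sqr_sum_ge2 (z : R) K : 0 < z -> (2 <= K)%N -> z + z ^+ 4 <= sqr_sum z K.
Proof.
move=> z0 K2; rewrite /sqr_sum -(subnKC K2) add2n !big_ord_recl/= exp1n expr1.
rewrite lerD2l -[(2 ^ 2)%N]/4%N lerDl sumr_ge0// => r _; exact/exprn_ge0/ltW.
Qed.

(** Jensen, Chernoff and Chebyshev are chained: h^p, z^D and the cardinality of the ball cancel.
    Logarithms are taken and divided by p; the constant 2 lost in Chebyshev is at most exp 1 and
    becomes 1 / p. *)
Lemma zeros_rate (p K D : nat) (z t d1 d2 m V lam rho : R) (j0 : 'I_p) :
  0 < z < 1 -> 0 < d1 -> expR (- t) <= z -> 0 <= t -> 0 <= lam ->
  \sum_(i < K.*2.+1) z ^+ (box_abs i ^ 2) * ((box_abs i ^ 2)%:R - m) = 0 ->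
  \sum_(i < K.*2.+1) z ^+ (box_abs i ^ 2) * ((box_abs i ^ 2)%:R - m) ^+ 2 <=
    V ->
  p%:R * (m + d1) <= D%:R -> D%:R <= p%:R * (m + d2) -> 2 * V <=
    p%:R * d1 ^+ 2 ->
  (0 < #|ballbox p K D|)%N ->
  \sum_(w in ballbox p K D) (box_abs (w j0) == 0)%:R =
    rho * #|ballbox p K D|%:R ->
  lam * rho <= p%:R^-1 + t * (d1 + d2) + (expR lam - 1) / (1 + 2 * sqr_sum z K).
Proof.
move=> z01 d10 tz t0 lam0 mean var Dlo Dhi pV N0 hrho.
have p0 : (0 < p)%N by apply: leq_ltn_trans (ltn_ord j0).
have pr : 0 < p%:R :> R by rewrite ltr0n.
have /andP[z0 z1] := z01.
have lo := ballbox_ge z01 p0 d10 tz t0 mean var Dlo Dhi pV.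
have hi := @ballbox_le R p K z z01 D lam lam0.
have je := zeros_jensen lam hrho.
set h := \sum_i _ in lo hi; have hh : h =
  1 + 2 * sqr_sum z K by exact: partial_hE.
rewrite -hh; set N := #|_| in N0 lo je hrho.
have Nr : 0 < N%:R :> R by rewrite ltr0n.
have zD : 0 < z ^+ D by exact: exprn_gt0.
set A := p%:R * ((expR lam - 1) / h) in hi; set B :=
  t * (p%:R * (d1 + d2)) in lo.
have c1 : N%:R * z ^+ D * expR (lam * (p%:R * rho)) <=
    N%:R * z ^+ D * (2 * expR (B + A)).
  apply: (@le_trans _ _ (h ^+ p * expR A)).
    apply: le_trans hi; have := ler_wpM2r (ltW zD) je; lra.
  rewrite expRD; have := ler_wpM2r (expR_ge0 A) lo; lra.
have {}c1 : expR (lam * (p%:R * rho)) <= expR (1 + (B + A)).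
  move: c1; rewrite ler_pM2l ?mulr_gt0// => /le_trans; apply.
  rewrite [leRHS]expRD ler_wpM2r ?expR_ge0//.
  have := expR_ge1Dx (1 : R); lra.
move: c1; rewrite ler_expR => c1.
rewrite -(ler_pM2l pr) !mulrDr mulfV ?gt_eqF//; move: c1; rewrite /A /B; lra.
Qed.

(** With s = 1 + 2 z, half of the surplus k in h absorbs the second-order error of exp lam - 1, so
    rho <= e / lam + u with u = 1 / (s + k / 2). The constants close the estimate: e / lam <= k /
    24, s <= 3 and u >= 1/4 give rho s <= k / 8 + 1 - k / 8. *)
Lemma final_rate (z k lam rho h e : R) :
  0 < z <= 1 -> 0 < k <= 1 -> lam = k / 8 -> 1 + 2 * z + k <= h ->
  e <= k ^+ 2 / 192 -> lam * rho <= e + (expR lam - 1) / h ->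
  rho * (1 + 2 * z) <= 1.
Proof.
move=> /andP[z0 z1] /andP[k0 k1] lamE hk ek H.
have lam0 : 0 < lam by lra.
have h0 : 0 < h by lra.
have l1 : 0 < 1 - lam by lra.
have ex : expR lam - 1 <= lam / (1 - lam).
  have := expR_ge1Dx (- lam); have := expRxMexpNx_1 lam; have := expR_gt0 lam =>
    x0 xx x1.
  have : expR lam * (1 - lam) <= 1 by rewrite -[leRHS]xx ler_pM2l.
  rewrite ler_pdivlMr// => ?; lra.
pose s := 1 + 2 * z; pose u := (s + k / 2)^-1.
have su : (s + k / 2) * u = 1 by rewrite mulfV// gt_eqF// /s; lra.
have u4 : 1 / 4 <= u.
  rewrite /u -[1 / 4]/(1 * 4^-1) mul1r lef_pV2 ?posrE /s; lra.
have u0 : 0 < u by lra.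
have hu : (lam / (1 - lam)) / h <= lam * u.
  rewrite -mulrA ler_pM2l// -invfM /u lef_pV2 ?posrE ?mulr_gt0//;
    last by rewrite /s; lra.
  have : lam * h <= 1 * h - (s + k / 2) -> s + k / 2 <= (1 - lam) * h by lra.
  apply; have : (1 - lam) * (s + k) <= (1 - lam) * h by rewrite ler_pM2l//;
    rewrite /s; lra.
  have : lam * (s + k) <= lam * 4 by rewrite ler_pM2l// /s; lra.
  lra.
have H2 : lam * rho <= k ^+ 2 / 192 + lam * u.
  apply: le_trans H _; apply: lerD => //; apply: le_trans hu.
  by rewrite ler_wpM2r// invr_ge0 ltW.
have H3 : rho <= k / 24 + u.
  rewrite -(ler_pM2l lam0); apply: le_trans H2 _; rewrite lamE; lra.
have s0 : 0 < s by rewrite /s; lra.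
have : rho * s <= (k / 24 + u) * s by rewrite ler_pM2r.
have : k * s <= k * 3 by rewrite ler_pM2l// /s; lra.
have : k * (1 / 4) <= k * u by rewrite ler_pM2l.
rewrite -/s; lra.
Qed.

(* zt = z (1 - eta) lies slightly below the saddle point z of g, so that the
   mean of r ^ 2 under the weights zt ^ (r ^ 2) falls below g by an amount
   E / h, which is bounded below by a multiple of eta and above by eta V
   plus a truncation error. *)
Section Tilt.
Variables (z g q eta g0 a0 : R) (K : nat).
Hypotheses (z01 : 0 < z < 1) (gpos : 0 < g) (zg : derive1 (l_fun g) z = 0).
Hypotheses (q01 : 0 < q < 1) (zq : z <= q ^+ 3).
Hypotheses (eta01 : 0 < eta <= 1 / 2) (g0g : g0 <= g) (a00 : 0 <
  a0) (a0z : a0 <= z).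
Hypotheses (K2 : (2 <= K)%N) (gK : g <= (K.+1 ^ 2)%:R).

Let C := (1 - q)^-1.
Let V := 2 * C ^+ 3.
Let x (n : nat) : R := z ^+ n.
Let y (n : nat) : R := (1 - eta) ^+ n.
Let sq (r : nat) := (r ^ 2)%N.
Notation sumK F := (\sum_(i < K.*2.+1) F (sq (box_abs i))).
Let E := sumK (fun n => (g - n%:R) * (x n * y n)).

Let z0 : 0 < z. Proof. by case/andP: z01. Qed.
Let z1 : z < 1. Proof. by case/andP: z01. Qed.
Let q0 : 0 < q. Proof. by case/andP: q01. Qed.
Let q1 : q < 1. Proof. by case/andP: q01. Qed.
Let x0 n : 0 < x n. Proof. exact: exprn_gt0. Qed.
Let e0 : 0 < eta. Proof. by case/andP: eta01. Qed.
Let e1 : eta <= 1 / 2. Proof. by case/andP: eta01. Qed.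
Let y01 n : 0 <= y n <= 1.
Proof. by move: e0 e1 => ? ?; rewrite exprn_ge0 ?exprn_ile1//; lra. Qed.
Let C1 : 1 <= C.
Proof. by move: q0 q1 => ? ?; rewrite -[1]invr1 lef_pV2 ?posrE; lra. Qed.

Lemma truncated_saddle_bounds : 0 <= sumK (fun n => (g - n%:R) * x n) <=
  2 * (C ^+ 3 / K.+1%:R).
Proof.
have -> : sumK (fun n => (g - n%:R) * x n) = g - 2 * saddle_sum z g K.
  rewrite (sym_sumE (fun r => (g - (sq r)%:R) * x (sq r))) /x /sq expr0
    subr0 mulr1.
  rewrite -[g - _]/(g + - _) -mulrN /saddle_sum -sumrN; congr (_ + 2 * _).
  by apply: eq_bigr => r _; rewrite -mulNr opprB.
have /andP[] := saddle_sum_tail z01 gpos zg q01 zq gK; rewrite -/C.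
set c := C ^+ 3 / _ => T1 T2; apply/andP; split; lra.
Qed.

Lemma fourth_moment : sumK (fun n => n%:R ^+ 2 * x n) <= V.
Proof.
rewrite (sym_sumE (fun r => (sq r)%:R ^+ 2 * x (sq r))) {1}/sq expr0n
  mul0r add0r.
rewrite /V ler_pM2l//.
apply: (@le_trans _ _ (\sum_(r < K) C ^+ 2 * q ^+ r)); last first.
  rewrite -mulr_sumr [leRHS]exprSr ler_wpM2l ?exprn_ge0 ?(le_trans ler01)//.
  by apply: sum_geometric_le; rewrite ltW.
apply: ler_sum => r _; set n := sq r.+1.
have q01' : 0 <= q < 1 by rewrite ltW.
have p0 : 0 <= q ^+ n by rewrite exprn_ge0// ltW.
apply: (@le_trans _ _ ((n%:R * q ^+ n) ^+ 2 * q ^+ n)).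
  have : x n <= (q ^+ 3) ^+ n by rewrite lerXn2r// nnegrE ?exprn_ge0// ltW.
  rewrite -exprM mulnC exprM => xn.
  apply: le_trans (ler_wpM2l (sqr_ge0 _) xn) _; lra.
apply: ler_pM => //; first exact: sqr_ge0.
  by rewrite lerXn2r// ?nnegrE ?natr_expr_le// ?mulr_ge0// (le_trans ler01).
apply: ler_wiXn2l; rewrite ?ltW//.
by rewrite /n /sq expnS expn1 (leq_trans _ (leq_pmulr _ _)).
Qed.

(** A correlation argument: subtracting the value Y of the decreasing factor [y] at the integer part
    of g makes every summand nonnegative, and the subtracted part is Y times a nonnegative sum. One
    summand then suffices. *)
Lemma tilted_gap_ge (k1 : R) : k1 <= g0 -> k1 <= 3 * a0 ^+ 4 -> eta * k1 <= E.
Proof.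
move: e0 e1 q0 q1 z0 z1 C1 gpos g0g a00 a0z =>
  e0' e1' q0' q1' z0' z1' C1' gp' g0g' a00' a0z'.
move=> k1g k1a; pose n1 := Num.truncn g; pose Y : R := y n1.
have gn1 : n1%:R <= g by rewrite truncn_le ltW.
have gn2 : g < n1.+1%:R by exact: truncnS_gt.
pose F r := (g - (sq r)%:R) * (y (sq r) - Y) * x (sq r).
have F0 r : 0 <= F r.
  apply: mulr_ge0; last exact: ltW.
  have [rn|nr] := leqP (sq r) n1.
    apply: mulr_ge0; first by rewrite subr_ge0 (le_trans _ gn1)// ler_nat.
    by rewrite subr_ge0; apply: ler_wiXn2l => //; lra.
  apply: mulr_le0.
    by rewrite subr_le0 (le_trans (ltW gn2))// ler_nat.
  by rewrite subr_le0; apply: ler_wiXn2l => //; [lra|lra|exact: ltnW].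
have EF : E = \sum_(i < K.*2.+1) F (box_abs i) + Y * sumK (fun n =>
  (g - n%:R) * x n).
  by rewrite mulr_sumr -big_split/=; apply: eq_bigr => i _; rewrite /F; lra.
have /andP[T0 _] := truncated_saddle_bounds.
have YT : 0 <= Y * sumK (fun n => (g - n%:R) * x n).
  by apply: mulr_ge0 T0; case/andP: (y01 n1).
rewrite EF; apply: (@le_trans _ _ (\sum_(i < K.*2.+1) F (box_abs i)));
  last by rewrite lerDl.
rewrite (sym_sumE F).
have sF : 0 <= \sum_(r < K) F r.+1 by apply: sumr_ge0.
have [g1|g1] := lerP 1 g.
  have n10 : (0 < n1)%N by rewrite truncn_gt0.
  have Y1 : Y <= 1 - eta.
    by rewrite -[leRHS]expr1; apply: ler_wiXn2l => //; lra.
  apply: (@le_trans _ _ (F 0%N)); last by rewrite lerDl mulr_ge0.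
  rewrite /F /sq /x /y !expr0 subr0 mulr1.
  have : eta * k1 <= eta * g by rewrite ler_pM2l// (le_trans k1g).
  have : g * eta <= g * (1 - Y) by rewrite ler_pM2l//; lra.
  rewrite /y; lra.
have n10 : n1 = 0%N.
  by apply/eqP; rewrite -leqn0 -ltnS -(ltr_nat R) (le_lt_trans gn1).
(* For g < 1 the term r = 0 vanishes since Y = 1, and r = 1 degenerates as g approaches 1; r = 2
   keeps the factor 4 - g >= 3. *)
have F2 : F 2%N <= \sum_(r < K) F r.+1.
  rewrite -(subnKC K2) add2n !big_ord_recl/=.
  have : 0 <= F 1%N by [].
  have : 0 <= \sum_(i < K - 2) F (bump 0 (bump 0 i)).+1 by apply: sumr_ge0.
  rewrite -[(bump 0 0).+1]/2%N; lra.
apply: (@le_trans _ _ (F 2%N)); last by have := F0 0%N; lra.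
rewrite /F /Y n10 /y expr0 -[sq 2]/4%N.
have y4 : (1 - eta) ^+ 4 <= 1 - eta.
  by rewrite -[leRHS]expr1; apply: ler_wiXn2l => //; lra.
have a4 : a0 ^+ 4 <= x 4 by rewrite lerXn2r// nnegrE ltW.
have : eta * k1 <= eta * (3 * x 4) by rewrite ler_pM2l//; lra.
have : 3 * eta <= (g - 4) * ((1 - eta) ^+ 4 - 1) by nra.
move=> /(ler_wpM2r (ltW (x0 4))); lra.
Qed.

(** By Bernoulli the tilt multiplies the weight of n by at least 1 - n eta, so it raises the gap by
    at most eta times a fourth moment. The other term is the truncation error. *)
Lemma tilted_gap_le : E <= 2 * (C ^+ 3 / K.+1%:R) + eta * V.
Proof.
move: e0 e1 q0 q1 z0 z1 C1 gpos g0g a00 a0z =>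
  e0' e1' q0' q1' z0' z1' C1' gp' g0g' a00' a0z'.
have /andP[_ T1] := truncated_saddle_bounds.
apply: (@le_trans _ _ (sumK (fun n => (g - n%:R) * x n) +
    eta * sumK (fun n => n%:R ^+ 2 * x n))); last first.
  by apply: lerD => //; rewrite ler_pM2l//; exact: fourth_moment.
rewrite mulr_sumr -big_split/=; apply: ler_sum => i _; set n := sq _.
have b : 1 - n%:R * eta <= y n by apply: bernoulli_ge; lra.
have /andP[y0 y1] := y01 n.
have n0 : 0 <= n%:R :> R by [].
have : (n%:R - g) * (1 - y n) <= n%:R * (n%:R * eta).
  apply: (@le_trans _ _ (n%:R * (1 - y n))).
    by rewrite ler_wpM2r//; lra.
  by rewrite ler_wpM2l//; lra.
move=> /(ler_wpM2r (ltW (x0 n))); lra.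
Qed.

Let zt := z * (1 - eta).

(** The tilted mean of r^2 is g - E / h and D = g p, so the deficit per coordinate is E / h. It lies
    between [d1] and [d2] because 1 <= h <= 1 + 2 C; the factor 2 in the conclusion comes from d1 <=
    d2. *)
Lemma tilt_rate (p D : nat) (t k1 lam rho : R) (j0 : 'I_p) :
  expR (- t) <= zt -> 0 <= t -> 0 <= lam -> 0 < k1 ->
  k1 <= g0 -> k1 <= 3 * a0 ^+ 4 -> g * p%:R = D%:R ->
  2 * V <= p%:R * (eta * k1 / (1 + 2 * C)) ^+ 2 ->
  (0 < #|ballbox p K D|)%N ->
  \sum_(w in ballbox p K D) (box_abs (w j0) == 0)%:R =
    rho * #|ballbox p K D|%:R ->
  lam * rho <= p%:R^-1 + t * (2 * (2 * (C ^+ 3 / K.+1%:R) + eta * V)) +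
    (expR lam - 1) / (1 + 2 * sqr_sum zt K).
Proof.
move: e0 e1 q0 q1 z0 z1 C1 gpos g0g a00 a0z =>
  e0' e1' q0' q1' z0' z1' C1' gp' g0g' a00' a0z'.
move=> tz t0 lam0 k10 k1g k1a gD pV N0 hrho.
have zt01 : 0 < zt < 1.
  rewrite mulr_gt0//; last by lra.
  by rewrite /= (le_lt_trans _ z1)// ler_piMr ?(ltW z0)//; lra.
pose h := 1 + 2 * sqr_sum zt K.
have zt0 : 0 < zt by case/andP: zt01.
have h1 : 1 <= h by exact: ge1_partial.
have xyE n : zt ^+ n = x n * y n by rewrite exprMn.
have hE' : \sum_(i < K.*2.+1) zt ^+ (box_abs i ^ 2) = h by exact: partial_hE.
have hH : h <= 1 + 2 * C.
  rewrite lerD2l ler_pM2l//; apply: (@le_trans _ _ (\sum_(r < K) q ^+ r));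
    last first.
    by apply: sum_geometric_le; rewrite ltW.
  apply: ler_sum => r _; apply: (@le_trans _ _ (q ^+ (r.+1 ^ 2))).
    rewrite lerXn2r ?nnegrE ?(ltW zt0) ?(ltW q0)//.
    apply: (@le_trans _ _ z); first by rewrite ler_piMr ?(ltW z0)//; lra.
    by apply: le_trans zq _; rewrite -[leRHS]expr1; apply: ler_wiXn2l;
      rewrite ?ltW.
  apply: ler_wiXn2l; rewrite ?ltW//.
  by rewrite expnS expn1 (leq_trans _ (leq_pmulr _ _)).
have Elo := tilted_gap_ge k1g k1a; have Ehi := tilted_gap_le.
have Epos : 0 < E by apply: lt_le_trans Elo; rewrite mulr_gt0.
pose Eh := E / h; have EhE : Eh * h = E by rewrite divfK// gt_eqF//; lra.
have Eh0 : 0 < Eh by rewrite divr_gt0//; lra.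
have EhE' : Eh <= E by rewrite -EhE ler_peMr// ltW.
pose d1 := eta * k1 / (1 + 2 * C); pose d2 := 2 * (C ^+ 3 / K.+1%:R) + eta * V.
have d10 : 0 < d1 by rewrite divr_gt0// ?mulr_gt0//; lra.
have d1E : d1 <= Eh.
  rewrite /d1 ler_pdivrMr; last by lra.
  by apply: le_trans Elo _; rewrite -EhE ler_pM2l.
pose m := g - Eh.
have sumE : \sum_(i < K.*2.+1) zt ^+ (box_abs i ^ 2) * (box_abs i ^ 2)%:R =
  g * h - E.
  by rewrite -hE' mulr_sumr -sumrB; apply: eq_bigr => i _;
    rewrite -/(sq _) xyE; lra.
have mean : \sum_(i < K.*2.+1) zt ^+ (box_abs i ^ 2) *
  ((box_abs i ^ 2)%:R - m) = 0.
  under eq_bigr do rewrite mulrBr; rewrite sumrB sumE -mulr_suml hE' /m -EhE;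
    lra.
have var : \sum_(i < K.*2.+1) zt ^+ (box_abs i ^ 2) * ((box_abs i ^ 2)%:R - m)
  ^+ 2 <= V.
  apply: le_trans fourth_moment.
  have -> : \sum_(i < K.*2.+1) zt ^+ (box_abs i ^ 2) * ((box_abs i ^ 2)%:R -
    m) ^+ 2 =
      \sum_(i < K.*2.+1) zt ^+ (box_abs i ^ 2) * (box_abs i ^ 2)%:R ^+ 2 -
        m ^+ 2 * h.
    rewrite (eq_bigr (fun i =>
      (zt ^+ (box_abs i ^ 2) * (box_abs i ^ 2)%:R ^+ 2 -
        m ^+ 2 * zt ^+ (box_abs i ^ 2)) +
        - (2 * m) * (zt ^+ (box_abs i ^ 2) * ((box_abs i ^ 2)%:R - m)))) =>
      [|i _];
      last by lra.
    by rewrite big_split/= sumrB -!mulr_sumr mean mulr0 addr0 hE'.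
  have mh : 0 <= m ^+ 2 * h by rewrite mulr_ge0 ?sqr_ge0//; lra.
  rewrite lerBlDr -[leLHS]addr0; apply: lerD => //; apply: ler_sum => i _.
  rewrite mulrC ler_wpM2l ?sqr_ge0// -/(sq _) xyE ler_piMr ?(ltW (x0 _))//.
  by case/andP: (y01 (sq (box_abs i))).
have Dlo : p%:R * (m + d1) <= D%:R.
  rewrite -gD mulrC ler_wpM2r//; rewrite /m; lra.
have Dhi : D%:R <= p%:R * (m + d2).
  rewrite -gD mulrC ler_wpM2l//; have : E <= d2 := Ehi; rewrite /m; lra.
apply: le_trans (zeros_rate zt01 d10 tz t0 lam0 mean var Dlo Dhi pV N0 hrho) _.
rewrite lerD2r lerD2l ler_wpM2l// -/d2; have : E <= d2 := Ehi; lra.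
Qed.

End Tilt.
End ZerosFraction.

Section Lattice.
Context {R : realType}.

Lemma ballbox_gt0 p K D : (0 < #|ballbox p K D|)%N.
Proof.
apply/card_gt0P; have KK : (K < K.*2.+1)%N by rewrite ltnS -addnn leq_addr.
exists [ffun=> Ordinal KK]; rewrite inE /box_sqr_norm big1// => j _.
by rewrite ffunE /box_abs/= subrr.
Qed.

Lemma admissible_int (L : R) p g : (0 < p)%N -> admissible L p g ->
  exists2 D : nat, g * p%:R = D%:R & (0 < D)%N.
Proof.
move=> p0 [g0 /intrP[m mE] _].
have : 0 < p%:R * g by rewrite mulr_gt0// ltr0n.
rewrite mE ltr0z; case: m mE => // D mE D0; exists D => //.
by rewrite mulrC mE.
Qed.

Lemma admissible_saddle (L : R) p g : 0 < L -> admissible L p g ->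
  [/\ 0 < g, 0 < saddle g < 1, derive1 (l_fun g) (saddle g) = 0 &
      g * (1 + 2 * saddle g) <= 2 * saddle g * L].
Proof.
move=> L0 [g0 _ gL]; have [z01 zg] := saddleP g0; split => //.
move: z01 gL; set z := saddle g => /andP[z0 _] gL.
have z20 : 0 < 2 * z by rewrite mulr_gt0.
have := ler_wpM2l (ltW z20) gL; apply: le_trans.
have E : 2 * z * (1 / (2 * z)) = 1 by rewrite mul1r mulfV// gt_eqF.
have -> : 2 * z * (g * (1 + 1 / (2 * z))) =
  g * (2 * z + 2 * z * (1 / (2 * z))) by lra.
by rewrite E addrC.
Qed.

(** The competitor is p g1 rounded down to an integer, over p. [root_le] gives z <= 3 g1 / 2, hence
    z <= 1/2 and 48 z <= 72 g1 <= L - 1, so [root_half] proves it admissible. *)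
Lemma gamma_star_ge (L g1 : R) p g : 1 < L -> 0 < g1 -> g1 <= 1 / 3 ->
  72 * g1 <= L - 1 ->
  2 <= p%:R * g1 -> is_gamma_star L p g -> g1 / 2 <= g.
Proof.
move=> L1 g10 g13 g1L pg1 [_ gmax].
pose n := Num.truncn (p%:R * g1).
have pg0 : 0 <= p%:R * g1 by lra.
have n1 : n%:R <= p%:R * g1 by rewrite truncn_le.
have n2 : p%:R * g1 < n.+1%:R by exact: truncnS_gt.
have n3 : p%:R * g1 - 1 <= n%:R by move: n2; rewrite -natr1; lra.
have p0 : 0 < p%:R :> R.
  by rewrite lt_neqAle ler0n andbT; apply/eqP => pE; move: pg1;
    rewrite -pE mul0r; lra.
pose g' : R := n%:R / p%:R.
have g'p : g' * p%:R = n%:R by rewrite divfK// gt_eqF.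
have g'0 : 0 < g' by rewrite divr_gt0//; lra.
have g'1 : g' <= g1 by rewrite ler_pdivrMr// mulrC.
have g'2 : g1 / 2 <= g' by rewrite ler_pdivlMr//; lra.
apply: le_trans g'2 (gmax _ _); split => //.
  by rewrite mulrC g'p; exact: natr_int.
have [z01 zg] := saddleP g'0; move: z01 zg; set z := saddle g' => z01 zg.
have zle := root_le z01 g'0 zg; have /andP[z0 z1] := z01.
have := root_half z01 g'0 zg; have zh : z <= 1 / 2 by lra.
move=> /(_ zh) H.
have z20 : 0 < 2 * z by rewrite mulr_gt0.
rewrite -(ler_pM2l z20).
have E : 2 * z * (1 / (2 * z)) = 1 by rewrite mul1r mulfV// gt_eqF.
have -> : 2 * z * (g' * (1 + 1 / (2 * z))) =
  g' * (2 * z + 2 * z * (1 / (2 * z))) by lra.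
rewrite E addrC; apply: le_trans H _; rewrite ler_pM2l//; lra.
Qed.

Lemma natr_large (c : R) : exists n0 : nat, forall p, (n0 <= p)%N -> c <= p%:R.
Proof.
exists (Num.truncn c).+1 => p np; apply: (@le_trans _ _ (Num.truncn c).+1%:R).
  exact/ltW/truncnS_gt.
by rewrite ler_nat.
Qed.

(** Here [kap] bounds the fourth power of the tilted point from below. Of the surplus 2 [kap] in h,
    one [kap] pays for replacing the tilted point by z and the other is the k of [final_rate]. Each
    of the three errors is at most [r], and 3 r <= kap^2 / 192. *)
Lemma ratio_core (p D : nat) (g z q a0 g0 k1 t eta : R) (j0 : 'I_p) :
  let C := (1 - q)^-1 in let kap := (a0 / 2) ^+ 4 in let r := kap ^+ 2 / 768 in
  0 < z < 1 -> 0 < g -> derive1 (l_fun g) z = 0 -> 0 < q < 1 -> z <= q ^+ 3 ->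
  g * p%:R = D%:R -> (2 <= D)%N -> g0 <= g -> 0 < a0 -> a0 <= 1 -> a0 <= z ->
  0 < k1 -> k1 <= g0 -> k1 <= 3 * a0 ^+ 4 -> expR (- t) = a0 / 2 -> 0 <= t ->
  0 < eta -> eta <= kap / 2 -> t * (2 * (eta * (2 * C ^+ 3))) <= r ->
  p%:R^-1 <= r -> t * (2 * (2 * (C ^+ 3 / D.+1%:R))) <= r ->
  2 * (2 * C ^+ 3) <= p%:R * (eta * k1 / (1 + 2 * C)) ^+ 2 ->
  \sum_(w in ballbox p D D) (box_abs (w j0) == 0)%:R * (1 + 2 * z) <=
    #|ballbox p D D|%:R.
Proof.
move=> C kap r z01 g_gt0 zg q01 zq gD D2 g0g a00 a01 a0z k10 k1g k1a tE t0
  eta0 eta1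
  hr1 hr2 hr3 pV.
have /andP[z0 z1] := z01.
have p0 : (0 < p)%N by apply: leq_ltn_trans (ltn_ord j0).
have kap0 : 0 < kap by apply: exprn_gt0; lra.
have kap1 : kap <= 1 by apply: exprn_ile1; lra.
have gDD : g <= (D.+1 ^ 2)%:R.
  apply: (@le_trans _ _ D%:R); first by rewrite -gD ler_peMr ?ler1n// ltW.
  by rewrite ler_nat expnS expn1 (leq_trans (leqnSn D))// leq_pmulr.
have eta01 : 0 < eta <= 1 / 2 by apply/andP; split; lra.
pose zt := z * (1 - eta).
have zt2 : a0 / 2 <= zt.
  have : z * (1 / 2) <= zt by rewrite /zt ler_pM2l//; lra.
  lra.
have N0 := ballbox_gt0 p D D.
pose N : R := #|ballbox p D D|%:R; have Nr : 0 < N by rewrite ltr0n.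
pose Z : R := \sum_(w in ballbox p D D) (box_abs (w j0) == 0)%:R.
pose rho := Z / N.
have hrho : Z = rho * N by rewrite divfK// gt_eqF.
have lam0 : 0 <= kap / 8 by lra.
have tz : expR (- t) <= zt by rewrite tE.
have H := tilt_rate z01 g_gt0 zg q01 zq eta01 g0g a00 a0z D2 gDD tz t0
  lam0 k10 k1g
  k1a gD pV N0 hrho.
rewrite -mulr_suml -/Z -/N.
suff : rho * (1 + 2 * z) <= 1.
  by move=> /(ler_wpM2r (ltW Nr)); rewrite mul1r hrho mulrAC.
apply: (final_rate _ _ erefl _ _ H).
- by rewrite z0 ltW.
- by rewrite kap0.
- have zt0 : 0 < zt by apply: lt_le_trans zt2; lra.
  have := sqr_sum_ge2 zt0 D2.
  have zt4 : kap <= zt ^+ 4 by rewrite lerXn2r// nnegrE; lra.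
  have ze : z * eta <= eta by rewrite ler_piMl// ltW.
  have ztE : zt = z - z * eta by rewrite /zt mulrBr mulr1.
  move: zt4 ze ztE eta1; rewrite -/zt; set S := sqr_sum _ _; set x :=
    zt ^+ 4; clear.
  set y := z * eta; set x1 := zt; set k := kap; clearbody S x y x1 k; lra.
- rewrite -/C; move: hr1 hr2 hr3 (sqr_ge0 kap); rewrite /r.
  set c := C ^+ 3 / _; set c3 := C ^+ 3; set pi := p%:R^-1.
  clearbody c c3 pi kap; clear; lra.
Qed.

Lemma lattice_ratio (L : R) : 0 < L -> exists d0 : nat,
  forall (p D : nat) (g : R),
  (d0 <= p)%N -> (0 < p)%N -> is_gamma_star L p g -> g * p%:R = D%:R ->
  forall j0 : 'I_p, \sum_(w in ballbox p D D) (box_abs (w j0) == 0)%:R *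
    (1 + 2 * saddle g)
    <= #|ballbox p D D|%:R.
Proof.
move=> L0.
have [L1|L1] := lerP L 1.
  (* For L <= 1 no radius is admissible, by [root_gt]. *)
  exists 0%N => p D g _ p0 [/(admissible_saddle L0)[g0 z01 zg H] _].
  have := root_gt z01 zg; have /andP[z0 _] := z01.
  have : 2 * saddle g * L <= 2 * saddle g * 1 by rewrite ler_pM2l// mulr_gt0.
  lra.
pose g1 := Num.min (1 / 3) ((L - 1) / 72).
have g10 : 0 < g1 by rewrite lt_min; apply/andP; split; lra.
have g13 : g1 <= 1 / 3 by rewrite ge_min lexx.
have g1L : 72 * g1 <= L - 1.
  have : g1 <= (L - 1) / 72 by rewrite ge_min lexx orbT.
  lra.
clearbody g1.
have [q [q01 qP]] := root_upper_bound L0.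
pose C := (1 - q)^-1.
have C30 : 0 < C ^+ 3 by apply: exprn_gt0; rewrite invr_gt0; lra.
pose g0 := g1 / 2.
have g00 : 0 < g0 by rewrite /g0; lra.
(* A lower bound for z: g <= g (1 + 2 z) <= 2 z L. *)
pose a0 := g0 / (2 * L).
have a0L : a0 * (2 * L) = g0 by rewrite divfK// gt_eqF//; lra.
have a00 : 0 < a0 by apply: divr_gt0; lra.
have a01 : a0 <= 1 by rewrite /a0 ler_pdivrMr ?mul1r /g0; lra.
pose kap := (a0 / 2) ^+ 4.
have kap0 : 0 < kap by apply: exprn_gt0; lra.
pose k1 := Num.min g0 (3 * a0 ^+ 4).
have k10 : 0 < k1.
  by rewrite lt_min g00/=; apply: mulr_gt0; [lra|exact: exprn_gt0].
have k1g : k1 <= g0 by rewrite ge_min lexx.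
have k1a : k1 <= 3 * a0 ^+ 4 by rewrite ge_min lexx orbT.
clearbody k1.
pose t := - ln (a0 / 2).
have t0 : 0 <= t by rewrite oppr_ge0 ln_le0//; lra.
have tE : expR (- t) = a0 / 2 by rewrite opprK lnK// posrE; lra.
clearbody t.
pose r := kap ^+ 2 / 768.
have r0 : 0 < r by apply: divr_gt0; [exact: exprn_gt0|rewrite ltr0n].
have s0 : 0 < t * (4 * C ^+ 3) + 1.
  by apply: ltr_wpDl => //; apply: mulr_ge0 => //; lra.
pose eta := Num.min (kap / 2) (r / (t * (4 * C ^+ 3) + 1)).
have eta0 : 0 < eta by rewrite lt_min; apply/andP; split; apply: divr_gt0.
have eta1 : eta <= kap / 2 by rewrite ge_min lexx.
have eta2 : t * (2 * (eta * (2 * C ^+ 3))) <= r.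
  have : eta <= r / (t * (4 * C ^+ 3) + 1) by rewrite ge_min lexx orbT.
  rewrite ler_pdivlMr//; move: eta0; clear; set c := C ^+ 3;
    clearbody c eta r; lra.
clearbody eta.
pose d1 := eta * k1 / (1 + 2 * C).
have d10 : 0 < d1.
  have C0 : 0 < C by rewrite invr_gt0; lra.
  by apply: divr_gt0; [exact: mulr_gt0|lra].
have [n1 hn1] := natr_large (2 / g0).
have [n2 hn2] := natr_large (r^-1).
have [n3 hn3] := natr_large (t * (4 * C ^+ 3) / g0 / r).
have [n4 hn4] := natr_large (2 * (2 * C ^+ 3) / d1 ^+ 2).
exists (maxn (maxn n1 n2) (maxn n3 n4)) => p D g; rewrite !geq_max.
move=> /andP[/andP[/hn1 p1 /hn2 p2] /andP[/hn3 p3 /hn4 p4]] p_gt0 gs gD j0.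
have pr : 0 < p%:R :> R by rewrite ltr0n.
have [gam0 z01 zg gL] := admissible_saddle L0 gs.1.
rewrite ler_pdivrMr// in p1.
have gg0 : g0 <= g.
  apply: (gamma_star_ge L1 g10 g13 g1L _ gs).
  by apply: le_trans p1 _; rewrite ler_pM2l// /g0; lra.
move: z01 zg gL; set z := saddle g => z01 zg gL; have /andP[z0 z1] := z01.
have gLe : g <= L.
  have zg' : 0 <= g * z by rewrite mulr_ge0// ltW.
  by rewrite -(ler_pM2r z0); lra.
have a0z : a0 <= z.
  rewrite /a0 ler_pdivrMr; last by lra.
  by apply: le_trans gg0 _; move: gL; have : 0 <= g * z :=
    mulr_ge0 (ltW gam0) (ltW z0); lra.
have D2 : (2 <= D)%N.
  by rewrite -(ler_nat R) -gD; apply: le_trans p1 _; rewrite mulrC ler_pM2r.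
apply: (@ratio_core p D g z q a0 g0 k1 t eta j0) => //; rewrite -/C -/kap -/r.
- exact: qP zg gLe.
- by rewrite -[r]invrK lef_pV2 ?posrE ?invr_gt0.
- have Dp : g0 * p%:R <= D.+1%:R.
    apply: (@le_trans _ _ D%:R); last by rewrite ler_nat.
    by rewrite -gD ler_pM2r.
  have -> : t * (2 * (2 * (C ^+ 3 / D.+1%:R))) = t * (4 * C ^+ 3) / D.+1%:R.
    by set i := (_^-1); clearbody i; lra.
  rewrite ler_pdivrMr//; rewrite ler_pdivrMr// ler_pdivrMr// in p3.
  apply: le_trans p3 _; apply: le_trans (ler_wpM2l (ltW r0) Dp).
  by rewrite -mulrA mulrC -mulrA.
- by rewrite -ler_pdivrMr// exprn_gt0.
Qed.

End Lattice.

(** * Counting lattice points through the box *)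

Section LatticeCount.
Context {R : realType}.

Lemma card_fset_set_image (T : finType) (U : choiceType) (f : T ->
  U) (A : {set T})
    (B : set U) : injective f -> B = f @` [set` A] -> #|` fset_set B|%N = #|A|.
Proof.
move=> finj ->.
rewrite (_ : fset_set _ = [fset f x | x in A]%fset).
  by rewrite card_imfset//= -cardE.
apply/fsetP => u; rewrite in_fset_set; last exact/finite_image/finite_finset.
apply/idP/imfsetP => /= [|[x xA ->]]; last by rewrite inE; exists x.
by rewrite inE => -[x xA <-]; exists x.
Qed.

Variables (p K : nat).
Notation box := {ffun 'I_p -> 'I_K.*2.+1}.

Definition box_freq (w : box) : freq p := [ffun j => (w j)%:Z - K%:Z].

Lemma box_freq_inj : injective box_freq.
Proof.
move=> w w' /ffunP E; apply/ffunP => j; apply: val_inj; have := E j.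
by rewrite !ffunE => /addIr [].
Qed.

Lemma box_freqP (k : freq p) : (forall j, `|k j|%N <= K)%N -> exists w,
  box_freq w = k.
Proof.
move=> kK.
have b j : (`|(k j + K%:Z)%R|%N < K.*2.+1)%N.
  have := kK j; rewrite -addnn; lia.
exists [ffun j => Ordinal (b j)]; apply/ffunP => j; rewrite !ffunE /=.
have := kK j; lia.
Qed.

Lemma box_freq_sqr (w : box) j : ((box_freq w j)%:~R ^+ 2 : R) =
  (box_abs (w j) ^ 2)%:R.
Proof.
by rewrite ffunE /box_abs natrX -[LHS]real_normK ?num_real// -intr_norm -abszE
  -pmulrn.
Qed.

Lemma sum_box_freq_sqr (w : box) : \sum_j ((box_freq w j)%:~R ^+ 2 : R) =
  (box_sqr_norm w)%:R.
Proof. by rewrite /box_sqr_norm natr_sum; apply: eq_bigr => j _;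
  exact: box_freq_sqr. Qed.

Lemma ball1_coord_le (k : freq p) (g : R) j :
  ball1 g k -> (`|k j|%N ^ 2)%:R <= g * p%:R.
Proof.
move=> kg; apply: le_trans kg; rewrite (bigD1 j)//= natrX.
rewrite -[X in _ <= X + _]real_normK ?num_real// -intr_norm -abszE
  -pmulrn lerDl.
by apply: sumr_ge0 => i _; exact: sqr_ge0.
Qed.

Lemma ball1_box (g : R) : g * p%:R <= K%:R -> @ball1 R p g `<=` range box_freq.
Proof.
move=> gK k kg; have [j|w <-] := @box_freqP k; last by exists w.
rewrite -(ler_nat R); apply: le_trans gK; apply: le_trans (ball1_coord_le j kg).
by rewrite ler_nat expnS expn1; case: (`|k j|%N) => // m; rewrite leq_pmulr.
Qed.

End LatticeCount.

Section LatticeCount2.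
Context {R : realType} (p : nat).

Lemma finite_ball1 (g : R) : finite_set (@ball1 R p g).
Proof.
have gK : g * p%:R <= (Num.truncn (g * p%:R)).+1%:R by exact/ltW/truncnS_gt.
exact: sub_finite_set (ball1_box gK) (finite_image _ finite_finset).
Qed.

Lemma le_N1 (g g' : R) : g <= g' -> (N1 p g <= N1 p g')%N.
Proof.
move=> gg'; apply: fsubset_leq_card; rewrite -fset_set_sub;
  try exact: finite_ball1.
by move=> k kg; apply: le_trans kg _; rewrite ler_wpM2r.
Qed.

Variables (g : R) (D : nat).
Hypothesis gD : g * p%:R = D%:R.

Lemma N1_ballbox : N1 p g = #|ballbox p D D|.
Proof.
apply: card_fset_set_image (@box_freq_inj p D) _.
apply/seteqP; split => [k kg|_ [w wD <-]].
  have [w _ wk] : range (@box_freq p D) k by apply: ball1_box kg; rewrite gD.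
  exists w => //=; move: kg;
    rewrite /ball1/= -wk sum_box_freq_sqr gD ler_nat inE.
  by [].
by rewrite /ball1/= sum_box_freq_sqr gD ler_nat; move: wD; rewrite /= inE.
Qed.

Lemma N2_ballbox (j0 : 'I_p) : j0 = 0%N :> nat ->
  (N2 p g)%:R = \sum_(w in ballbox p D D) (box_abs (w j0) == 0)%:R :> R.
Proof.
move=> j00.
rewrite -natr_sum; congr (_%:R).
pose A2 := [set w in ballbox p D D | box_abs (w j0) == 0%N]%SET.
transitivity #|A2|; last first.
  rewrite -sum1_card (eq_bigl (fun w =>
    (w \in ballbox p D D) && (box_abs (w j0) == 0%N))).
    by rewrite big_mkcondr; apply: eq_bigr => w _; case: eqP.
  by move=> w; rewrite [LHS]inE.
apply: card_fset_set_image (@box_freq_inj p D) _.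
have ab0 (w : {ffun 'I_p -> 'I_D.*2.+1}) :
    (box_freq w j0 = 0) <-> (box_abs (w j0) == 0%N).
  by rewrite ffunE /box_abs; split => [->|/eqP/eqP];
    rewrite ?absz_eq0// => /eqP.
have jE (j : 'I_p) : ~~ (0 < j)%N -> j = j0.
  by rewrite -eqn0Ngt => /eqP j0'; apply: val_inj; rewrite /= j0' j00.
have sumE (k : freq p) : k j0 = 0 ->
    \sum_(j < p | (0 < j)%N) (k j)%:~R ^+ 2 = \sum_j (k j)%:~R ^+ 2 :> R.
  move=> k0; rewrite [RHS](bigID (fun j : 'I_p => (0 < j)%N))/= [X in _ + X]big1
    ?addr0//.
  by move=> j /jE ->; rewrite k0 expr0n.
apply/seteqP; split => [k [kg k0]|_ [w wA <-]].
  have {}k0 := k0 j0 j00; rewrite sumE// in kg.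
  have [w _ wk] : range (@box_freq p D) k by apply: ball1_box kg; rewrite gD.
  exists w => //=; rewrite inE; apply/andP; split.
    by move: kg; rewrite -wk sum_box_freq_sqr gD ler_nat inE.
  by apply/ab0; rewrite wk.
move: wA; rewrite /= inE => /andP[wD /ab0 w0]; split.
  by rewrite sumE// sum_box_freq_sqr gD ler_nat; move: wD; rewrite inE.
by move=> j j0'; rewrite (jE j) ?j0'.
Qed.

End LatticeCount2.

(** * The least favourable functions *)

Section Embedding.
Context {R : realType} (d p : nat) (x0 : 'I_d) (J : {set 'I_d}).
Hypothesis cJ : #|J| = p.

Definition embed_idx (j : 'I_p) : 'I_d := nth x0 (enum J) j.

(** When J has p elements the sum has at most one term, and it is empty, hence zero, outside J. *)
Definition embed_freq (k : freq p) : freq d :=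
  [ffun i => \sum_(j | embed_idx j == i) k j].

Let szJ : size (enum J) = p. Proof. by rewrite -cardE. Qed.

Lemma embed_idx_inj : injective embed_idx.
Proof.
move=> j j' /eqP; rewrite nth_uniq ?szJ ?enum_uniq//;
  first by move=> /eqP/val_inj.
Qed.

Lemma embed_idx_in j : embed_idx j \in J.
Proof. by rewrite -mem_enum mem_nth// szJ. Qed.

Lemma embed_idxP i : i \in J -> exists j, embed_idx j = i.
Proof.
rewrite -mem_enum => iJ; have lt : (index i (enum J) < p)%N by rewrite -szJ
  index_mem.
by exists (Ordinal lt); rewrite /embed_idx nth_index.
Qed.

Lemma embed_freq_at k j : embed_freq k (embed_idx j) = k j.
Proof.
rewrite ffunE (eq_bigl (pred1 j)) ?big_pred1_eq// => j'.
by rewrite (inj_eq embed_idx_inj).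
Qed.

Lemma embed_freq_out k i : i \notin J -> embed_freq k i = 0.
Proof.
move=> iJ; rewrite ffunE big1// => j /eqP ji.
by move: iJ; rewrite -ji embed_idx_in.
Qed.

Lemma embed_freq_inj : injective embed_freq.
Proof. by move=> k k' /ffunP E; apply/ffunP => j; have := E (embed_idx j);
  rewrite !embed_freq_at. Qed.

Lemma sum_embed_freq (V : nmodType) (F : int -> V) (k : freq p) : F 0 = 0 ->
  \sum_i F (embed_freq k i) = \sum_j F (k j).
Proof.
move=> F0; rewrite (bigID (mem J))/= [X in _ + X]big1 ?addr0; last first.
  by move=> i iJ; rewrite embed_freq_out.
rewrite -big_enum/= (big_nth x0) szJ big_mkord; apply: eq_bigr => j _.
by rewrite -[nth _ _ _]/(embed_idx j) embed_freq_at.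
Qed.

Lemma embed_freq_S_freq (L g : R) (k : freq p) : g <= L -> ball1 g k ->
  S_freq (Num.sqrt (p%:R * L)) p (embed_freq k).
Proof.
move=> gL kg; split.
  rewrite /norm2 (@sum_embed_freq R (fun m : int => m%:~R ^+ 2) k) ?expr0n//.
  by rewrite ler_wsqrtr// (le_trans kg)// mulrC ler_wpM2l.
rewrite /norm0 -cJ; apply: subset_leq_card; apply/fintype.subsetP => i;
  rewrite inE.
by apply: contraNT => /embed_freq_out ->.
Qed.

Lemma dot_embed_freq_subvec (k : freq p) (x y : vec R d) :
  subvec J x = subvec J y -> dot (embed_freq k) x = dot (embed_freq k) y.
Proof.
move=> xy; apply: eq_bigr => i _.
have [iJ|/embed_freq_out ->] := boolP (i \in J); last by rewrite !mul0r.
congr (_ * _).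
have := congr1 (fun t => tnth t (enum_rank_in iJ i)) xy.
by rewrite !tnth_mktuple enum_rankK_in.
Qed.

Variables (KT : finType) (e : KT -> freq p) (b : KT -> R).

(** The factor evaluates the polynomial at some chosen point with the given coordinates in J; the
    choice is harmless because all frequencies vanish outside J. *)
Lemma fourier_poly_embed_factor : exists fbar : vec R #|J| -> R,
  forall x, fourier_poly (fun i => embed_freq (e i)) b x = fbar (subvec J x).
Proof.
pose f := fourier_poly (fun i => embed_freq (e i)) b.
exists (fun y => f (xget point [set x | subvec J x = y])) => x.
have E : subvec J (xget point [set y | subvec J y = subvec J x]) = subvec J x.
  exact: (@xgetPex _ point [set y | subvec J y =
    subvec J x] (ex_intro _ x erefl)).
by apply: eq_bigr => i _; rewrite !fourierE /wave (dot_embed_freq_subvec _ E).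
Qed.

End Embedding.

Section TestFunctions.
Context {R : realType} (d p D : nat) (x0 : 'I_d) (L g A : R) (j0 : 'I_p).
Notation KT := {w in ballbox p D D}.
Notation N := (#|ballbox p D D|%:R : R).
Notation Z := (\sum_(w in ballbox p D D) (box_abs (w j0) == 0)%:R : R).
Hypothesis gD : g * p%:R = D%:R.
Hypothesis A2 : A ^+ 2 * (N - Z) = 1.
Hypothesis gL : g * N <= L * (N - Z).
Hypothesis L0 : 0 < L.

Definition test_freq (J : {set 'I_d}) (w : KT) : freq d :=
  embed_freq x0 J (box_freq (val w)).
Definition test_fun (J : {set 'I_d}) (s : {ffun KT -> bool}) : vec R d -> R :=
  fourier_poly (test_freq J) (fun w => A * bool_sign (s w)).

Let p0 : (0 < p)%N. Proof. exact: leq_ltn_trans (ltn_ord j0). Qed.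

Section Pattern.
Variables (J : {set 'I_d}) (s : {ffun KT -> bool}).
Hypothesis cJ : #|J| = p.

Lemma test_freq_inj : injective (test_freq J).
Proof. by move=> w w' /(embed_freq_inj cJ)/box_freq_inj/val_inj. Qed.

Let bsq (w : KT) : (A * bool_sign (s w)) ^+ 2 = A ^+ 2.
Proof. by rewrite exprMn [bool_sign _ ^+ 2]bool_sign_sqr mulr1. Qed.

(** By symmetry each coordinate carries a fraction 1 / p of the total squared norm, which is at most
    D = g p for each point. *)
Lemma sum_ballbox_sqr (j : 'I_p) :
  \sum_(w in ballbox p D D) (box_abs (w j) ^ 2)%:R <= g * N.
Proof.
have pr : 0 < p%:R :> R by rewrite ltr0n.
rewrite -(ler_pM2l pr).
have -> : p%:R * \sum_(w in ballbox p D D) (box_abs (w j) ^ 2)%:R =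
    \sum_(w in ballbox p D D) (box_sqr_norm w)%:R :> R.
  under [RHS]eq_bigr do rewrite /box_sqr_norm natr_sum.
  rewrite [RHS]exchange_big/= [RHS](eq_bigr (fun=> \sum_(w in ballbox p D D)
    (box_abs (w j) ^ 2)%:R)).
    by rewrite sumr_const card_ord mulr_natl.
  by move=> j' _; exact: (sum_ballbox_sym D (fun i => (box_abs i ^ 2)%:R : R)).
rewrite mulrA [p%:R * g]mulrC gD mulrC mulr_natl -sumr_const.
by apply: ler_sum => w; rewrite inE ler_nat.
Qed.

Lemma test_fun_sobolev (i : 'I_d) :
  (\esum_(k in [set: freq d]) ((k i)%:~R ^+ 2 * theta (test_fun J s) k ^+
    2)%R%:E <= L%:E)%E.
Proof.
rewrite (esum_theta_fourier_poly test_freq_inj _ _ (w := fun k : freq d =>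
  (k i)%:~R ^+ 2)); last first.
  by move=> k; exact: sqr_ge0.
rewrite lee_fin.
rewrite (eq_bigl xpredT) => [|w]; last by rewrite in_setT.
rewrite (eq_bigr (fun w : KT => A ^+ 2 * (test_freq J w i)%:~R ^+ 2));
  last first.
  by move=> w _; rewrite bsq mulrC.
rewrite -mulr_sumr; have [iJ|iJ] := boolP (i \in J); last first.
  rewrite big1 ?mulr0 ?(ltW L0)// => w _.
  by rewrite /test_freq (embed_freq_out x0 cJ)// expr0n.
have [j ji] := embed_idxP x0 cJ iJ.
rewrite (eq_bigr (fun w : KT => (box_abs (val w j) ^ 2)%:R)); last first.
  by move=> w _; rewrite /test_freq -ji (embed_freq_at x0 cJ) box_freq_sqr.
rewrite -(big_sub (mem (ballbox p D D)) (fun w => (box_abs (w j) ^ 2)%:R)).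
apply: (@le_trans _ _ (A ^+ 2 * (L * (N - Z))));
  last by rewrite mulrCA A2 mulr1.
rewrite ler_wpM2l ?sqr_ge0//; apply: le_trans gL; exact: sum_ballbox_sqr.
Qed.

(** N - Z counts the points whose coordinate [j0], or by symmetry any other, is nonzero. Each
    contributes A^2. *)
Lemma test_fun_Q (i : 'I_d) : i \in J -> Q (test_fun J s) i = 1%E.
Proof.
move=> iJ; rewrite /Q; under eq_esum do rewrite -[_ ^+ 2]mul1r.
rewrite (esum_theta_fourier_poly test_freq_inj _ _ (w := fun=> 1))//.
have [j ji] := embed_idxP x0 cJ iJ; congr (_%:E); rewrite -[RHS]A2.
rewrite big_mkcond/= (eq_bigr (fun w : KT =>
  A ^+ 2 * (1 - (box_abs (val w j) == 0)%:R))).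
  rewrite -mulr_sumr -(big_sub (mem (ballbox p D D)) (fun w =>
    1 - (box_abs (w j) == 0)%:R)).
  rewrite sumrB sumr_const; congr (_ * (_ - _)).
  exact: (sum_ballbox_sym D (fun i => (box_abs i == 0)%:R : R)).
move=> w _; rewrite mul1r bsq.
have -> : (test_freq J w \in [set k : freq d | k i != 0]) =
  (box_abs (val w j) != 0%N).
  apply/idP/idP; rewrite in_setE /= /test_freq -ji (embed_freq_at x0 cJ)
    ffunE /box_abs absz_eq0//.
by case: (_ == _); rewrite ?subrr ?mulr0 ?subr0 ?mulr1.
Qed.

Lemma test_fun_is_pattern : is_pattern p (test_fun J s) J.
Proof.
split; first by rewrite cJ.
  exact: fourier_poly_embed_factor.
by move=> i iJ; rewrite test_fun_Q.
Qed.

Lemma test_fun_pattern : pattern p (test_fun J s) = J.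
Proof. exact: (fourier_poly_pattern test_fun_is_pattern). Qed.

Lemma test_fun_Sigma : Sigma L p (test_fun J s).
Proof.
split; [|exact: test_fun_sobolev|by exists J; exact: test_fun_is_pattern].
by rewrite /test_fun fourier_polyE; exact: integrable_phased_poly.
Qed.

End Pattern.
End TestFunctions.

Lemma gram_diag_le (R : realType) n d (X : 'I_n -> vec R d) (k : freq d) :
  \sum_i fourier k (X i) * fourier k (X i) <= 2 * n%:R.
Proof.
apply: (@le_trans _ _ (\sum_(i < n) 2));
  last by rewrite sumr_const card_ord mulr_natr.
apply: ler_sum => i _; rewrite fourierE mulrACA -!expr2 sqr_sqrtr//.
rewrite ler_piMr// -[leLHS]real_normK ?num_real// exprn_ile1// cos_max//.
Qed.

Theorem theorem2 (R : realType) (L alpha : R) (hL : 0 < L) (halpha : 0 < alpha)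
    (halpha' : alpha < (ln 3 - ln 2) / ln 3) :
  exists c : R, 0 < c /\ exists d0 : nat,
  forall n d dstar : nat,
    (0 < n)%N -> (0 < d)%N -> (0 < dstar)%N -> (d0 <= dstar <= d)%N ->
  forall X : 'I_n -> vec R d,
    (forall i, cube (X i)) ->
    (forall k k' : freq d,
       S_freq (Num.sqrt (dstar%:R * L)) dstar k ->
       S_freq (Num.sqrt (dstar%:R * L)) dstar k' ->
       k <> k' ->
       `| n%:R^-1 * \sum_(i < n) fourier k (X i) * fourier k' (X i) |
         <= n%:R / (N1 dstar L)%:R ^+ 2) ->
  forall gamma : R,
    is_gamma_star L dstar gamma ->
    ((N1 dstar gamma)%:R - (N2 dstar gamma)%:R) ^+ 2 * ln ('C(d, dstar))%:R
      / (n%:R ^+ 2 * (N1 dstar gamma)%:R) >= 5 / alpha ->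
  (c%:E <= minimax_error L dstar X)%E.
Proof.
have ln2 : 0 < ln 2 :> R by rewrite ln_gt0// ltr1n.
have alpha1 : alpha < 1.
  have ln3 : 0 < ln 3 :> R by rewrite ln_gt0// ltr1n.
  apply: lt_trans halpha' _; rewrite ltr_pdivrMr//; lra.
pose v : R := expR (- ((1 - alpha) / 2 * ln 2)).
have v1 : v < 1 by rewrite /v expR_lt1 oppr_lt0 mulr_gt0//; lra.
(* The average success probability will be at most v. Since [exists_error_ge] needs a strict bound,
   it is applied with the midpoint r = (1 + v) / 2, and c = 1 - r. *)
exists ((1 - v) / 2); split; first lra.
have [d0 hd0] := lattice_ratio hL.
exists d0 => n d p n0 d_gt0 p0 /andP[d0p pd] X _ hX gamma gs hyp.
have [D gD D0] := admissible_int p0 gs.1.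
have [g0 z01 _ gzL] := admissible_saddle hL gs.1.
have /andP[z0 z1] := z01.
have gL : gamma <= L.
  have gz0 : 0 <= gamma * saddle gamma by rewrite mulr_ge0// ltW.
  by rewrite -(ler_pM2r z0); lra.
pose j0 : 'I_p := Ordinal p0; pose x0 : 'I_d := Ordinal d_gt0.
have N1E := N1_ballbox gD; have N2E := @N2_ballbox R p gamma D gD j0 erefl.
have ratio := hd0 p D gamma d0p p0 gs gD j0.
have hN := le_N1 p gL.
move: hyp; rewrite N2E; rewrite N1E in hN *; rewrite -mulr_suml in ratio.
have Npos := ballbox_gt0 p D D.
set N : R := #|ballbox p D D|%:R in ratio *.
set Z := \sum_(w in ballbox p D D) _ in ratio *.
have Nr : 0 < N by rewrite ltr0n.
have Z0 : 0 <= Z by exact: sumr_ge0.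
have NZ : 2 * saddle gamma * Z <= N - Z by lra.
have NZ0 : 0 < N - Z.
  have [Zp|] := ltrP 0 Z; last by lra.
  by apply: lt_le_trans NZ; rewrite !mulr_gt0.
have gNL : gamma * N <= L * (N - Z).
  (* Multiply by 2 z: the lattice bound turns 2 z gamma N into at most gamma (1 + 2 z)(N - Z), and
     admissibility bounds this by 2 z L (N - Z). *)
  have z20 : 0 < 2 * saddle gamma by rewrite mulr_gt0.
  rewrite -(ler_pM2l z20).
  have := ler_wpM2r (ltW NZ0) gzL; have := ler_wpM2l (ltW g0) NZ; lra.
pose A := Num.sqrt (N - Z)^-1.
have A2 : A ^+ 2 = (N - Z)^-1 by rewrite sqr_sqrtr// invr_ge0 ltW.
have A2E : A ^+ 2 * (N - Z) = 1 by rewrite A2 mulVf// gt_eqF.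
pose M := 'C(d, p).
have M0 : (0 < M)%N by rewrite bin_gt0.
have Mr : 0 < M%:R :> R by rewrite ltr0n.
have nr : 0 < n%:R :> R by rewrite ltr0n.
rewrite ler_pdivlMr ?mulr_gt0 ?exprn_gt0// -/M => hyp.
have {}hyp : 5 * (n%:R ^+ 2 * N) <= alpha * ((N - Z) ^+ 2 * ln M%:R).
  have := ler_wpM2l (ltW halpha) hyp; rewrite (mulrA alpha (5 / alpha)).
  by rewrite [alpha * (5 / alpha)]mulrC divfK// gt_eqF.
have lnM : 0 < ln M%:R :> R.
  rewrite -(pmulr_rgt0 _ (exprn_gt0 2 NZ0)) -(pmulr_rgt0 _ halpha).
  by apply: lt_le_trans hyp; rewrite !mulr_gt0// exprn_gt0.
(* The hypothesis forces ln M > 0, so there are at least two candidate sets and the final bound does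
   not depend on M. *)
have M2 : ln 2 <= ln M%:R :> R.
  rewrite ler_ln ?posrE// ler_nat ltnNge; apply/negP => M1.
  by move: lnM; rewrite (_ : M = 1%N) ?ln1 ?ltxx//; apply/eqP;
    rewrite eqn_leq M1.
pose B := expR (alpha * ln M%:R : R).
pose HD := [set J : {set 'I_d} | #|J| == p]%SET.
have HDM : #|HD| = M by rewrite card_draws card_ord.
pose W : finType := {ffun {w in ballbox p D D} -> bool}.
pose a (J : {set 'I_d}) (s : W) (i : 'I_n) : R := test_fun x0 A J s (X i).
have NL : 0 < (N1 p L)%:R :> R by rewrite ltr0n (leq_trans Npos hN).
have cK : #|{: {w in ballbox p D D}}| = #|ballbox p D D|.
  by rewrite card_sig; apply: eq_card => w; rewrite inE.
(* The constant 5 is 4 + 1. Squared basis functions are at most 2, so the diagonal part is 4 A^4 n^2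
   N. As N is at most the count for radius L, the off-diagonal part is at most A^2 n^2 = A^4 (N - Z)
   n^2 <= A^4 n^2 N. *)
have expo : A ^+ 4 * (2 * n%:R) ^+ 2 * N +
    A ^+ 2 * (n%:R * (n%:R / (N1 p L)%:R ^+ 2)) * N ^+ 2 <= alpha * ln M%:R.
  have A40 : 0 <= A ^+ 4 by rewrite exprn_even_ge0.
  have A4 : A ^+ 4 * (N - Z) ^+ 2 = 1.
    by rewrite (exprM A 2 2) -exprMn A2E expr1n.
  have A24 : A ^+ 2 = A ^+ 4 * (N - Z).
    by rewrite (exprD A 2 2) -mulrA A2E mulr1.
  have q1 : n%:R / (N1 p L)%:R ^+ 2 * N ^+ 2 <= n%:R.
    rewrite mulrAC ler_pdivrMr ?exprn_gt0// ler_pM2l//.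
    by rewrite lerXn2r// ?nnegrE// ler_nat.
  have q2 : (N - Z) * (n%:R * (n%:R / (N1 p L)%:R ^+ 2 * N ^+ 2)) <=
      N * (n%:R * n%:R).
    apply: ler_pM => //; first exact: ltW.
    - by rewrite !mulr_ge0// ?invr_ge0 exprn_ge0// ltW.
    - by rewrite lerBlDr lerDl.
    - by rewrite ler_pM2l.
  have := ler_wpM2l A40 q2; have := ler_wpM2l A40 hyp.
  rewrite (_ : A ^+ 4 * (alpha * ((N - Z) ^+ 2 * ln M%:R)) =
    A ^+ 4 * (N - Z) ^+ 2 * (alpha * ln M%:R)); last by lra.
  rewrite A4 A24 mul1r; set w := n%:R / _; clearbody w; clear; lra.
have hB J w' : J \in HD -> \sum_w expR (\sum_i a J w i * a J w' i) <=
  #|W|%:R * B.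
  rewrite inE => /eqP cJ.
  have e0 : 0 <= n%:R * (n%:R / (N1 p L)%:R ^+ 2) :> R.
    by rewrite mulr_ge0// divr_ge0// exprn_ge0.
  have hc (k : {w in ballbox p D D}) :
      \sum_i fourier (test_freq x0 J k) (X i) * fourier (test_freq x0 J k)
        (X i) <= 2 * n%:R.
    exact: gram_diag_le.
  have he (k k' : {w in ballbox p D D}) : k != k' ->
      `|\sum_i fourier (test_freq x0 J k) (X i) *
        fourier (test_freq x0 J k') (X i)|
      <= n%:R * (n%:R / (N1 p L)%:R ^+ 2).
    have SS (q : {w in ballbox p D D}) : S_freq (Num.sqrt (p%:R * L)) p
      (test_freq x0 J q).
      apply: (embed_freq_S_freq x0 cJ gL).
      rewrite /ball1/= sum_box_freq_sqr gD ler_nat.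
      by have := valP q; rewrite inE.
    move=> /eqP kk'; have := hX _ _ (SS k) (SS k').
    have kN : test_freq x0 J k <> test_freq x0 J k'
      by move=> /(test_freq_inj cJ).
    move=> /(_ kN); rewrite normrM ger0_norm ?invr_ge0//.
    by rewrite mulrC ler_pdivrMr// mulrC.
  have := sum_expR_gram_le A w' hc he e0.
  rewrite cK -/N => H.
  have aE (u : W) i : a J u i =
      A * \sum_k bool_sign (u k) * fourier (test_freq x0 J k) (X i).
    by rewrite mulr_sumr; apply: eq_bigr => k _; rewrite mulrA.
  have WE : #|W|%:R = 2 ^+ #|ballbox p D D| :> R.
    by rewrite card_ffun card_bool cK natrX.
  have HB : #|W|%:R * expR (A ^+ 4 * (2 * n%:R) ^+ 2 * N +
      A ^+ 2 * (n%:R * (n%:R / (N1 p L)%:R ^+ 2)) * N ^+ 2) <= #|W|%:R * B.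
    by rewrite ler_wpM2l// ler_expR.
  apply: le_trans HB; rewrite WE; apply: le_trans H.
  rewrite le_eqVlt; apply/orP; left; apply/eqP.
  apply: eq_bigr => w _; congr expR; apply: eq_bigr => i _.
  by rewrite !aE.
(* With B = M^alpha, this [s] balances s B and 1 / (s M): both equal M^((alpha - 1) / 2). *)
pose s := expR (- ((1 + alpha) / 2 * ln M%:R) : R).
have s0 : 0 < s by exact: expR_gt0.
have W0 : (0 < #|W|)%N by rewrite card_ffun card_bool expn_gt0.
have val_lt : s * B / 2 + (2 * s * #|HD|%:R)^-1 < (1 + v) / 2.
  rewrite HDM.
  have Me : M%:R = expR (ln M%:R) :> R by rewrite lnK// posrE.
  pose u : R := expR (- ((1 - alpha) / 2 * ln M%:R)).
  have sB : s * B = u by rewrite -expRD; congr expR; lra.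
  have sM : (s * M%:R)^-1 = u.
    by rewrite {1}Me -expRD -expRN; congr expR; lra.
  have -> : (2 * s * M%:R)^-1 = 2^-1 * (s * M%:R)^-1 by rewrite -mulrA invfM.
  rewrite sB sM.
  have : u <= v.
    by rewrite ler_expR lerN2 ler_pM2l//; lra.
  lra.
have HD0 : (0 < #|HD|)%N by rewrite HDM.
apply: le_ereal_inf_tmp => _ /= [Jt eJt <-].
have mJ J : measurable [set y | Jt y = J] by exact: (eJt [set J]).
have [J [w [JHD Hw]]] := exists_error_ge mJ hB s0 W0 val_lt HD0.
move: JHD; rewrite inE => /eqP cJ.
have fS : Sigma L p (test_fun x0 A J w).
  exact: (@test_fun_Sigma R d p D x0 L gamma A j0 gD A2E gNL hL J w cJ).
apply: le_trans (ereal_sup_ubound _); last first.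
  by exists (test_fun x0 A J w).
rewrite (@test_fun_pattern R d p D x0 A j0 A2E J w cJ) /law /pushforward.
apply: le_trans Hw; rewrite lee_fin; lra.
Qed.
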